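(* Let $\lambda>0$, $y_d\in L^2(Q_T)$, and let $(y,p)\in (H^{1,\frac12}_{0,per}(Q_T))^2$ be the solution of the reduced optimality system $$\mathcal{B}((y,p),(z,q))=\int_{Q_T} y_d\,z\,d\boldsymbol{x}\,dt\qquad\forall\,(z,q)\in (H^{1,\frac12}_{0,per}(Q_T))^2 .$$ Let $\eta,\zeta\in H^{1,1}_{0,per}(Q_T)$ and $\boldsymbol{\tau},\boldsymbol{\rho}\in H(\mathrm{div},Q_T)$, and suppose that the bilinear form $\mathcal{B}$ meets the inf-sup condition $$\tilde\mu_1\,|(w,r)|_{1,\frac12}\le \sup_{0\ne(z,q)\in (H^{1,\frac12}_{0,per}(Q_T))^2}\frac{\mathcal{B}((w,r),(z,q))}{|(z,q)|_{1,\frac12}}\qquad\forall\, w,r\in H^{1,\frac12}_{0,per}(Q_T),$$ where $\tilde\mu_1=\frac{\min\{\underline\nu,\underline\sigma\}\min\{\lambda,\frac1\lambda\}}{\sqrt2}$. Then the error $e=(y,p)-(\eta,\zeta)\in (H^{1,\frac12}_{0,per}(Q_T))^2$ satisfies $$|e|_{1,\frac12}\le \frac{1}{\tilde\mu_1}\Big(C_F\|\mathcal{R}_1(\eta,\zeta,\boldsymbol{\tau})\|+\|\mathcal{R}_2(\eta,\boldsymbol{\tau})\|+C_F\|\mathcal{R}_3(\eta,\zeta,\boldsymbol{\rho})\|+\|\mathcal{R}_4(\zeta,\boldsymbol{\rho})\|\Big),$$ where $$\mathcal{R}_1(\eta,\zeta,\boldsymbol{\tau})=\sigma\partial_t\eta+\lambda^{-1}\zeta-\mathrm{div}\,\boldsymbol{\tau},\quad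 \mathcal{R}_2(\eta,\boldsymbol{\tau})=\boldsymbol{\tau}-\nu\nabla\eta,$$ $$\mathcal{R}_3(\eta,\zeta,\boldsymbol{\rho})=\sigma\partial_t\zeta+\eta-\mathrm{div}\,\boldsymbol{\rho}-y_d,\quad \mathcal{R}_4(\zeta,\boldsymbol{\rho})=\boldsymbol{\rho}+\nu\nabla\zeta .$$
   Context: $\Omega\subset\mathbb{R}^d$, $d\in\{1,2,3\}$, is a bounded Lipschitz domain with boundary $\Gamma$; $T>0$, $\omega=2\pi/T$, $Q_T=\Omega\times(0,T)$, $\Sigma_T=\Gamma\times(0,T)$. The measurable coefficients $\sigma,\nu:\Omega\to\mathbb{R}$ satisfy $0<\underline\sigma\le\sigma\le\overline\sigma$ and $0<\underline\nu\le\nu\le\overline\nu$ with constants $\underline\sigma,\overline\sigma,\underline\nu,\overline\nu$. $\|\cdot\|$ is the $L^2(Q_T)$-norm (for scalar or vector functions; equal to $+\infty$ if the function is not square integrable), $\|\cdot\|_\Omega$ the $L^2(\Omega)$-norm, $\langle\cdot,\cdot\rangle_\Omega$ the $L^2(\Omega)$ inner product. $\nabla$ and $\mathrm{div}$ are the generalized spatial gradient and divergence, $\partial_t$ the generalized time derivative. $C_F>0$ is the Friedrichs constant of $\Omega$: $\|w\|_\Omega\le C_F\|\nabla w\|_\Omega$ for $w\in H^1_0(\Omega)$. Each $v\in L^2(Q_T)$ is expanded as $v(\boldsymbol{x},t)=v_0^c(\boldsymbol{x})+\sum_{k\ge1}(v_k^c(\boldsymbol{x})\cos(k\omega t)+v_k^s(\boldsymbol{x})\sin(k\omega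 t))$; put $\boldsymbol{v}_k=(v_k^c,v_k^s)^T$ and $\boldsymbol{v}_k^\perp=(-v_k^s,v_k^c)^T$. Define $\|\partial_t^{1/2}v\|^2:=\frac T2\sum_{k\ge1}k\omega\|\boldsymbol{v}_k\|_\Omega^2$ and $$\int_{Q_T}\sigma\,\partial_t^{1/2}y\,\partial_t^{1/2}v^\perp\,d\boldsymbol{x}\,dt:=\frac T2\sum_{k\ge1}k\omega\,\langle\sigma\boldsymbol{y}_k,\boldsymbol{v}_k^\perp\rangle_\Omega .$$ $H^{1,\frac12}_{0,per}(Q_T)$ is the space of $v\in L^2(Q_T)$ with $\nabla v\in[L^2(Q_T)]^d$, $\|\partial_t^{1/2}v\|<\infty$ and $v=0$ on $\Sigma_T$, with seminorm $|v|_{1,\frac12}^2=\|\nabla v\|^2+\|\partial_t^{1/2}v\|^2$; for pairs, $|(y,p)|_{1,\frac12}^2=|y|_{1,\frac12}^2+|p|_{1,\frac12}^2$. $H^{1,1}_{0,per}(Q_T)$ is the space of $v\in L^2(Q_T)$ with $\nabla v\in[L^2(Q_T)]^d$, $\partial_tv\in L^2(Q_T)$, $v=0$ on $\Sigma_T$ and $v(\cdot,0)=v(\cdot,T)$. $H(\mathrm{div},Q_T)=\{\boldsymbol{\rho}\in[L^2(Q_T)]^d:\mathrm{div}\,\boldsymbol{\rho}(\cdot,t)\in L^2(\Omega)\text{ for a.e. }t\in(0,T)\}$. The bilinear form is $$\mathcal{B}((y,p),(z,q))=\int_{Q_T}\Big(yz-\nu\nabla p\cdot\nabla z+\sigma\partial_t^{1/2}p\,\partial_t^{1/2}z^\perp+\nu\nabla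 y\cdot\nabla q+\sigma\partial_t^{1/2}y\,\partial_t^{1/2}q^\perp+\lambda^{-1}pq\Big)d\boldsymbol{x}\,dt .$$ *)

(* Defs.v *)
From HB Require Import structures.
From mathcomp Require Import all_boot all_order all_algebra.
From mathcomp Require Import all_classical all_reals all_analysis.
Set Implicit Arguments.
Unset Strict Implicit.
Unset Printing Implicit Defensive.
Import Order.TTheory GRing.Theory Num.Theory.
Import numFieldNormedType.Exports.
Local Open Scope classical_set_scope.
Local Open Scope ring_scope.

Definition rV_display : measure_display -> measure_display.
Proof. exact. Qed.

Section measurable_rV.
Context {R : realType} (d : nat).

Let coors : 'I_d -> 'rV[R]_d -> R := fun i x => x ord0 i.

Let rV_set0 : g_sigma_preimage coors set0.
Proof. exact: sigma_algebra0. Qed.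

Let rV_setC A : g_sigma_preimage coors A -> g_sigma_preimage coors (~` A).
Proof. exact: sigma_algebraC. Qed.

Let rV_bigcup (F : _^nat) : (forall i, g_sigma_preimage coors (F i)) ->
  g_sigma_preimage coors (\bigcup_i (F i)).
Proof. exact: sigma_algebra_bigcup. Qed.

(* As for [n.-tuple], the sigma-algebra generated by the coordinates; it is the
   Borel one. *)
HB.instance Definition _ := @isMeasurable.Build (rV_display default_measure_display)
  'rV[R]_d (g_sigma_preimage coors) rV_set0 rV_setC rV_bigcup.

End measurable_rV.

Section lebesgue_rV.
Context {R : realType}.
Local Open Scope ereal_scope.

Lemma measurable_coord d (i : 'I_d) :
  measurable_fun [set: 'rV[R]_d] (fun x => x ord0 i).
Proof.
move=> _ Y mY; rewrite setTI; apply: sub_sigma_algebra => /=.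
rewrite -bigcup_seq/=; exists i => /=; first by rewrite mem_index_enum.
by exists Y => //; rewrite setTI.
Qed.

Lemma measurable_fun_rV d d1 (T1 : measurableType d1) (f : T1 -> 'rV[R]_d) :
  (forall i, measurable_fun [set: T1] (fun x => f x ord0 i)) ->
  measurable_fun [set: T1] f.
Proof.
move=> mf _ A mA; rewrite setTI; move: A mA.
apply: (@smallest_sub _ _ _ (fun A => measurable (f @^-1` A))).
  split => /=.
  - by rewrite preimage_set0; exact: measurable0.
  - by move=> A mA; rewrite setTD -preimage_setC; exact: measurableC.
  - by move=> F mF; rewrite preimage_bigcup; exact: bigcupT_measurable.
move=> A; rewrite -bigcup_seq => -[i _ [B mB <-]]; rewrite setTI.
by have := mf i measurableT _ mB; rewrite setTI.
Qed.

(* [rV_cons (t, x)] is the vector [(t, x_0, ..., x_(d-1))]. *)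
Definition rV_cons d (p : measurableTypeR R * 'rV[R]_d) : 'rV[R]_d.+1 :=
  \row_i oapp (p.2 ord0) p.1 (unlift ord0 i).

Definition rV_uncons d (x : 'rV[R]_d.+1) : measurableTypeR R * 'rV[R]_d :=
  (x ord0 ord0, \row_j x ord0 (lift ord0 j)).

Lemma rV_consK d : cancel (@rV_cons d) (@rV_uncons d).
Proof.
move=> [t x]; rewrite /rV_cons /rV_uncons /= mxE unlift_none /=; congr pair.
by apply/rowP => j; rewrite !mxE liftK.
Qed.

Lemma measurable_rV_cons d : measurable_fun setT (@rV_cons d).
Proof.
apply: measurable_fun_rV => i; rewrite /rV_cons.
case: (unliftP ord0 i) => [j ->|->].
- under eq_fun do rewrite mxE liftK /=.
  exact: (measurableT_comp (measurable_coord j) measurable_snd).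
- under eq_fun do rewrite mxE unlift_none /=.
  exact: measurable_fst.
Qed.

Lemma measurable_rV_uncons d : measurable_fun setT (@rV_uncons d).
Proof.
apply: measurable_fun_pair; first exact: measurable_coord.
apply: measurable_fun_rV => i; under eq_fun do rewrite mxE.
exact: measurable_coord.
Qed.

Notation leb := (@lebesgue_measure R).

Section step.
Context d (mu : {sigma_finite_measure set 'rV[R]_d -> \bar R}).

Definition rV_measureS := pushforward (leb \x mu) (@rV_cons d).

Let pm : {measure set 'rV[R]_d.+1 -> \bar R} :=
  measure_function_pushforward__canonical__measure_function_Measure
    (leb \x mu) (@measurable_rV_cons d).

HB.instance Definition _ := @isMeasure.Build _ _ _ rV_measureS
  (measure0 pm) (measure_ge0 pm) (@measure_semi_sigma_additive _ _ _ pm).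

Lemma rV_measureS_sigma_finite : sigma_finite setT rV_measureS.
Proof.
have /sigma_finiteP[F [TF ndF Foo]] := sigma_finiteT (@lebesgue_measure R).
have /sigma_finiteP[G [TG ndG Goo]] := sigma_finiteT mu.
exists (fun n => @rV_uncons d @^-1` (F n `*` G n)).
  rewrite -preimage_bigcup -(@preimage_setT _ _ (@rV_uncons d)); congr preimage.
  rewrite -setXTT TF TG predeqE => -[x y]; split.
    move=> [/= [n _ Fnx] [k _ Gky]]; exists (maxn n k) => //; split.
    - by move: x Fnx; exact/subsetPset/ndF/leq_maxl.
    - by move: y Gky; exact/subsetPset/ndG/leq_maxr.
  by move=> [n _ []/= ? ?]; split; exists n.
move=> n; have [mFn Fn] := Foo n; have [mGn Gn] := Goo n; split.
  rewrite -[X in measurable X]setTI; apply: measurable_rV_uncons => //.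
  exact: measurableX.
rewrite /rV_measureS /pushforward -comp_preimage.
rewrite (_ : _ \o _ = id); last by rewrite funeqE; exact: rV_consK.
by rewrite preimage_id product_measure1E// lte_mul_pinfty// ge0_fin_numE.
Qed.

HB.instance Definition _ := @Measure_isSigmaFinite.Build _ _ _ rV_measureS
  rV_measureS_sigma_finite.

End step.

Fixpoint lebesgue_rV d : {sigma_finite_measure set 'rV[R]_d -> \bar R} :=
  match d with
  | 0%N => dirac (0 : 'rV[R]_0)%R
  | d'.+1 => rV_measureS (lebesgue_rV d')
  end.

End lebesgue_rV.
Arguments lebesgue_rV {R} d.
Notation leb R := (@lebesgue_measure R).

Lemma lebesgue_rV_box (R : realType) d (A : 'I_d -> set (measurableTypeR R)) :
  (forall i, measurable (A i)) ->
  (lebesgue_rV d [set x : 'rV[R]_d | forall i, A i (x ord0 i)] =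
   \prod_(i < d) leb R (A i))%E.
Proof.
elim: d A => [|d IH] A mA.
  by rewrite big_ord0 /= diracE mem_set//= => -[].
rewrite big_ord_recl -IH//= /rV_measureS /pushforward.
rewrite (_ : _ @^-1` _ = A ord0 `*`
    [set x : 'rV[R]_d | forall i, A (lift ord0 i) (x ord0 i)]); last first.
  rewrite predeqE => -[t x]; rewrite /rV_cons /=; split.
    move=> h; split; first by have := h ord0; rewrite mxE unlift_none.
    by move=> i; have := h (lift ord0 i); rewrite mxE liftK.
  by move=> [h0 h] i; rewrite mxE; case: (unliftP ord0 i) => [j ->|->] /=; [exact: h|].
rewrite product_measure1E//.
rewrite (_ : mkset _ = \bigcap_(i in setT)
    ((fun x : 'rV[R]_d => x ord0 i) @^-1` A (lift ord0 i))); last first.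
  by rewrite predeqE => x; split => /= [h i _|h i]; exact: h.
apply: fin_bigcap_measurable => // i _.
have := @measurable_coord R d i measurableT _ (mA (lift ord0 i)).
by rewrite setTI.
Qed.

Section L2.
Context {dT : measure_display} {X : measurableType dT} {R : realType}.
Variables (mu : {measure set X -> \bar R}) (D : set X).

Definition L2norm (f : X -> R) : \bar R := 'N[mu]_2%:E[EFin \o (f \_ D)].

Definition L2 (f : X -> R) : Prop :=
  measurable_fun D f /\ (L2norm f < +oo)%E.

End L2.

Section vectors.
Context {R : realType} {d : nat}.

Definition dot (u v : 'rV[R]_d) : R := \sum_i u ord0 i * v ord0 i.

(* The norm [`|u|] of ['rV[R]_d] is the sup norm; [enorm] is the Euclidean one. *)
Definition enorm (u : 'rV[R]_d) : R := Num.sqrt (dot u u).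

Context {dT : measure_display} {X : measurableType dT}.
Variables (mu : {measure set X -> \bar R}) (D : set X).

Definition L2normv (g : X -> 'rV[R]_d) : \bar R :=
  L2norm mu D (fun x => enorm (g x)).

Definition L2v (g : X -> 'rV[R]_d) : Prop :=
  measurable_fun D g /\ (L2normv g < +oo)%E.

End vectors.

Section domains.
Context {R : realType} {d : nat}.

(* Around [x], [Omega] is the part of space above the graph of a Lipschitz
   function over the hyperplane orthogonal to the unit vector [n]. That function
   is represented by its extension [gamma] to the whole space, constant along
   [n]. *)
Definition lipschitz_graph_at (Omega : set 'rV[R]_d) (x : 'rV[R]_d) : Prop :=
  exists (r k : R) (n : 'rV[R]_d) (gamma : 'rV[R]_d -> R^o),
    [/\ 0 < r, dot n n = 1, k.-lipschitz gamma,
        forall y (s : R), gamma (y + s *: n) = gamma y &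
        forall y, ball x r y -> (Omega y <-> gamma y < dot y n)].

Definition bounded_lipschitz_domain (Omega : set 'rV[R]_d) : Prop :=
  [/\ Omega !=set0, open Omega, connected Omega, bounded_set Omega &
      forall x, (closure Omega `\` Omega) x -> lipschitz_graph_at Omega x].

End domains.

Section test_functions.
Context {R : realType} {V : normedModType R}.

Definition iter_derive (vs : seq V) (phi : V -> R^o) : V -> R^o :=
  foldr (fun v f => 'D_v f) phi vs.

Definition smooth (phi : V -> R^o) : Prop :=
  forall vs : seq V, continuous (iter_derive vs phi) /\
    forall x v, derivable (iter_derive vs phi) x v.

(* [C_c^oo(U)], for an open set [U]. *)
Definition test_fun (U : set V) (phi : V -> R^o) : Prop :=
  smooth phi /\
  exists K, [/\ compact K, K `<=` U & forall x, ~ K x -> phi x = 0].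

End test_functions.

Section space.
Context {R : realType} {d : nat}.
Variable Omega : set 'rV[R]_d.
Local Notation vol := (lebesgue_rV d).

Definition grad (phi : 'rV[R]_d -> R^o) (x : 'rV[R]_d) : 'rV[R]_d :=
  \row_i 'D_(delta_mx ord0 i) phi x.

Definition is_wgrad (w : 'rV[R]_d -> R) (g : 'rV[R]_d -> 'rV[R]_d) : Prop :=
  [/\ L2 vol Omega w, L2v vol Omega g &
      forall phi, test_fun Omega phi -> forall i,
        \int[vol]_(x in Omega) (w x * grad phi x ord0 i) =
        - \int[vol]_(x in Omega) (g x ord0 i * phi x)].

Definition is_wdiv (rho : 'rV[R]_d -> 'rV[R]_d) (h : 'rV[R]_d -> R) : Prop :=
  [/\ L2v vol Omega rho, L2 vol Omega h &
      forall phi, test_fun Omega phi ->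
        \int[vol]_(x in Omega) dot (rho x) (grad phi x) =
        - \int[vol]_(x in Omega) (h x * phi x)].

(* [H^1_0(Omega)], the closure of [C_c^oo(Omega)] in [H^1(Omega)]. *)
Definition H10 (w : 'rV[R]_d -> R) : Prop :=
  exists2 g, is_wgrad w g &
    forall eps : R, 0 < eps -> exists2 phi, test_fun Omega phi &
      (L2norm vol Omega (fun x => w x - phi x)%R < eps%:E)%E /\
      (L2normv vol Omega (fun x => g x - grad phi x)%R < eps%:E)%E.

Definition friedrichs_constant (C : R) : Prop :=
  0 < C /\ forall w g, H10 w -> is_wgrad w g ->
    (L2norm vol Omega w <= C%:E * L2normv vol Omega g)%E.

End space.

(* Points [(x, t)] of [R^d x R]; [measurableTypeR R] is the real line with its
   Borel sigma-algebra. *)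
Notation spacetime R d := ('rV[R]_d * measurableTypeR R)%type.

Section spacetime.
Context {R : realType} {d : nat}.
Variables (Omega : set 'rV[R]_d) (T : R).
Local Notation vol := (lebesgue_rV d).
Local Notation I := `]0, T[%classic.
Local Notation st := (spacetime R d).

Definition stvol : {measure set st -> \bar R} := (vol \x leb R)%E.

Definition QT : set st := Omega `*` I.

Definition normQ : (st -> R) -> \bar R := L2norm stvol QT.
Definition normvQ : (st -> 'rV[R]_d) -> \bar R := L2normv stvol QT.
Definition L2Q : (st -> R) -> Prop := L2 stvol QT.
Definition L2vQ : (st -> 'rV[R]_d) -> Prop := L2v stvol QT.

Local Notation omega := (2 * pi / T).
Local Notation normO := (L2norm vol Omega).

(* [g] is a generalized spatial gradient of [v]: it is jointly measurable and, for
   a.e. [t], [g(., t)] is the generalized gradient of [v(., t)] in [Omega]. *)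
Definition is_sgrad (v : st -> R) (g : st -> 'rV[R]_d) : Prop :=
  measurable_fun QT g /\
  \forall t \ae leb R, I t ->
    is_wgrad Omega (fun x => v (x, t)) (fun x => g (x, t)).

(* As for [is_sgrad], for a.e. [t]; [h] need not be square integrable on [Q_T]. *)
Definition is_sdiv (rho : st -> 'rV[R]_d) (h : st -> R) : Prop :=
  measurable_fun QT h /\
  \forall t \ae leb R, I t ->
    is_wdiv Omega (fun x => rho (x, t)) (fun x => h (x, t)).

(* Generalized derivative of [v : (0, T) -> L^2(Omega)]: for every test function
   [theta] on [(0, T)], the identity holds in [L^2(Omega)], i.e. for a.e. [x]. *)
Definition is_dt (v g : st -> R) : Prop :=
  [/\ L2Q v, L2Q g &
  forall theta : R^o -> R^o, test_fun I theta ->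
    \forall x \ae vol, Omega x ->
      \int[leb R]_(t in I) (v (x, t) * derive1 theta t) =
      - \int[leb R]_(t in I) (g (x, t) * theta t)].

(* The operators pick a representative; it is unique up to a null set of [Q_T]. *)
Definition sgrad (v : st -> R) : st -> 'rV[R]_d := xget (cst 0) (is_sgrad v).
Definition sdiv (rho : st -> 'rV[R]_d) : st -> R := xget (cst 0) (is_sdiv rho).
Definition dt (v : st -> R) : st -> R := xget (cst 0) (is_dt v).

(* The trace of [v] on [Sigma_T] vanishes. *)
Definition zero_lateral (v : st -> R) : Prop :=
  \forall t \ae leb R, I t -> H10 Omega (fun x => v (x, t)).

(* [V] is the representative of [v] in [C([0, T]; L^2(Omega))]. *)
Definition time_continuous_rep (v V : st -> R) : Prop :=
  [/\ \forall t \ae leb R, I t -> \forall x \ae vol, Omega x ->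
        V (x, t) = v (x, t),
      forall t, t \in `[0, T] -> L2 vol Omega (fun x => V (x, t)) &
      forall t, t \in `[0, T] ->
        normO (fun x => V (x, s) - V (x, t))
          @[s --> within `[0, T]%classic (nbhs (t : R^o))] --> 0%E].

(* [v(., 0) = v(., T)]. *)
Definition time_periodic (v : st -> R) : Prop :=
  exists2 V, time_continuous_rep v V &
    \forall x \ae vol, Omega x -> V (x, 0) = V (x, T).

(* The Fourier coefficients [v_k^c] and [v_k^s] of [v(x, .)], for [k >= 1]. *)
Definition cosc (v : st -> R) (k : nat) (x : 'rV[R]_d) : R :=
  2 / T * \int[leb R]_(t in I) (v (x, t) * cos (k%:R * omega * t)).

Definition sinc (v : st -> R) (k : nat) (x : 'rV[R]_d) : R :=
  2 / T * \int[leb R]_(t in I) (v (x, t) * sin (k%:R * omega * t)).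

(* [|| d_t^(1/2) v ||^2] *)
Definition half_norm2 (v : st -> R) : \bar R :=
  ((T / 2)%:E * \sum_(1 <= k <oo)
    (k%:R * omega)%:E * (normO (cosc v k) ^+ 2 + normO (sinc v k) ^+ 2))%E.

(* [\int_(Q_T) sigma d_t^(1/2) y d_t^(1/2) v^perp], where
   [v_k^perp = (- v_k^s, v_k^c)]. *)
Definition half_form (sigma : 'rV[R]_d -> R) (y v : st -> R) : R :=
  T / 2 * \big[+%R/0]_(1 <= k <oo)
    (k%:R * omega * \int[vol]_(x in Omega)
      (sigma x * cosc y k x * - sinc v k x + sigma x * sinc y k x * cosc v k x)).

(* [H^(1,1/2)_(0,per)(Q_T)] *)
Definition H1half (v : st -> R) : Prop :=
  [/\ L2Q v,
      is_sgrad v (sgrad v), L2vQ (sgrad v),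
      (half_norm2 v < +oo)%E & zero_lateral v].

(* [H^(1,1)_(0,per)(Q_T)] *)
Definition H11 (v : st -> R) : Prop :=
  [/\ L2Q v,
      is_sgrad v (sgrad v) /\ L2vQ (sgrad v),
      is_dt v (dt v), zero_lateral v & time_periodic v].

(* [H(div, Q_T)] *)
Definition Hdiv (rho : st -> 'rV[R]_d) : Prop :=
  L2vQ rho /\ is_sdiv rho (sdiv rho).

(* [|v|_(1,1/2)^2] *)
Definition seminorm2 (v : st -> R) : \bar R :=
  (normvQ (sgrad v) ^+ 2 + half_norm2 v)%E.

Definition pair_seminorm (y p : st -> R) : \bar R :=
  sqrte (seminorm2 y + seminorm2 p)%E.

Definition pair_nonzero (z q : st -> R) : Prop :=
  ~ (\forall u \ae stvol, QT u -> z u = 0 /\ q u = 0).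

Variables (sigma nu : 'rV[R]_d -> R) (lambda : R).

Definition B (y p z q : st -> R) : R :=
  \int[stvol]_(u in QT)
    (y u * z u - nu u.1 * dot (sgrad p u) (sgrad z u)
     + nu u.1 * dot (sgrad y u) (sgrad q u) + lambda^-1 * (p u * q u))
  + half_form sigma p z + half_form sigma y q.

Definition optimality_system (y_d y p : st -> R) : Prop :=
  forall z q, H1half z -> H1half q ->
    B y p z q = \int[stvol]_(u in QT) (y_d u * z u).

Definition inf_sup (mu1 : R) : Prop :=
  forall w r, H1half w -> H1half r ->
    (mu1%:E * pair_seminorm w r <=
     ereal_sup [set e | exists z q, [/\ H1half z, H1half q, pair_nonzero z q &
       e = (B w r z q / fine (pair_seminorm z q))%:E]])%E.

Definition R1 (eta zeta : st -> R) (tau : st -> 'rV[R]_d) (u : st) : R :=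
  sigma u.1 * dt eta u + lambda^-1 * zeta u - sdiv tau u.

Definition R2 (eta : st -> R) (tau : st -> 'rV[R]_d) (u : st) : 'rV[R]_d :=
  tau u - nu u.1 *: sgrad eta u.

Definition R3 (y_d eta zeta : st -> R) (rho : st -> 'rV[R]_d) (u : st) : R :=
  sigma u.1 * dt zeta u + eta u - sdiv rho u - y_d u.

Definition R4 (zeta : st -> R) (rho : st -> 'rV[R]_d) (u : st) : 'rV[R]_d :=
  rho u + nu u.1 *: sgrad zeta u.

End spacetime.

Definition mu1_const {R : realType} (nu_lo sigma_lo lambda : R) : R :=
  Num.min nu_lo sigma_lo * Num.min lambda lambda^-1 / Num.sqrt 2.

(* Main.v *)
Require Import Defs.
From mathcomp Require Import all_boot all_order all_algebra.
From mathcomp Require Import all_classical all_reals all_analysis.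
From mathcomp Require Import measurable_realfun.
From mathcomp Require Import ring lra.
Set Implicit Arguments.
Unset Strict Implicit.
Unset Printing Implicit Defensive.
Import Order.TTheory GRing.Theory Num.Theory.
Import numFieldNormedType.Exports.
Local Open Scope classical_set_scope.
Local Open Scope ring_scope.

(** Write [e = (y - eta, p - zeta)]. By the inf-sup condition it suffices to bound
    [B(e, (z, q)) <= S |(z, q)|] for all test pairs, where [S] is the sum of the
    weighted residual norms. Since [(y, p)] solves the optimality system,
    [B(e, (z, q))] is the integral of [y_d z] minus [B((eta, zeta), (z, q))]. In the
    latter the half-order terms become first-order ones: for [eta] in [H^(1,1)],

      [half_form sigma eta q = \int sigma (d_t eta) q].

    Inserting the fluxes through [\int rho . grad z + \int (div rho) z = 0], valid as
    [z] vanishes on the lateral boundary, everything collects into the residuals: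

      [B(e, (z, q)) = \int R4 . grad z - \int R3 z + \int R2 . grad q - \int R1 q]

    ([residual_identity]). The Cauchy-Schwarz inequality and the Friedrichs
    inequality in almost every time slice conclude. If [R1] or [R3] is not square
    integrable, the right-hand side is infinite; otherwise the divergences are square
    integrable on the whole cylinder, as the integrations by parts require.

    Three points need analysis.

    - The identity for [half_form] ([half_form_dt]) rests on two facts in almost
      every fibre [x]: the Fourier coefficients of [d_t eta] are those of [eta]
      rotated and multiplied by [k omega], and Parseval's formula. The first one
      ([dt_coefficients]) is an integration by parts against functions that do not
      vanish at the ends of the period. It is obtained from the definition, which
      only knows compactly supported test functions, through cut-offs: their
      derivatives have integral zero and live near both ends, where [eta] is close
      to one and the same function by continuity in [L^2] and periodicity
      ([layer_estimate], [ibp_time]).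
    - Parseval's formula requires the completeness of the trigonometric system
      ([spanned_L2]). The squared distance from the indicator of [(0, a)] to the
      span of the first trigonometric functions is, up to a factor, the remainder
      of the series [\sum (1 - cos k x) / k^2 = pi x / 2 - x^2 / 4], estimated with
      the Dirichlet kernel ([dsaw_bound], [saw_err_small]); a monotone class argument
      and simple functions reach all square-integrable functions.
    - Gradients are chosen among almost everywhere equal representatives, so the
      linearity of [sgrad] requires their uniqueness ([is_wgrad_unique]), hence the
      fundamental lemma of the calculus of variations ([ae_eq0_of_test]) and explicit
      smooth bumps on boxes. *)

(** * Square-integrable functions and vector fields *)

Section real_L2.
Context {dT : measure_display} {X : measurableType dT} {R : realType}.
Variables (mu : {measure set X -> \bar R}) (D : set X).
Hypothesis mD : measurable D.
Implicit Types f g h : X -> R.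
Local Notation intg f := (mu.-integrable D (EFin \o f)).

Lemma intgD f g : intg f -> intg g -> intg (fun x => f x + g x).
Proof. by move=> hf hg; have := integrableD mD hf hg. Qed.

Lemma intgZ c f : intg f -> intg (fun x => c * f x).
Proof. by move=> hf; have := integrableZl mD c hf. Qed.

Lemma intgB f g : intg f -> intg g -> intg (fun x => f x - g x).
Proof. by move=> hf hg; have := integrableB mD hf hg. Qed.

Lemma L2normE f : L2norm mu D f = sqrte (\int[mu]_(x in D) (f x ^+ 2)%:E)%E.
Proof.
rewrite /L2norm unlock /= poweR12_sqrt; last first.
  by apply: integral_ge0 => x _; rewrite lee_fin powR_ge0.
congr sqrte; rewrite [RHS]integral_mkcond; apply: eq_integral => x _ /=.
rewrite restrict_EFin /= !patchE; case: ifPn => _.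
  by rewrite powR_mulrn// real_normK ?num_real.
by rewrite normr0 powR0.
Qed.

Lemma L2norm_sqr f :
  (L2norm mu D f ^+ 2 = \int[mu]_(x in D) (f x ^+ 2)%:E)%E.
Proof.
by rewrite L2normE sqr_sqrte//; apply: integral_ge0 => x _; rewrite lee_fin sqr_ge0.
Qed.

Lemma L2norm_ge0 f : (0 <= L2norm mu D f)%E.
Proof. by rewrite L2normE sqrte_ge0. Qed.

Lemma L2P f : L2 mu D f <-> measurable_fun D f /\ intg (fun x => f x ^+ 2).
Proof.
split=> -[mf h]; split => //.
  apply/integrableP; split.
    by apply/measurable_EFinP; exact: measurable_funX.
  under eq_integral do rewrite /= ger0_norm ?sqr_ge0//.
  by rewrite -L2norm_sqr expe2 lte_mul_pinfty ?L2norm_ge0// ge0_fin_numE ?L2norm_ge0.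
rewrite L2normE -ge0_fin_numE ?sqrte_ge0// sqrte_fin_num; last first.
  by apply: integral_ge0 => x _; rewrite lee_fin sqr_ge0.
exact: integrable_fin_num h.
Qed.

Lemma L2_meas f : L2 mu D f -> measurable_fun D f. Proof. by case. Qed.

Lemma L2_sqr f : L2 mu D f -> intg (fun x => f x ^+ 2).
Proof. by case/L2P. Qed.

Lemma L2normEfin f : L2 mu D f ->
  L2norm mu D f = (Num.sqrt (\int[mu]_(x in D) (f x ^+ 2)))%:E.
Proof.
move=> /L2P[_ h]; rewrite L2normE /Rintegral.
by rewrite -[X in sqrte X]fineK//; exact: integrable_fin_num h.
Qed.

Lemma L2_mul f g : L2 mu D f -> L2 mu D g -> intg (fun x => f x * g x).
Proof.
move=> /L2P[mf f2] /L2P[mg g2].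
have := integrableD mD f2 g2; apply: (le_integrable mD).
  by apply/measurable_EFinP; exact: measurable_funM.
move=> x _ /=; rewrite lee_fin [leRHS]ger0_norm ?addr_ge0 ?sqr_ge0// normrM.
rewrite -[f x ^+ 2]real_normK ?num_real// -[g x ^+ 2]real_normK ?num_real//.
by have := sqr_ge0 (`|f x| - `|g x|); have := sqr_ge0 (`|f x| + `|g x|); nra.
Qed.

Lemma L2_le f g : measurable_fun D f -> (forall x, D x -> `|f x| <= `|g x|) ->
  L2 mu D g -> L2 mu D f.
Proof.
move=> mf fg /L2P[mg g2]; apply/L2P; split => //.
apply: (le_integrable mD) g2 => [|x Dx /=].
  by apply/measurable_EFinP; exact: measurable_funX.
by rewrite lee_fin !ger0_norm ?sqr_ge0// -[leLHS]real_normK ?num_real//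
  -[leRHS]real_normK ?num_real// lerXn2r ?nnegrE// fg.
Qed.

Lemma L2D f g : L2 mu D f -> L2 mu D g -> L2 mu D (fun x => f x + g x).
Proof.
move=> /L2P[mf f2] /L2P[mg g2]; apply/L2P; split; first exact: measurable_funD.
have := integrableD mD (integrableZl mD 2 f2) (integrableZl mD 2 g2).
apply: (le_integrable mD) => [|x Dx /=].
  by apply/measurable_EFinP/measurable_funX/measurable_funD.
rewrite lee_fin !ger0_norm ?sqr_ge0//.
  by have := sqr_ge0 (f x - g x); nra.
by rewrite addr_ge0// mulr_ge0// sqr_ge0.
Qed.

Lemma L2_bounded_mul (c : R) f g : measurable_fun D g ->
  (forall x, D x -> `|g x| <= c) -> L2 mu D f -> L2 mu D (fun x => g x * f x).
Proof.
move=> mg gc /L2P[mf f2]; apply/L2P; split; first exact: measurable_funM.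
have := integrableZl mD (c ^+ 2) f2.
apply: (le_integrable mD) => [|x Dx /=].
  by apply/measurable_EFinP/measurable_funX/measurable_funM.
rewrite lee_fin -!exprMn !ger0_norm ?sqr_ge0//.
rewrite !exprMn ler_wpM2r ?sqr_ge0//.
rewrite -[leLHS]real_normK ?num_real// lerXn2r ?nnegrE//; last exact: gc.
exact: le_trans (gc _ Dx).
Qed.

Lemma L2Z (c : R) f : L2 mu D f -> L2 mu D (fun x => c * f x).
Proof.
by apply: (@L2_bounded_mul `|c|) => //; exact: measurable_cst. Qed.

Lemma L2N f : L2 mu D f -> L2 mu D (fun x => - f x).
Proof.
move=> /(L2Z (-1)) h; rewrite (_ : (fun x => _) = (fun x => -1 * f x))//.
by apply/funext => x; rewrite mulN1r.
Qed.

Lemma L2B f g : L2 mu D f -> L2 mu D g -> L2 mu D (fun x => f x - g x).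
Proof. by move=> hf hg; apply: L2D => //; exact: L2N. Qed.

Lemma L2_cst (c : R) : (mu D < +oo)%E -> L2 mu D (fun=> c).
Proof.
move=> Doo; apply/L2P; split; first exact: measurable_cst.
apply: measurable_bounded_integrable => //.
by exists (c ^+ 2); split => [|M cM x Dx /=]; rewrite ?num_real// ger0_norm ?sqr_ge0// ltW.
Qed.

Lemma L2_integrable f : (mu D < +oo)%E -> L2 mu D f -> intg f.
Proof.
move=> /(L2_cst 1) h1 hf; have := L2_mul hf h1.
by under eq_fun do rewrite mulr1.
Qed.

Lemma L2_bounded (c : R) f : (mu D < +oo)%E -> measurable_fun D f ->
  (forall x, D x -> `|f x| <= c) -> L2 mu D f.
Proof.
move=> Doo mf fc; apply: (@L2_le f (fun=> c)) => // [x Dx|].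
  by rewrite (le_trans (fc x Dx))// ler_norm.
exact: L2_cst.
Qed.

Lemma cauchy_schwarz f g : L2 mu D f -> L2 mu D g ->
  `|\int[mu]_(x in D) (f x * g x)| <=
  Num.sqrt (\int[mu]_(x in D) (f x ^+ 2)) * Num.sqrt (\int[mu]_(x in D) (g x ^+ 2)).
Proof.
move=> hf hg.
set A := \int[mu]_(x in D) (f x ^+ 2); set B := \int[mu]_(x in D) (g x ^+ 2).
set C := \int[mu]_(x in D) (f x * g x).
have quad (t : R) : 0 <= A - 2 * t * C + t ^+ 2 * B.
  have : 0 <= \int[mu]_(x in D) ((f x - t * g x) ^+ 2).
    by apply: Rintegral_ge0 => x _; exact: sqr_ge0.
  have -> : (fun x => (f x - t * g x) ^+ 2) =
     (fun x => f x ^+ 2 + (- (2 * t) * (f x * g x) + t ^+ 2 * g x ^+ 2)).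
    by apply/funext => x; ring.
  have i1 := L2_sqr hf; have i2 := L2_mul hf hg; have i3 := L2_sqr hg.
  rewrite RintegralD//; last first.
    by apply: intgD; exact: intgZ.
  rewrite RintegralD//; try exact: intgZ.
  by rewrite !RintegralZl// mulNr addrA.
have A0 : 0 <= A by apply: Rintegral_ge0 => x _; exact: sqr_ge0.
have B0 : 0 <= B by apply: Rintegral_ge0 => x _; exact: sqr_ge0.
have CAB : C ^+ 2 <= A * B.
  have [B_0|Bn0] := eqVneq B 0.
    rewrite B_0 mulr0; have [->|Cn0] := eqVneq C 0; first by rewrite expr0n.
    have := quad ((A + 1) / (2 * C)); rewrite B_0 mulr0 addr0.
    rewrite (_ : A - _ = -1) ?oppr_ge0 ?ler10//.
    by field.
  have Bp : 0 < B by rewrite lt_def Bn0.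
  have := quad (C / B).
  rewrite (_ : A - _ + _ = (A * B - C ^+ 2) / B); last by field.
  by rewrite pmulr_lge0 ?invr_gt0// subr_ge0.
rewrite -sqrtrM// -sqrtr_sqr ler_wsqrtr//.
Qed.

Lemma ae_eq_Rintegral f g : measurable_fun D f -> measurable_fun D g ->
  (\forall x \ae mu, D x -> f x = g x) ->
  \int[mu]_(x in D) f x = \int[mu]_(x in D) g x.
Proof.
move=> mf mg fg; rewrite /Rintegral; congr fine.
apply: ae_eq_integral => //; try exact/measurable_EFinP.
by move: fg; apply: filterS => x h /h /= ->.
Qed.

Lemma ae_eq_L2norm f g : measurable_fun D f -> measurable_fun D g ->
  (\forall x \ae mu, D x -> f x = g x) -> L2norm mu D f = L2norm mu D g.
Proof.
move=> mf mg fg; rewrite !L2normE; congr sqrte.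
apply: ae_eq_integral => //; try exact/measurable_EFinP/measurable_funX.
by move: fg; apply: filterS => x h /h /= ->.
Qed.

End real_L2.

Section vectors.
Context {R : realType} {d : nat}.
Implicit Types u v : 'rV[R]_d.

Lemma dotC u v : dot u v = dot v u.
Proof. by apply: eq_bigr => i _; rewrite mulrC. Qed.
Lemma dotDl u v w : dot (u + v) w = dot u w + dot v w.
Proof. by rewrite -big_split; apply: eq_bigr => i _ /=; rewrite mxE mulrDl. Qed.
Lemma dotNl u w : dot (- u) w = - dot u w.
Proof. by rewrite -sumrN; apply: eq_bigr => i _ /=; rewrite mxE mulNr. Qed.
Lemma dotBl u v w : dot (u - v) w = dot u w - dot v w.
Proof. by rewrite dotDl dotNl. Qed.
Lemma dotZl c u w : dot (c *: u) w = c * dot u w.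
Proof. by rewrite mulr_sumr; apply: eq_bigr => i _ /=; rewrite mxE mulrA. Qed.
Lemma dotDr u v w : dot w (u + v) = dot w u + dot w v.
Proof. by rewrite !(dotC w) dotDl. Qed.
Lemma dotBr u v w : dot w (u - v) = dot w u - dot w v.
Proof. by rewrite !(dotC w) dotBl. Qed.
Lemma dotZr c u w : dot w (c *: u) = c * dot w u.
Proof. by rewrite !(dotC w) dotZl. Qed.

Lemma dot_ge0 u : 0 <= dot u u.
Proof. by apply: sumr_ge0 => i _; rewrite -expr2 sqr_ge0. Qed.
Lemma enorm_ge0 u : 0 <= enorm u. Proof. exact: sqrtr_ge0. Qed.
Lemma enorm_sqr u : enorm u ^+ 2 = dot u u.
Proof. by rewrite sqr_sqrtr ?dot_ge0. Qed.

Lemma coord_enorm u i : `|u ord0 i| <= enorm u.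
Proof.
rewrite -sqrtr_sqr ler_wsqrtr// /dot (bigD1 i)//= expr2 lerDl.
by apply: sumr_ge0 => j _; rewrite -expr2 sqr_ge0.
Qed.

Lemma dot_enorm u v : `|dot u v| <= enorm u * enorm v.
Proof.
have A0 := dot_ge0 u; have B0 := dot_ge0 v.
rewrite -sqrtrM// -sqrtr_sqr ler_wsqrtr//.
have quad t : 0 <= dot u u - 2 * t * dot u v + t ^+ 2 * dot v v.
  have := dot_ge0 (u - t *: v); rewrite dotBl !dotBr !dotZl !dotZr (dotC v u).
  by congr (0 <= _); ring.
have [B_0|Bn0] := eqVneq (dot v v) 0.
  rewrite B_0 mulr0; have [->|Cn0] := eqVneq (dot u v) 0; first by rewrite expr0n.
  have := quad ((dot u u + 1) / (2 * dot u v)); rewrite B_0 mulr0 addr0.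
  by rewrite (_ : dot u u - _ = -1) ?oppr_ge0 ?ler10//; field.
have Bp : 0 < dot v v by rewrite lt_def Bn0.
have := quad (dot u v / dot v v).
rewrite (_ : _ - _ + _ = (dot u u * dot v v - dot u v ^+ 2) / dot v v); last by field.
by rewrite pmulr_lge0 ?invr_gt0// subr_ge0.
Qed.

End vectors.

Section vector_L2.
Context {dT : measure_display} {X : measurableType dT} {R : realType} {d : nat}.
Variables (mu : {measure set X -> \bar R}) (D : set X).
Hypothesis mD : measurable D.
Implicit Types g h : X -> 'rV[R]_d.
Local Notation intg f := (mu.-integrable D (EFin \o f)).

Lemma measurable_fun_coord g i :
  measurable_fun D g -> measurable_fun D (fun x => g x ord0 i).
Proof.
move=> mg; exact: (measurableT_comp (measurable_coord i) mg).
Qed.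

Lemma measurable_rVP g :
  (forall i, measurable_fun D (fun x => g x ord0 i)) -> measurable_fun D g.
Proof.
move=> mg; apply/(measurable_restrictT g mD); apply: measurable_fun_rV => i.
have /(measurable_restrictT _ mD) := mg i; congr measurable_fun.
by apply/funext => x; rewrite !patchE; case: ifPn => // _; rewrite mxE.
Qed.

Lemma measurable_dot g h : measurable_fun D g -> measurable_fun D h ->
  measurable_fun D (fun x => dot (g x) (h x)).
Proof.
move=> mg mh; apply: measurable_sum => i; apply: measurable_funM.
  exact: measurable_fun_coord.
exact: measurable_fun_coord.
Qed.

Lemma measurable_enorm g : measurable_fun D g ->
  measurable_fun D (fun x => enorm (g x)).
Proof.
move=> mg; apply: (measurableT_comp _ (measurable_dot mg mg)).
by apply: continuous_measurable_fun; exact: sqrt_continuous.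
Qed.

Lemma L2vP g : L2v mu D g <->
  measurable_fun D g /\ L2 mu D (fun x => enorm (g x)).
Proof.
split=> -[mg h]; split => //; last by case: h.
by split => //; exact: measurable_enorm.
Qed.

Lemma L2v_le g (f : X -> R) : measurable_fun D g ->
  (forall x, D x -> enorm (g x) <= f x) -> L2 mu D f -> L2v mu D g.
Proof.
move=> mg gf hf; apply/L2vP; split => //.
apply: (L2_le mD) hf; first exact: measurable_enorm.
by move=> x Dx; rewrite ger0_norm ?enorm_ge0// (le_trans (gf x Dx))// ler_norm.
Qed.

Lemma L2v_dot g h : L2v mu D g -> L2v mu D h ->
  intg (fun x => dot (g x) (h x)).
Proof.
move=> /L2vP[mg hg] /L2vP[mh hh]; have := L2_mul mD hg hh.
apply: (le_integrable mD).
  by apply/measurable_EFinP; exact: measurable_dot.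
move=> x _ /=; rewrite lee_fin (le_trans (dot_enorm _ _))//.
by rewrite ger0_norm// mulr_ge0// enorm_ge0.
Qed.

Lemma L2v_coord g i : L2v mu D g -> L2 mu D (fun x => g x ord0 i).
Proof.
move=> /L2vP[mg hg]; apply: (L2_le mD) hg; first exact: measurable_fun_coord.
by move=> x _; rewrite (le_trans (coord_enorm _ _))// ler_norm.
Qed.

Lemma measurable_rVD g h : measurable_fun D g -> measurable_fun D h ->
  measurable_fun D (fun x => g x + h x).
Proof.
move=> mg mh; apply: measurable_rVP => i; under eq_fun do rewrite mxE.
by apply: measurable_funD; exact: measurable_fun_coord.
Qed.

Lemma measurable_rVZ (c : X -> R) g : measurable_fun D c -> measurable_fun D g ->
  measurable_fun D (fun x => c x *: g x).
Proof.
move=> mc mg; apply: measurable_rVP => i; under eq_fun do rewrite mxE.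
by apply: measurable_funM => //; exact: measurable_fun_coord.
Qed.

Lemma enormZ (c : R) (u : 'rV[R]_d) : enorm (c *: u) = `|c| * enorm u.
Proof.
by rewrite /enorm dotZl dotZr mulrA -expr2 sqrtrM ?sqr_ge0// sqrtr_sqr.
Qed.

Lemma L2v_bounded_mul (k : R) (c : X -> R) g : measurable_fun D c ->
  (forall x, D x -> `|c x| <= k) -> L2v mu D g -> L2v mu D (fun x => c x *: g x).
Proof.
move=> mc ck /L2vP[mg hg].
apply: (@L2v_le _ (fun x => k * enorm (g x))); first exact: measurable_rVZ.
  by move=> x Dx; rewrite enormZ ler_wpM2r ?enorm_ge0// ck.
exact: L2Z.
Qed.

Lemma L2vD g h : L2v mu D g -> L2v mu D h -> L2v mu D (fun x => g x + h x).
Proof.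
move=> /L2vP[mg hg] /L2vP[mh hh].
apply: (@L2v_le _ (fun x => enorm (g x) + enorm (h x))).
- exact: measurable_rVD.
- move=> x _; rewrite -(ger0_norm (enorm_ge0 (g x + h x))).
  rewrite -(@ler_pXn2r _ 2)// ?nnegrE ?addr_ge0 ?enorm_ge0//.
  rewrite real_normK ?num_real// enorm_sqr dotDl !dotDr (dotC (h x)).
  have := dot_enorm (g x) (h x); have := ler_norm (dot (g x) (h x)).
  have := enorm_sqr (g x); have := enorm_sqr (h x); nra.
- exact: L2D.
Qed.

Lemma L2vN g : L2v mu D g -> L2v mu D (fun x => - g x).
Proof.
move=> hg; have := @L2v_bounded_mul 1 (fun=> -1) g (measurable_cst _).
under eq_fun do rewrite scaleN1r; apply => // x _; by rewrite normrN1.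
Qed.

Lemma L2vB g h : L2v mu D g -> L2v mu D h -> L2v mu D (fun x => g x - h x).
Proof. by move=> hg hh; apply: L2vD => //; exact: L2vN. Qed.

Lemma cauchy_schwarz_dot g h : L2v mu D g -> L2v mu D h ->
  `|\int[mu]_(x in D) dot (g x) (h x)| <=
  Num.sqrt (\int[mu]_(x in D) (enorm (g x) ^+ 2)) *
  Num.sqrt (\int[mu]_(x in D) (enorm (h x) ^+ 2)).
Proof.
move=> hg hh; have /L2vP[mg ng] := hg; have /L2vP[mh nh] := hh.
apply: le_trans (cauchy_schwarz mD ng nh).
apply: le_trans (le_normr_Rintegral mD (L2v_dot hg hh)) _.
rewrite (le_trans _ (ler_norm _))//; apply: le_Rintegral => //.
- exact: integrable_norm (L2v_dot hg hh).
- exact: L2_mul.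
- by move=> x _; exact: dot_enorm.
Qed.

Lemma ae_eq_L2normv g h : measurable_fun D g -> measurable_fun D h ->
  (\forall x \ae mu, D x -> g x = h x) -> L2normv mu D g = L2normv mu D h.
Proof.
move=> mg mh gh; apply: ae_eq_L2norm => //; try exact: measurable_enorm.
by move: gh; apply: filterS => x gh /gh ->.
Qed.

Lemma ae_eq_L2v g h : measurable_fun D h ->
  (\forall x \ae mu, D x -> g x = h x) -> L2v mu D g -> L2v mu D h.
Proof.
by move=> mh gh [mg gi]; split => //; rewrite -(ae_eq_L2normv mg mh).
Qed.

End vector_L2.

Section real_integrals.
Context {dT : measure_display} {X : measurableType dT} {R : realType}.
Variables (mu : {measure set X -> \bar R}) (D : set X).
Hypothesis mD : measurable D.
Implicit Types f g h : X -> R.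
Local Notation intg f := (mu.-integrable D (EFin \o f)).

Lemma intg_meas f : intg f -> measurable_fun D f.
Proof. by move=> /measurable_int /measurable_EFinP. Qed.

Lemma intg_le f g : measurable_fun D f -> (forall x, D x -> `|f x| <= g x) ->
  intg g -> intg f.
Proof.
move=> mf fg; apply: (le_integrable mD); first exact/measurable_EFinP.
by move=> x Dx; rewrite /= lee_fin (le_trans (fg x Dx))// ler_norm.
Qed.

Lemma intg_ae_eq f g : measurable_fun D g ->
  (\forall x \ae mu, D x -> f x = g x) -> intg f -> intg g.
Proof.
move=> mg fg /integrableP[mf foo]; apply/integrableP; split.
  exact/measurable_EFinP.
rewrite (_ : (\int[mu]_(x in D) _ = \int[mu]_(x in D) `|(f x)%:E|)%E)//.
apply: ae_eq_integral => //; try by apply: measurableT_comp => //; exact/measurable_EFinP.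
by move: fg; apply: filterS => x h /h /= ->.
Qed.

Lemma Rdominated (f_ : nat -> X -> R) f g :
  (forall n, measurable_fun D (f_ n)) -> measurable_fun D f -> intg g ->
  (\forall x \ae mu, D x -> f_ n x @[n --> \oo] --> f x) ->
  (\forall x \ae mu, D x -> forall n, `|f_ n x| <= g x) ->
  intg f /\ \int[mu]_(x in D) f_ n x @[n --> \oo] --> \int[mu]_(x in D) f x.
Proof.
move=> mfn mf ig cf bf.
have cf' : {ae mu, forall x, D x -> (f_ n x)%:E @[n --> \oo] --> (f x)%:E}.
  move: cf; apply: filterS => x h /h hx.
  by apply: cvg_EFin; [exact: nearW|exact: hx].
have bf' : {ae mu, forall x n, D x -> (`|(f_ n x)%:E| <= (g x)%:E)%E}.
  by move: bf; apply: filterS => x h n /h /(_ n); rewrite lee_fin.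
have [if_ _ h] := @dominated_convergence _ _ _ mu D mD (fun n => EFin \o f_ n)
  (EFin \o f) (EFin \o g) (fun n => (measurable_EFinP _ _).2 (mfn n))
  ((measurable_EFinP _ _).2 mf) cf' ig bf'.
split=> //; apply: fine_cvg; rewrite fineK//; exact: integrable_fin_num.
Qed.

Lemma Rintegral_indic f (E : set X) : measurable E -> E `<=` D ->
  \int[mu]_(x in D) (f x * \1_E x) = \int[mu]_(x in E) f x.
Proof.
move=> mE ED; rewrite -[in RHS](setIidr ED) Rintegral_mkcondr.
by apply: eq_Rintegral => x _; rewrite patchE indicE; case: (x \in E); rewrite ?mulr1 ?mulr0.
Qed.

Lemma eq_Rint f g : (forall x, D x -> f x = g x) ->
  \int[mu]_(x in D) f x = \int[mu]_(x in D) g x.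
Proof. by move=> h; apply: eq_Rintegral => x /set_mem/h. Qed.

Lemma Rintegral0 : \int[mu]_(x in D) (0 : R) = 0.
Proof. by rewrite /Rintegral integral0_eq. Qed.

Lemma RintegralN f : intg f -> \int[mu]_(x in D) (- f x) = - \int[mu]_(x in D) f x.
Proof.
move=> hf; under eq_Rintegral do rewrite -mulN1r.
by rewrite RintegralZl// mulN1r.
Qed.

Lemma Rintegral_sum (I : Type) (s : seq I) (F : I -> X -> R) :
  (forall i, intg (F i)) ->
  intg (fun x => \sum_(i <- s) F i x) /\
  \int[mu]_(x in D) (\sum_(i <- s) F i x) = \sum_(i <- s) \int[mu]_(x in D) F i x.
Proof.
move=> hF; elim: s => [|i s [IH1 IH2]].
  split; first by under eq_fun do rewrite big_nil; exact: integrable0.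
  by rewrite big_nil; under eq_Rintegral do rewrite big_nil; rewrite Rintegral0.
split; first by under eq_fun do rewrite big_cons; exact: intgD.
rewrite big_cons -IH2 -RintegralD//.
by apply: eq_Rint => x _; rewrite big_cons.
Qed.

End real_integrals.

(** * Boxes and open sets of the space of row vectors *)

Section rV_borel.
Context {R : realType} {d : nat}.
Local Notation vol := (@lebesgue_rV R d).
Implicit Types (A : set 'rV[R]_d) (a b : 'I_d -> R).

(** Open boxes form a pi-system generating the Borel sets, so a measure is
    determined by its values on them; the closed ones are the compact supports of
    bump functions. *)
Definition obox a b : set 'rV[R]_d := [set x | forall i, a i < x ord0 i < b i].
Definition cbox a b : set 'rV[R]_d := [set x | forall i, a i <= x ord0 i <= b i].

Lemma measurable_coords (A : 'I_d -> set (measurableTypeR R)) :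
  (forall i, measurable (A i)) ->
  measurable [set x : 'rV[R]_d | forall i, A i (x ord0 i)].
Proof.
move=> mA; rewrite (_ : mkset _ = \bigcap_(i in setT)
    ((fun x : 'rV[R]_d => x ord0 i) @^-1` A i)); last first.
  by rewrite predeqE => x; split => /= [h i _|h i]; exact: h.
apply: fin_bigcap_measurable => // i _.
by have := @measurable_coord R d i measurableT _ (mA i); rewrite setTI.
Qed.

Lemma measurable_obox a b : measurable (obox a b).
Proof.
rewrite (_ : obox a b = [set x | forall i, `]a i, b i[%classic (x ord0 i)]).
  by apply: (@measurable_coords (fun i => `]a i, b i[%classic)) => i; exact: measurable_itv.
by apply/funext => x; apply/propext; split=> h i; have := h i; rewrite /= in_itv.
Qed.

Lemma measurable_cbox a b : measurable (cbox a b).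
Proof.
rewrite (_ : cbox a b = [set x | forall i, `[a i, b i]%classic (x ord0 i)]).
  by apply: (@measurable_coords (fun i => `[a i, b i]%classic)) => i; exact: measurable_itv.
by apply/funext => x; apply/propext; split=> h i; have := h i; rewrite /= in_itv.
Qed.

Lemma lebesgue_cbox_fin a b : (vol (cbox a b) < +oo)%E.
Proof.
rewrite (_ : cbox a b = [set x | forall i, `[a i, b i]%classic (x ord0 i)]).
  rewrite (@lebesgue_rV_box _ _ (fun i => `[a i, b i]%classic)) => [|i]; last exact: measurable_itv.
  rewrite ltey_eq prode_fin_num ?orbT// => i _.
  rewrite lebesgue_measure_itv/=; case: ifP => // _.
by apply/funext => x; apply/propext; split=> h i; have := h i; rewrite /= in_itv.
Qed.

Lemma coord_norm (x : 'rV[R]_d) i : `|x ord0 i| <= `|x|.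
Proof.
rewrite [leRHS]/Num.norm /= mx_normrE; apply/bigmax_geP; right => /=.
by exists (ord0, i).
Qed.

Lemma bounded_cbox A : bounded_set A -> exists M : R, A `<=` cbox (fun=> - M) (fun=> M).
Proof.
move=> [M [_ h]]; exists (M + 1) => x Ax i.
by rewrite -ler_norml (le_trans (coord_norm _ _))// (h (M + 1)) // ltrDl.
Qed.

Lemma bounded_vol_fin A : measurable A -> bounded_set A -> (vol A < +oo)%E.
Proof.
move=> mA /bounded_cbox[M AM]; apply: le_lt_trans (lebesgue_cbox_fin (fun=> - M) (fun=> M)).
by apply: le_measure; rewrite ?inE//; exact: measurable_cbox.
Qed.

Lemma compact_cbox a b : compact (cbox a b).
Proof.
rewrite (_ : cbox a b = [set x | forall i, `[a i, b i]%classic (x ord0 i)]).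
  by apply: (@rV_compact _ _ (fun i => `[a i, b i]%classic)) => i; exact: segment_compact.
by apply/funext => x; apply/propext; split=> h i; have := h i; rewrite /= in_itv.
Qed.

Definition rat_lo (q : 'rV[rat]_d * nat) (i : 'I_d) : R :=
  ratr (q.1 ord0 i) - q.2.+1%:R^-1.
Definition rat_hi (q : 'rV[rat]_d * nat) (i : 'I_d) : R :=
  ratr (q.1 ord0 i) + q.2.+1%:R^-1.

(** Rational cubes are countably many, which is why an open set belongs to the
    sigma-algebra generated by the coordinates. *)
Lemma open_rat_cubes A x : open A -> A x ->
  exists q, obox (rat_lo q) (rat_hi q) x /\ cbox (rat_lo q) (rat_hi q) `<=` A.
Proof.
move=> oA Ax; have /nbhs_ballP[e /= e0 xe] : nbhs x A by exact: open_nbhs_nbhs.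
have [n ne] : exists n, n.+1%:R^-1 < e / 2 :> R.
  have e20 : 0 < (e / 2)^-1 by rewrite invr_gt0 divr_gt0.
  exists (Num.truncn (e / 2)^-1).
  by rewrite invf_plt ?posrE// ?divr_gt0// truncnS_gt.
have n0 : 0 < n.+1%:R^-1 :> R by rewrite invr_gt0.
have /choice[q hq] : forall i, exists r : rat, `|x ord0 i - ratr r| < n.+1%:R^-1.
  move=> i.
  have /rat_in_itvoo[r] : x ord0 i - n.+1%:R^-1 < x ord0 i + n.+1%:R^-1.
    by move: (n.+1%:R^-1) n0 => r r0; lra.
  rewrite in_itv/= => ri; exists r; rewrite ltr_norml.
  by move: (n.+1%:R^-1) n0 ri => r' r0 ri; lra.
exists (\row_i q i, n); split.
  move=> i; rewrite /rat_lo /rat_hi mxE /=; have := hq i; rewrite ltr_norml.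
  by move: (n.+1%:R^-1) n0 => r r0 hr; lra.
move=> y hy; apply: xe; split => // i j; rewrite ord1 /ball /=.
have := hy j; rewrite /rat_lo /rat_hi mxE /= => hj.
have := hq j; rewrite !ltr_norml.
by move: (n.+1%:R^-1) n0 ne hj => r r0 re hj hr; lra.
Qed.

Lemma open_bigcup_cubes A : open A ->
  A = \bigcup_q (if pselect (cbox (rat_lo q) (rat_hi q) `<=` A)
                 then obox (rat_lo q) (rat_hi q) else set0).
Proof.
move=> oA; apply/seteqP; split=> [x Ax|x [q _]].
  have [q [xq qA]] := open_rat_cubes oA Ax; exists q => //.
  by case: pselect.
case: pselect => // qA xq; apply: (qA) => i; have /andP[] := xq i.
by move=> /ltW -> /ltW ->.
Qed.

Lemma open_measurable_rV A : open A -> measurable A.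
Proof.
move=> oA; rewrite [A]open_bigcup_cubes//; apply: countable_bigcupT_measurable.
  exact: countableP.
by move=> q; case: pselect => ? /=; [exact: measurable_obox|exact: measurable0].
Qed.

Lemma continuous_measurable_rV (f : 'rV[R]_d -> R^o) :
  continuous f -> measurable_fun setT (f : _ -> measurableTypeR R).
Proof.
move=> cf; apply: (measurability _ (RGenOInfty.measurableE R)) => _ [_ [a ->] <-].
rewrite setTI; apply: open_measurable_rV; apply: open_comp => //.
Qed.

Lemma measurable_oboxE :
  @measurable _ 'rV[R]_d = <<s [set obox ab.1 ab.2 | ab in setT] >>.
Proof.
apply/seteqP; split; last first.
  apply: smallest_sub; first exact: sigma_algebra_measurable.
  by move=> _ [[a b] _ <-]; exact: measurable_obox.
apply: smallest_sub; first exact: smallest_sigma_algebra.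
move=> A; rewrite -bigcup_seq/= => -[i _ [B mB <-]]; rewrite setTI.
pose G := [set B : set R | <<s [set obox ab.1 ab.2 | ab in setT] >>
  ((fun x : 'rV[R]_d => x ord0 i) @^-1` B)].
suff : @measurable _ (measurableTypeR R) `<=` G by apply.
have sG := @smallest_sigma_algebra _ setT [set obox ab.1 ab.2 | ab in setT].
rewrite [X in X `<=` _](RGenOInfty.measurableE R); apply: smallest_sub.
  split.
  - by rewrite /G /= preimage_set0; case: sG.
  - by move=> C GC; rewrite /G /= setTD -preimage_setC -setTD; case: sG => _ h _; exact: h.
  - by move=> F GF; rewrite /G /= preimage_bigcup; case: sG => _ _ h; exact: h.
move=> _ [a ->]; rewrite /G /=.
rewrite (_ : _ @^-1` _ = \bigcup_n obox (fun j => if j == i then a else - n%:R) (fun j => n%:R)).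
  by case: sG => _ _; apply => n; apply: sub_sigma_algebra; eexists (_, _).
apply/seteqP; split => [x /=|x [n _] /(_ i)] /=; rewrite in_itv/= andbT; last first.
  by rewrite eqxx => /andP[].
move=> ax; have xn0 := normr_ge0 x.
exists (Num.truncn `|x|).+1 => // j.
have xj : `|x ord0 j| < (Num.truncn `|x|).+1%:R.
  by rewrite (le_lt_trans (coord_norm _ _))// truncnS_gt.
by move: xj; rewrite ltr_norml => /andP[xj ->]; case: eqP => [->|]; rewrite ?ax ?xj.
Qed.

Lemma oboxI a b a' b' : obox a b `&` obox a' b' =
  obox (fun i => Num.max (a i) (a' i)) (fun i => Num.min (b i) (b' i)).
Proof.
apply/seteqP; split => x.
  by move=> [h h'] i; have := h i; have := h' i; rewrite gt_max lt_min => /andP[-> ->] /andP[-> ->].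
by move=> h; split => i; have := h i; rewrite gt_max lt_min => /andP[/andP[? ?] /andP[? ?]]; apply/andP.
Qed.

Lemma setI_closed_obox : setI_closed [set obox ab.1 ab.2 | ab in [set: ('I_d -> R) * ('I_d -> R)]].
Proof.
move=> _ _ [[a b] _ <-] [[a' b'] _ <-]; rewrite oboxI /=.
by eexists (_, _).
Qed.

End rV_borel.

(** * A class of smooth functions closed under differentiation *)

Section flat.
Context {R : realType}.
Implicit Types (p : {poly R}) (s t : R).

(** The smooth function [exp (- 1 / t)] of the half-line, with a polynomial factor
    in [1 / t] so that derivatives have the same form. *)
Definition flat p t : R := if 0 < t then p.[t^-1] * expR (- t^-1) else 0.

(** Induction on the polynomial; the free exponent [k] absorbs the factor [s] that
    each step of the Horner scheme produces. *)
Lemma poly_exp_bounded p (k : nat) :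
  exists2 C, 0 <= C & forall s, 0 <= s -> `|p.[s]| * s ^+ k * expR (- s) <= C.
Proof.
elim/poly_ind: p k => [|p c IH] k.
  by exists 0 => // s s0; rewrite horner0 normr0 !mul0r.
have [C1 C10 h1] := IH k.+1.
exists (C1 + `|c| * (k`!%:R + 1)) => [|s s0]; first by rewrite addr_ge0// mulr_ge0// addr_ge0.
rewrite hornerMXaddC.
have sk : 0 <= s ^+ k by exact: exprn_ge0.
have e0 := expR_ge0 (- s).
have hk : s ^+ k * expR (- s) <= k`!%:R + 1.
  rewrite expRN ler_pdivrMr ?expR_gt0//; case: (k) => [|j].
    by rewrite expr0 fact0; have := expR_ge1Dx s; lra.
  have := expR_ge1Dxn j s0 => h.
  have f0 : 0 < j.+1`!%:R :> R by rewrite ltr0n fact_gt0.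
  have : s ^+ j.+1 <= j.+1`!%:R * expR s.
    rewrite mulrC -ler_pdivrMr// (le_trans _ h)// lerDr//.
  by move/le_trans; apply; rewrite ler_pM2r ?expR_gt0// lerDl.
rewrite (@le_trans _ _ ((`|p.[s]| * s + `|c|) * s ^+ k * expR (- s)))//.
  rewrite !ler_wpM2r// (le_trans (ler_normD _ _))// normrM.
  by rewrite (ger0_norm s0).
rewrite !mulrDl lerD//.
  by rewrite -[X in X * _ <= _]mulrA -exprS h1.
by rewrite -mulrA ler_wpM2l.
Qed.

(** Quadratic decay at 0 is what makes the derivative exist and vanish there. *)
Lemma flat_bound p : exists2 C, 0 <= C & forall t, `|flat p t| <= C * t ^+ 2.
Proof.
have [C C0 h] := poly_exp_bounded p 2; exists C => // t; rewrite /flat.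
case: ifPn => [t0|_]; last by rewrite normr0 mulr_ge0// sqr_ge0.
have := h t^-1; rewrite invr_ge0 ltW// => /(_ isT).
rewrite normrM (ger0_norm (expR_ge0 _)) exprVn mulrAC.
by rewrite ler_pdivrMr ?exprn_gt0.
Qed.

Lemma is_derive_flat p t :
  is_derive t 1 (flat p : R^o -> R^o) (flat ('X^2 * (p - p^`())) t).
Proof.
have [t0|t0|->] := ltgtP t 0.
- have near0 : \forall x \near (t : R^o), (cst 0 : R^o -> R^o) x = flat p x.
    near=> x; rewrite /flat ifF//; apply/negbTE; rewrite -leNgt ltW//.
    near: x; exact: lt_nbhsl.
  apply: near_eq_is_derive near0 _.
  by rewrite /flat ifF ?(lt_gtF t0)//; exact: is_derive_cst.
- have nearp : \forall x \near (t : R^o),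
    (fun x : R^o => p.[x^-1] * expR (- x^-1) : R^o) x = flat p x.
    near=> x; rewrite /flat ifT//.
    near: x; exact: lt_nbhsr.
  apply: near_eq_is_derive nearp _.
  have tn0 : t != 0 by rewrite gt_eqF.
  have dV : is_derive t 1 (fun x : R^o => x^-1 : R^o) (- t ^- 2).
    by apply: is_derive_eq; first exact: is_deriveV; rewrite /GRing.scale/= mulr1.
  have dp : is_derive t 1 (fun x : R^o => p.[x^-1] : R^o) (p^`().[t^-1] * - t ^- 2).
    have := @is_derive1_comp _ (horner p) (fun x : R^o => x^-1) t _ _ _ dV.
    by apply.
  have dN : is_derive t 1 (fun x : R^o => - x^-1 : R^o) (t ^- 2).
    by have := is_deriveN dV; rewrite opprK.
  have de : is_derive t 1 (fun x : R^o => expR (- x^-1) : R^o) (expR (- t^-1) * t ^- 2).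
    have := @is_derive1_comp _ expR (fun x : R^o => - x^-1) t _ _ _ dN.
    by apply.
  have := is_deriveM dp de; move=> /is_derive_eq; apply.
  rewrite /flat t0 !hornerE /GRing.scale/= exprVn; ring.
- have -> : flat ('X^2 * (p - p^`())) 0 = 0 by rewrite /flat ltxx.
  have [C C0 h] := flat_bound p.
  have f0 : flat p 0 = 0 by rewrite /flat ltxx.
  have lim0 : h0^-1 *: ((flat p \o shift 0) (h0 *: 1) - flat p 0) @[h0 --> (0:R^o)^'] --> (0 : R^o).
    apply/cvgr0Pnorm_le => e e0.
    have C1 : 0 < C + 1 by rewrite ltr_wpDl.
    near=> x.
    have x0 : x != 0 by near: x; exact: nbhs_dnbhs_neq.
    rewrite f0 subr0 /= addr0 /GRing.scale /= mulr1 normrM normfV.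
    rewrite mulrC ler_pdivrMr ?normr_gt0// (le_trans (h _))//.
    rewrite -real_normK ?num_real// expr2 mulrA ler_wpM2r//.
    have xe : `|x| <= e / (C + 1).
      by near: x; apply: dnbhs0_le; exact: divr_gt0.
    rewrite (le_trans (ler_wpM2l C0 xe))// mulrA ler_pdivrMr//.
    by rewrite mulrDr mulr1 mulrC lerDl ltW.
  apply: DeriveDef; first by apply/cvg_ex; exists 0.
  exact: cvg_lim lim0.
Unshelve. all: by end_near.
Qed.

Lemma flat_gt0 t : 0 < t -> flat 1 t = expR (- t^-1).
Proof. by move=> t0; rewrite /flat t0 hornerE mul1r. Qed.

Lemma flat_le0 p t : t <= 0 -> flat p t = 0.
Proof. by rewrite /flat ltNge => ->. Qed.

Lemma flat_ge0 t : 0 <= flat 1 t.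
Proof.
by have [t0|t0] := leP t 0; [rewrite flat_le0|rewrite flat_gt0// expR_ge0].
Qed.

Lemma flat_le1 t : flat 1 t <= 1.
Proof.
have [t0|t0] := leP t 0; first by rewrite flat_le0.
by rewrite flat_gt0// -expR0 ler_expR oppr_le0 invr_ge0 ltW.
Qed.

End flat.

Section smooth_algebra.
Context {R : realType} {V : normedModType R}.
Implicit Types f g : V -> R^o.

(** An affine function, seen through its constant differential. *)
Definition affine_along (l : V -> R^o) (c : V -> R) :=
  forall x, differentiable l x /\ forall v, 'd l x v = c v.

(** Smoothness is about all iterated directional derivatives, and a syntactic class
    that is closed under differentiation provides them by induction on the list of
    directions. The generators are those needed for bumps, cut-offs and
    trigonometric functions. *)
Inductive smooth_alg : (V -> R^o) -> Prop :=
| smooth_flat p l c of affine_along l c : smooth_alg (fun x => flat p (l x))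
| smooth_cos l c of affine_along l c : smooth_alg (fun x => cos (l x))
| smooth_sin l c of affine_along l c : smooth_alg (fun x => sin (l x))
| smooth_cst (a : R) : smooth_alg (fun=> a)
| smooth_add f g of smooth_alg f & smooth_alg g : smooth_alg (fun x => f x + g x)
| smooth_mul f g of smooth_alg f & smooth_alg g : smooth_alg (fun x => f x * g x)
| smooth_inv f of smooth_alg f & (forall x, f x != 0) : smooth_alg (fun x => (f x)^-1).

Lemma diff_comp1 (h dh : R^o -> R^o) (l : V -> R^o) x v :
  (forall t : R, is_derive (t : R^o) (1 : R^o) h (dh t)) -> differentiable l x ->
  differentiable (fun y => h (l y) : R^o) x /\
  'd (fun y => h (l y) : R^o) x v = dh (l x) * 'd l x v.
Proof.
move=> hdh dl.
have dhx : differentiable h (l x) by apply/derivable1_diffP; have [] := hdh (l x).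
split; first exact: (differentiable_comp dl dhx).
rewrite (_ : (fun y => h (l y)) = h \o l)// diff_comp//= diff1E// /GRing.scale/=.
by rewrite derive1E; have [_ ->] := hdh (l x); rewrite mulrC.
Qed.

Lemma smooth_alg_diff f : smooth_alg f -> (forall x, differentiable f x) /\
  forall v, exists2 f', smooth_alg f' & forall x, 'd f x v = f' x.
Proof.
elim=> {f} [p l c lc|l c lc|l c lc|a|f g sf [df hf] sg [dg hg]|f g sf [df hf] sg [dg hg]|f sf [df hf] fn0].
- have h := is_derive_flat p; split=> [x|v].
    by have [dl _] := lc x; have [] := diff_comp1 0 h dl.
  exists (fun x => flat ('X^2 * (p - p^`())) (l x) * c v).
    by apply: smooth_mul; [exact: smooth_flat lc|exact: smooth_cst].
  by move=> x; have [dl lcx] := lc x; have [_ ->] := diff_comp1 v h dl; rewrite lcx.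
- have h : forall t : R, is_derive (t : R^o) (1 : R^o) (cos : R^o -> R^o) (- sin t) by exact: is_derive_cos.
  split=> [x|v].
    by have [dl _] := lc x; have [] := diff_comp1 0 h dl.
  exists (fun x => (-1 * sin (l x)) * c v).
    apply: smooth_mul; last exact: smooth_cst.
    by apply: smooth_mul; [exact: smooth_cst|exact: smooth_sin lc].
  by move=> x; have [dl lcx] := lc x; have [_ ->] := diff_comp1 v h dl; rewrite lcx mulN1r.
- have h : forall t : R, is_derive (t : R^o) (1 : R^o) (sin : R^o -> R^o) (cos t) by exact: is_derive_sin.
  split=> [x|v].
    by have [dl _] := lc x; have [] := diff_comp1 0 h dl.
  exists (fun x => cos (l x) * c v).
    by apply: smooth_mul; [exact: smooth_cos lc|exact: smooth_cst].
  by move=> x; have [dl lcx] := lc x; have [_ ->] := diff_comp1 v h dl; rewrite lcx.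
- split=> [x|v]; first exact: differentiable_cst.
  exists (fun=> 0); first exact: smooth_cst.
  by move=> x; rewrite diff_cst.
- split=> [x|v]; first exact: (differentiableD (df x) (dg x)).
  have [f' sf' f'E] := hf v; have [g' sg' g'E] := hg v.
  exists (fun x => f' x + g' x); first exact: smooth_add.
  move=> x; rewrite -f'E -g'E.
  by have /(congr1 (fun F => F v)) := diffD (df x) (dg x).
- split=> [x|v]; first exact: (differentiableM (df x) (dg x)).
  have [f' sf' f'E] := hf v; have [g' sg' g'E] := hg v.
  exists (fun x => f x * g' x + g x * f' x); first by apply: smooth_add; exact: smooth_mul.
  move=> x; rewrite -f'E -g'E.
  by have /(congr1 (fun F => F v)) := diffM (df x) (dg x).
- split=> [x|v]; first exact: (differentiableV (df x) (fn0 x)).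
  have [f' sf' f'E] := hf v.
  exists (fun x => (-1 * ((f x)^-1 * (f x)^-1)) * f' x).
    apply: smooth_mul => //; apply: smooth_mul; first exact: smooth_cst.
    by apply: smooth_mul; exact: smooth_inv.
  move=> x; rewrite -f'E mulN1r -expr2 exprVn.
  by have /(congr1 (fun F => F v)) := diffV (df x) (fn0 x).
Qed.

Lemma smooth_alg_smooth f : smooth_alg f -> smooth f.
Proof.
move=> sf vs.
have {sf}sf : smooth_alg (iter_derive vs f).
  elim: vs => //= v vs /smooth_alg_diff[dg /(_ v)[g' sg' g'E]].
  rewrite (_ : 'D_v _ = g')//; apply/funext => x; rewrite -g'E deriveE//.
have [dg _] := smooth_alg_diff sf; split=> [x|x v].
  exact: differentiable_continuous.
exact: diff_derivable.
Qed.

Lemma smoothB f g : smooth f -> smooth g -> smooth (fun x => f x - g x).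
Proof.
move=> sf sg vs.
have -> : iter_derive vs (fun x => f x - g x) =
          (fun x => iter_derive vs f x - iter_derive vs g x).
  elim: vs => //= v vs ->; apply/funext => x.
  have [_ df] := sf vs; have [_ dg] := sg vs.
  by rewrite -deriveB.
have [cf df] := sf vs; have [cg dg] := sg vs; split=> [x|x v].
  by apply: cvgB; [exact: cf|exact: cg].
exact: derivableB.
Qed.

Lemma test_funB (U : set V) f g : test_fun U f -> test_fun U g ->
  test_fun U (fun x => f x - g x).
Proof.
move=> [sf [K [cK KU K0]]] [sg [L [cL LU L0]]]; split; first exact: smoothB.
exists (K `|` L); split; first exact: compactU.
  by move=> x [/KU|/LU].
by move=> x KL; rewrite K0 ?L0 ?subrr// => h; apply: KL; [right|left].
Qed.

Lemma smooth_alg_prod (I : Type) (s : seq I) (F : I -> V -> R^o) :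
  (forall i, smooth_alg (F i)) -> smooth_alg (fun x => \prod_(i <- s) F i x).
Proof.
move=> sF; elim: s => [|i s IH].
  by under eq_fun do rewrite big_nil; exact: smooth_cst.
by under eq_fun do rewrite big_cons; exact: smooth_mul.
Qed.

End smooth_algebra.

(** * Bump functions and time cut-offs *)

Section box_bumps.
Context {R : realType} {d : nat}.
Implicit Types (a b : 'I_d -> R) (x : 'rV[R]_d).

Lemma affine_coord (c e : R) (i : 'I_d) :
  affine_along (fun x : 'rV[R]_d => c * x ord0 i + e : R^o) (fun v => c * v ord0 i).
Proof.
move=> x.
have dx : differentiable (fun x : 'rV[R]_d => x ord0 i : R^o) x by exact: differentiable_coord.
have dE v : 'd (fun x : 'rV[R]_d => x ord0 i : R^o) x v = v ord0 i.
  have @f : {linear 'rV[R]_d -> R^o}.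
    by exists (fun N : 'rV[R]_d => N ord0 i); do 2![eexists]; do ?[constructor];
    rewrite ?mxE// => ? *; rewrite ?mxE//; move=> ?; rewrite !mxE.
  rewrite (_ : (fun x : 'rV[R]_d => _) = f)//.
  by rewrite diff_lin//; exact: coord_continuous.
have dc : differentiable (fun x : 'rV[R]_d => c * x ord0 i : R^o) x.
  exact: (differentiableZ c dx).
split=> [|v].
  by apply: (differentiableD dc); exact: differentiable_cst.
have h1 := diffD dc (differentiable_cst e x).
apply: (etrans (congr1 (@^~ v) h1)).
apply: (etrans (congr2 +%R (congr1 (@^~ v) (diffZ c dx)) (congr1 (@^~ v) (diff_cst e x)))).
by rewrite addr0; exact: (congr1 ( *%R c) (dE v)).
Qed.

(** For [s > 0] the factor [exp (- 1 / ((n + 1) s))] tends to 1 from below, so these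
    functions tend to the indicator of the box while staying below it. *)
Definition bump a b (n : nat) x : R^o :=
  \prod_(i < d) (flat 1 (n.+1%:R * x ord0 i + - (n.+1%:R * a i)) *
                 flat 1 (- n.+1%:R * x ord0 i + n.+1%:R * b i)).

Lemma bumpE a b n x : bump a b n x =
  \prod_(i < d) (flat 1 (n.+1%:R * (x ord0 i - a i)) *
                 flat 1 (n.+1%:R * (b i - x ord0 i))).
Proof.
by apply: eq_bigr => i _; congr (flat 1 _ * flat 1 _); ring.
Qed.

Lemma bump_alg a b n : smooth_alg (bump a b n).
Proof.
apply: (@smooth_alg_prod _ _ _ _ (fun i (x : 'rV[R]_d) =>
  (flat 1 (n.+1%:R * x ord0 i + - (n.+1%:R * a i)) *
   flat 1 (- n.+1%:R * x ord0 i + n.+1%:R * b i) : R^o))) => i.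
by apply: smooth_mul; apply: smooth_flat; exact: affine_coord.
Qed.

Lemma bump_out a b n x : ~ obox a b x -> bump a b n x = 0.
Proof.
move=> /existsNP[i /negP]; rewrite negb_and -!leNgt => h.
rewrite bumpE (bigD1 i)//= (_ : flat _ _ * _ = 0) ?mul0r//.
have n0 : 0 <= n.+1%:R :> R by [].
case/orP: h => h; last rewrite mulrC; rewrite flat_le0 ?mul0r// mulr_ge0_le0//; by rewrite subr_le0.
Qed.

Lemma bump_ge0 a b n x : 0 <= bump a b n x.
Proof. by apply: prodr_ge0 => i _; rewrite mulr_ge0// flat_ge0. Qed.

Lemma bump_le1 a b n x : bump a b n x <= 1.
Proof.
apply: prodr_ile1 => i _; rewrite mulr_ge0 ?flat_ge0//= mulr_ile1 ?flat_ge0 ?flat_le1//.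
Qed.

Lemma bump_cvg a b x : bump a b n x @[n --> \oo] --> (\1_(obox a b) x : R).
Proof.
rewrite indicE; have [/set_mem xab|xab] := boolP (x \in obox a b); last first.
  rewrite (_ : (fun n => _) = cst 0); first exact: cvg_cst.
  apply/funext => n; apply: bump_out.
  by move=> h; move: xab; rewrite mem_set.
pose S := \sum_(i < d) ((x ord0 i - a i)^-1 + (b i - x ord0 i)^-1).
have -> : (fun n => bump a b n x) = (fun n => expR (- (n.+1%:R^-1 * S))).
  apply/funext => n; rewrite bumpE /S mulr_sumr -sumrN expR_sum.
  apply: eq_bigr => i _; have /andP[ax xb] := xab i.
  rewrite !flat_gt0 ?mulr_gt0 ?subr_gt0// -expRD !invfM; congr expR; ring.
have h : - (harmonic n * S) @[n --> \oo] --> (0 : R).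
  rewrite -oppr0 -(mul0r S); apply: cvgN; apply: cvgMl; exact: cvg_harmonic.
by have := continuous_cvg _ (@continuous_expR R 0) h; rewrite expR0; apply.
Qed.

Lemma bump_test (Omega : set 'rV[R]_d) a b n : cbox a b `<=` Omega ->
  test_fun Omega (bump a b n).
Proof.
move=> abO; split; first exact/smooth_alg_smooth/bump_alg.
exists (cbox a b); split => //; first exact: compact_cbox.
move=> x nx; apply: bump_out => h; apply: nx => i.
by have /andP[/ltW -> /ltW ->] := h i.
Qed.

End box_bumps.

Section time_cutoffs.
Context {R : realType}.
Implicit Types t : R.

Lemma affine_line (c e : R) :
  affine_along (fun t : R^o => c * t + e : R^o) (fun v => c * v).
Proof.
move=> t; have di : is_derive t (1 : R^o) (fun t : R^o => c * t + e : R^o) c.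
  have h1 : is_derive t (1 : R^o) (fun t : R^o => c *: t : R^o) (c *: 1).
    exact: is_deriveZ.
  have := is_deriveD h1 (is_derive_cst (e : R^o) t 1).
  by rewrite addr0 /GRing.scale/= mulr1.
have dl : differentiable (fun t : R^o => c * t + e : R^o) t.
  by apply/derivable1_diffP; case: di.
split=> // v; rewrite diff1E// /GRing.scale/= derive1E.
by have [_ ->] := di; rewrite mulrC.
Qed.

Lemma smooth_alg_derive (f : R^o -> R^o) : smooth_alg f ->
  exists2 f', smooth_alg f' & forall t, is_derive t (1 : R^o) f (f' t).
Proof.
move=> /smooth_alg_diff[df /(_ 1)[f' sf' f'E]]; exists f' => // t.
by apply: DeriveDef; [exact: diff_derivable|rewrite -f'E deriveE].
Qed.

Lemma smooth_alg_continuous (V : normedModType R) (f : V -> R^o) :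
  smooth_alg f -> continuous f.
Proof. by move=> /smooth_alg_diff[df _] x; exact: differentiable_continuous. Qed.

(** A smooth transition from 0 on the negative half-line to 1 after [t = 1]. *)
Definition step t : R := flat 1 t * (flat 1 t + flat 1 (1 - t))^-1.

Lemma step_den t : 0 < flat 1 t + flat 1 (1 - t).
Proof.
have [t0|t0] := leP t 0.
  by rewrite flat_le0// add0r flat_gt0 ?expR_gt0//; lra.
by rewrite ltr_pwDl ?flat_ge0// flat_gt0// expR_gt0.
Qed.

Lemma step_le0 t : t <= 0 -> step t = 0.
Proof. by move=> t0; rewrite /step flat_le0// mul0r. Qed.

Lemma step_ge1 t : 1 <= t -> step t = 1.
Proof.
move=> t1; have := step_den t; rewrite /step [flat 1 (1 - t)]flat_le0 ?addr0.
  by move=> /lt0r_neq0 h; rewrite divff.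
by rewrite subr_le0.
Qed.

Lemma step_ge0 t : 0 <= step t.
Proof. by rewrite /step mulr_ge0 ?flat_ge0// invr_ge0 ltW// step_den. Qed.

Lemma step_le1 t : step t <= 1.
Proof. by rewrite /step ler_pdivrMr ?step_den// mul1r lerDl flat_ge0. Qed.

Lemma step_alg (c e : R) : smooth_alg (fun t : R^o => step (c * t + e) : R^o).
Proof.
have f1 := smooth_flat 1 (affine_line c e).
have f2 := smooth_flat 1 (affine_line (- c) (1 - e)).
rewrite (_ : (fun t => _) = (fun t : R^o => flat 1 (c * t + e) *
   (flat 1 (c * t + e) + flat 1 (- c * t + (1 - e)))^-1 : R^o)); last first.
  apply/funext => t; rewrite /step; congr (_ * (_ + flat 1 _)^-1); ring.
apply: smooth_mul => //; apply: smooth_inv; first exact: smooth_add.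
move=> t; rewrite (_ : - c * t + (1 - e) = 1 - (c * t + e)); last by ring.
by rewrite gt_eqF// step_den.
Qed.

Lemma is_derive_locally_cst (f : R^o -> R^o) (f' e t : R) :
  is_derive t (1 : R^o) f f' -> (\forall s \near (t : R^o), f s = e) -> f' = 0.
Proof.
move=> [_ <-] h; rewrite -(near_eq_derive _ (_ : \forall s \near (t : R^o), cst e s = f s)).
  exact: derive_cst.
by near=> s; rewrite /cst; apply/esym; near: s.
Unshelve. all: by end_near. Qed.

Lemma step_derive : exists (ds : R^o -> R^o) (C : R),
  [/\ smooth_alg ds, forall t, is_derive t (1 : R^o) (step : R^o -> R^o) (ds t),
      forall t, `|ds t| <= C & forall t, t < 0 \/ 1 < t -> ds t = 0].
Proof.
have sa : smooth_alg (step : R^o -> R^o).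
  have := step_alg 1 0; congr smooth_alg; apply/funext => t.
  by rewrite mul1r addr0.
have [ds sds dsE] := smooth_alg_derive sa.
have ds0 t : t < 0 \/ 1 < t -> ds t = 0.
  move=> [t0|t1].
    apply: (@is_derive_locally_cst step _ 0 t (dsE t)).
    by near=> s; apply: step_le0; apply: ltW; near: s; exact: lt_nbhsl.
  apply: (@is_derive_locally_cst step _ 1 t (dsE t)).
  by near=> s; apply: step_ge1; apply: ltW; near: s; exact: lt_nbhsr.
have cds : {within `[0 : R, 1], continuous (fun t => `|ds t| : R)}.
  apply: continuous_subspaceT => t; apply: continuous_comp.
    exact: smooth_alg_continuous.
  exact: norm_continuous.
have [c _ hc] := EVT_max ler01 cds.
exists ds, `|ds c|; split => // t.
have [t0|t0] := ltP t 0; first by rewrite ds0 ?normr0//; left.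
have [t1|t1] := ltP 1 t; first by rewrite ds0 ?normr0//; right.
by apply: hc; rewrite in_itv/= t0 t1.
Unshelve. all: by end_near. Qed.

(** The derivative of [chi n] is of size [n] on two layers of width [1 / n], so its
    [L^1] norm stays bounded. The factor [c] gives test functions that coincide with
    [c] away from the ends. *)
Lemma time_cutoff (T : R) : 0 < T -> exists (C : R) (chi dchi : nat -> R^o -> R^o),
  forall n,
  [/\ forall c, smooth_alg c -> test_fun (`]0, T[%classic : set R^o) (fun t => chi n t * c t),
      forall t, is_derive t (1 : R^o) (chi n) (dchi n t),
      continuous (dchi n),
      forall t, 0 <= chi n t <= 1 &
  [/\ forall t, `|dchi n t| <= C * n.+1%:R,
      forall t, 2 / n.+1%:R < t < T - 2 / n.+1%:R -> dchi n t = 0 /\ chi n t = 1,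
      chi n 0 = 0 & chi n T = 0]].
Proof.
move=> T0; have [ds [C [sds dsE dsC ds0]]] := step_derive.
(* [s1] rises from 0 to 1 on [[1/(n+1), 2/(n+1)]], and [s2] mirrors it at the other
   end. *)
pose s1 n t := step (n.+1%:R * t + - 1).
pose s2 n t := step (- n.+1%:R * t + (n.+1%:R * T - 1)).
pose d1 n t := ds (n.+1%:R * t + - 1) * n.+1%:R.
pose d2 n t := ds (- n.+1%:R * t + (n.+1%:R * T - 1)) * - n.+1%:R.
exists (C + C), (fun n t => s1 n t * s2 n t), (fun n t => s1 n t * d2 n t + s2 n t * d1 n t).
move=> n; have n0 : 0 < n.+1%:R :> R by [].
have aff (c e t : R) : is_derive t (1 : R^o) (fun t : R^o => step (c * t + e) : R^o) (ds (c * t + e) * c).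
  have [dl lE] := affine_line c e t.
  have [dd dE] := diff_comp1 (1 : R^o) dsE dl.
  apply: DeriveDef; first exact: diff_derivable.
  by apply: (etrans (deriveE _ dd)); apply: (etrans dE); rewrite lE mulr1.
have C0 : 0 <= C by apply: le_trans (dsC 0).
split.
- move=> c sc; split.
    apply: smooth_alg_smooth; apply: smooth_mul => //.
    by apply: smooth_mul; exact: step_alg.
  exists `[n.+1%:R^-1, T - n.+1%:R^-1]%classic; split; first exact: segment_compact.
    move=> t /=; rewrite !in_itv/= => /andP[h1 h2].
    have i0 : 0 < n.+1%:R^-1 :> R by rewrite invr_gt0.
    by move: i0 h1 h2; move: (n.+1%:R^-1) => r *; lra.
  move=> t /=; rewrite in_itv/= => /negP; rewrite negb_and -!ltNge => /orP[h|h].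
    rewrite /s1 step_le0 ?mul0r// subr_le0.
    by rewrite -ler_pdivlMl// mulr1 ltW.
  rewrite /s2 [step (- _ * _ + _)]step_le0 ?mulr0 ?mul0r//.
  have : T <= t + n.+1%:R^-1 by rewrite -lerBlDr ltW.
  rewrite -(ler_pM2l n0) mulrDr mulfV ?gt_eqF// => h3; lra.
- move=> t; have := is_deriveM (aff n.+1%:R (-1) t) (aff (- n.+1%:R) (n.+1%:R * T - 1) t).
  by [].
- have cc (c e : R) : continuous (fun t : R^o => c * t + e : R^o).
    by move=> t; have [/differentiable_continuous] := affine_line c e t.
  have cds c e : continuous (fun t : R^o => ds (c * t + e) : R^o).
    move=> t; apply: (@continuous_comp _ _ _ (fun t : R^o => c * t + e : R^o) ds).
      exact: cc.
    exact: smooth_alg_continuous.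
  have cst (c e : R) := smooth_alg_continuous (step_alg c e).
  move=> t; apply: cvgD; apply: cvgM; try exact: cst; apply: cvgMl; exact: cds.
- move=> t; rewrite mulr_ge0 ?step_ge0//= mulr_ile1 ?step_ge0 ?step_le1//.
split.
- move=> t; rewrite (le_trans (ler_normD _ _))// mulrDl lerD// /d1 /d2 /s1 /s2.
    rewrite normrM [X in _ * X]normrM normrN (ger0_norm (ltW n0)) ger0_norm ?step_ge0//.
    rewrite -[leRHS]mul1r ler_pM ?step_ge0 ?mulr_ge0 ?step_le1// ?ler_wpM2r// ltW.
  rewrite normrM [X in _ * X]normrM (ger0_norm (ltW n0)) ger0_norm ?step_ge0//.
  by rewrite -[leRHS]mul1r ler_pM ?step_ge0 ?mulr_ge0 ?step_le1// ?ler_wpM2r// ltW.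
- move=> t /andP[h1 h2].
  have {}h1 : 2 < n.+1%:R * t by rewrite mulrC -ltr_pdivrMr.
  have {}h2 : n.+1%:R * t < n.+1%:R * T - 2.
    rewrite (_ : _ - 2 = n.+1%:R * (T - 2 / n.+1%:R)); last by field; rewrite gt_eqF.
    by rewrite ltr_pM2l.
  have e1 : step (n.+1%:R * t + - 1) = 1 by apply: step_ge1; lra.
  have e2 : step (- n.+1%:R * t + (n.+1%:R * T - 1)) = 1 by apply: step_ge1; lra.
  have e3 : ds (n.+1%:R * t + - 1) = 0 by apply: ds0; right; lra.
  have e4 : ds (- n.+1%:R * t + (n.+1%:R * T - 1)) = 0 by apply: ds0; right; lra.
  by rewrite /s1 /s2 /d1 /d2 e1 e2 e3 e4; split; ring.
- by rewrite /s1 step_le0 ?mul0r//; lra.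
- by rewrite /s2 [step (- _ * _ + _)]step_le0 ?mulr0//; lra.
Qed.

End time_cutoffs.

(** * The fundamental lemma of the calculus of variations *)

Section test_function_bounds.
Context {R : realType}.

Lemma test_fun_derive (V : normedModType R) (U : set V) (phi : V -> R^o) v :
  hausdorff_space V -> test_fun U phi -> test_fun U ('D_v phi).
Proof.
move=> hV [sphi [K [cK KU K0]]]; split.
  move=> vs; have := sphi (rcons vs v).
  by rewrite /iter_derive foldr_rcons.
exists K; split => // x nKx.
rewrite -(near_eq_derive _ (_ : \forall s \near x, cst 0 s = phi s)).
  exact: derive_cst.
have : open (~` K) by apply: closed_openC; exact: compact_closed.
move=> oK; have : nbhs x (~` K) by exact: open_nbhs_nbhs.
apply: filterS => y Ky.
by rewrite /cst K0.
Qed.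

Lemma test_fun_bounded (V : normedModType R) (U : set V) (phi : V -> R^o) :
  test_fun U phi -> exists2 M, 0 <= M & forall x, `|phi x| <= M.
Proof.
move=> [sphi [K [cK KU K0]]]; have [cphi _] := sphi [::].
have [[x Kx]|K_0] := pselect (K !=set0); last first.
  exists 0 => // x; rewrite K0 ?normr0// => Kx; apply: K_0; by exists x.
have cn : {within K, continuous (fun x => `|phi x| : R)}.
  apply: continuous_subspaceT => y; apply: continuous_comp; first exact: cphi.
  exact: norm_continuous.
have [c _ hc] := compact_EVT_max (ex_intro _ x Kx) cK cn.
exists `|phi c| => // y; have [Ky|nKy] := pselect (K y); first by apply: hc; rewrite inE.
by rewrite K0// normr0.
Qed.

End test_function_bounds.

Section fundamental_lemma.
Context {R : realType} {d : nat}.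
Local Notation vol := (@lebesgue_rV R d).
Variable Omega : set 'rV[R]_d.
Hypotheses (oO : open Omega) (finO : (vol Omega < +oo)%E).
Implicit Types (phi : 'rV[R]_d -> R^o).

Let mO : measurable Omega. Proof. exact: open_measurable_rV. Qed.

Lemma test_fun_meas phi : test_fun Omega phi -> measurable_fun Omega phi.
Proof.
move=> [sphi _]; have [cphi _] := sphi [::].
by apply: measurable_funTS; exact: continuous_measurable_rV.
Qed.

Lemma test_fun_L2 phi : test_fun Omega phi -> L2 vol Omega phi.
Proof.
move=> tphi; have [M _ hM] := test_fun_bounded tphi.
apply: (@L2_bounded _ _ _ _ _ mO M) => //.
exact: test_fun_meas.
Qed.

Lemma grad_coord phi x i : grad phi x ord0 i = 'D_(delta_mx ord0 i) phi x.
Proof. by rewrite mxE. Qed.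

Lemma test_fun_grad phi i : test_fun Omega phi ->
  test_fun Omega (fun x => grad phi x ord0 i).
Proof.
move=> tphi; rewrite (_ : (fun x => _) = 'D_(delta_mx ord0 i) phi).
  apply: test_fun_derive => //; exact: norm_hausdorff.
by apply/funext => x; rewrite grad_coord.
Qed.

(** Bumps are admissible test functions and converge boundedly to the indicator of
    the box. *)
Lemma integral_obox_eq0 (g : 'rV[R]_d -> R) a b :
  vol.-integrable Omega (EFin \o g) -> cbox a b `<=` Omega ->
  (forall phi, test_fun Omega phi -> \int[vol]_(x in Omega) (g x * phi x) = 0) ->
  \int[vol]_(x in obox a b) g x = 0.
Proof.
move=> ig abO g0; have mab := measurable_obox a b.
have mg := intg_meas ig.
have oabO : obox a b `<=` Omega.
  by move=> x h; apply: abO => i; have /andP[/ltW -> /ltW ->] := h i.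
have mb n : measurable_fun Omega (bump a b n) by apply: test_fun_meas; exact: bump_test.
have [|||||_ h] := @Rdominated _ _ _ vol Omega mO (fun n x => g x * bump a b n x)
  (fun x => g x * \1_(obox a b) x) (fun x => `|g x|).
- by move=> n; exact: measurable_funM.
- by apply: measurable_funM => //; exact: measurable_indic.
- exact: integrable_norm ig.
- by apply: aeW => x _; apply: cvgMr; exact: bump_cvg.
- apply: aeW => x _ n; rewrite normrM ler_piMr// ger0_norm ?bump_ge0//.
  exact: bump_le1.
rewrite -(Rintegral_indic _ _ mab oabO).
rewrite -(cvg_lim (@Rhausdorff R) h) (_ : (fun n => _) = cst 0) ?lim_cst//.
by apply/funext => n; apply: g0; exact: bump_test.
Qed.

(** Inside a box contained in [Omega], the integral of [g] vanishes on all smaller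
    boxes, hence on all Borel sets by the monotone class theorem. Countably many
    rational cubes then cover [Omega]. *)
Lemma ae_eq0_of_test (g : 'rV[R]_d -> R) :
  vol.-integrable Omega (EFin \o g) ->
  (forall phi, test_fun Omega phi -> \int[vol]_(x in Omega) (g x * phi x) = 0) ->
  \forall x \ae vol, Omega x -> g x = 0.
Proof.
move=> ig g0.
suff h (q : 'rV[rat]_d * nat) : cbox (rat_lo q) (rat_hi q) `<=` Omega ->
    \forall x \ae vol, obox (rat_lo q) (rat_hi q) x -> g x = 0.
  have h2 (q : 'rV[rat]_d * nat) : \forall x \ae vol,
     cbox (rat_lo q) (rat_hi q) `<=` Omega -> obox (rat_lo q) (rat_hi q) x -> g x = 0.
    have [/h|nq] := pselect (cbox (@rat_lo R d q) (rat_hi q) `<=` Omega).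
      by apply: filterS => x hx _.
    by apply: aeW => x.
  have : \forall x \ae vol, forall n, if unpickle n is Some q then
     cbox (rat_lo q) (rat_hi q) `<=` Omega -> obox (rat_lo q) (rat_hi q) x -> g x = 0 else True.
    apply: ae_foralln => n; case: (unpickle n) => [q|]; [exact: h2|exact: aeW].
  apply: filterS => x hx Ox; have [q [xq qO]] := open_rat_cubes oO Ox.
  by have := hx (pickle q); rewrite pickleK; apply.
set a := rat_lo q; set b := rat_hi q => abO.
have mab := measurable_obox a b.
have oabO : obox a b `<=` Omega.
  by move=> x hx; apply: abO => i; have /andP[/ltW -> /ltW ->] := hx i.
have igab : vol.-integrable (obox a b) (EFin \o g) by exact: integrableS oabO ig.
have fin E : measurable E -> E `<=` obox a b -> (\int[vol]_(x in E) (g x)%:E)%E \is a fin_num.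
  move=> mE Eab; apply: integrable_fin_num => //; exact: integrableS Eab igab.
have P E : measurable E -> (\int[vol]_(x in E `&` obox a b) (g x)%:E = 0)%E.
  have gen := @measurable_oboxE R d.
  move=> mE; have : <<s [set obox ab.1 ab.2 | ab in [set: ('I_d -> R) * ('I_d -> R)]] >> E.
    by rewrite -gen.
  apply: (@dynkin_induction _ _ _ (fun E => (\int[vol]_(x in E `&` obox a b) (g x)%:E = 0)%E) gen).
  - exact: setI_closed_obox.
  - rewrite setTI -[LHS]fineK; last exact: fin.
    by have := integral_obox_eq0 ig abO g0; rewrite /Rintegral => ->.
  - move=> _ [[a' b'] _ <-] /=; rewrite oboxI -[LHS]fineK; last first.
      rewrite -oboxI; apply: fin => //; apply: measurableI => //; exact: measurable_obox.
    rewrite [X in X%:E](_ : _ = 0)//; apply: integral_obox_eq0 => //.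
    move=> x hx; apply: abO => i; have := hx i.
    by rewrite ge_max le_min => /andP[/andP[_ ->] /andP[_ ->]].
  - move=> S mS h; have mSab : measurable (S `&` obox a b) by exact: measurableI.
    have mSab' : measurable (~` S `&` obox a b) by apply: measurableI => //; exact: measurableC.
    have := @integral_setU _ _ _ vol _ _ (EFin \o g) mSab mSab'.
    rewrite -setIUl setUv setTI h add0e => <-//; last 2 first.
    + exact: measurable_int igab.
    + by apply/disj_setPS => x [[h1 _] [h2 _]].
    + rewrite -[LHS]fineK; last exact: fin.
      by have := integral_obox_eq0 ig abO g0; rewrite /Rintegral => ->.
  - move=> F mF tF hF; rewrite setI_bigcupl integral_bigcup.
    + by apply: eseries0 => n _ _; exact: hF.
    + exact: trivIset_setIr.
    + by move=> k; exact: measurableI.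
    + apply: integrableS igab => //; last by move=> x [k _ []].
      by apply: bigcup_measurable => k _; exact: measurableI.
have := @integral_ae_eq _ _ _ vol (obox a b) mab (cst 0%E) (EFin \o g) igab (measurable_cst _).
have hE E : E `<=` obox a b -> measurable E ->
   (\int[vol]_(x in E) (EFin \o g) x = \int[vol]_(x in E) cst 0 x)%E.
  by move=> Eab mE; rewrite integral0 -[in LHS](setIidl Eab) P.
by move=> /(_ hE); apply: filterS => x h1 /h1 [].
Qed.

End fundamental_lemma.

(** * Weak gradients and functions vanishing on the boundary *)

Section L2_norm_bounds.
Context {dT : measure_display} {X : measurableType dT} {R : realType}.
Variables (mu : {measure set X -> \bar R}) (D : set X).
Hypothesis mD : measurable D.

Lemma L2norm_lt (f : X -> R) e : 0 < e -> L2 mu D f ->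
  (L2norm mu D f < e%:E)%E = (\int[mu]_(x in D) (f x ^+ 2) < e ^+ 2).
Proof.
move=> e0 hf; by rewrite L2normEfin// lte_fin -{1}(ger0_norm (ltW e0)) -sqrtr_sqr ltr_sqrt ?exprn_gt0.
Qed.

Lemma L2norm_lt_sum (f g h : X -> R) e : 0 < e -> L2 mu D f -> L2 mu D g ->
  measurable_fun D h -> (forall x, D x -> `|h x| <= `|f x| + `|g x|) ->
  (L2norm mu D f < (e / 2)%:E)%E -> (L2norm mu D g < (e / 2)%:E)%E ->
  (L2norm mu D h < e%:E)%E.
Proof.
move=> e0 hf hg mh hfg; have e20 : 0 < e / 2 by rewrite divr_gt0.
have hsq x : D x -> h x ^+ 2 <= 2 * f x ^+ 2 + 2 * g x ^+ 2.
  move=> Dx; rewrite -[h x ^+ 2]real_normK ?num_real// -[f x ^+ 2]real_normK ?num_real//.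
  rewrite -[g x ^+ 2]real_normK ?num_real//.
  have := hfg x Dx; have := normr_ge0 (h x); have := sqr_ge0 (`|f x| - `|g x|).
  move=> a b c; rewrite (@le_trans _ _ ((`|f x| + `|g x|) ^+ 2))//; last by lra.
  by rewrite lerXn2r ?nnegrE// addr_ge0.
have isum : mu.-integrable D (EFin \o (fun x => 2 * f x ^+ 2 + 2 * g x ^+ 2)).
  by apply: intgD => //; apply: intgZ => //; exact: L2_sqr.
have hh : L2 mu D h.
  apply/L2P => //; split => //; apply: intg_le isum => //.
    exact: measurable_funX.
  by move=> x Dx; rewrite ger0_norm ?sqr_ge0// hsq.
rewrite !L2norm_lt// => If Ig.
apply: (@le_lt_trans _ _ (\int[mu]_(x in D) (2 * f x ^+ 2 + 2 * g x ^+ 2))).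
  by apply: le_Rintegral => //; exact: L2_sqr.
rewrite RintegralD//; try by apply: intgZ => //; exact: L2_sqr.
rewrite !RintegralZl//; try exact: L2_sqr.
by move: If Ig; rewrite !expr_div_n; lra.
Qed.

End L2_norm_bounds.

Section vector_norm_bounds.
Context {R : realType} {d : nat}.

Lemma enormD_le (u v : 'rV[R]_d) : enorm (u + v) <= enorm u + enorm v.
Proof.
rewrite -(@ler_pXn2r _ 2)// ?nnegrE ?addr_ge0 ?enorm_ge0//.
rewrite enorm_sqr dotDl !dotDr (dotC v).
have := dot_enorm u v; have := ler_norm (dot u v).
by have := enorm_sqr u; have := enorm_sqr v; nra.
Qed.

Lemma enormN (u : 'rV[R]_d) : enorm (- u) = enorm u.
Proof. by rewrite -scaleN1r enormZ normrN1 mul1r. Qed.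

Lemma enormB_le (u v : 'rV[R]_d) : enorm (u - v) <= enorm u + enorm v.
Proof. by rewrite (le_trans (enormD_le _ _))// enormN. Qed.

Context {dT : measure_display} {X : measurableType dT}.
Variables (mu : {measure set X -> \bar R}) (D : set X).
Hypothesis mD : measurable D.

Lemma L2v_of_coord (g : X -> 'rV[R]_d) :
  (forall i, L2 mu D (fun x => g x ord0 i)) -> L2v mu D g.
Proof.
move=> hg; have mg : measurable_fun D g.
  by apply: measurable_rVP => // i; apply: L2_meas; exact: hg.
apply/L2vP; split => //; apply/L2P => //; split; first exact: measurable_enorm.
under eq_fun do rewrite enorm_sqr.
have [] := @Rintegral_sum _ _ _ mu D mD _ (index_enum 'I_d)
   (fun i x => g x ord0 i * g x ord0 i) => //.
by move=> i; apply: L2_mul => //; exact: hg.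
Qed.

Lemma measurable_rVB (g h : X -> 'rV[R]_d) : measurable_fun D g ->
  measurable_fun D h -> measurable_fun D (fun x => g x - h x).
Proof.
move=> mg mh; apply: measurable_rVP => // i; under eq_fun do rewrite !mxE.
by apply: measurable_funB; exact: measurable_fun_coord.
Qed.

End vector_norm_bounds.

Section weak_gradients.
Context {R : realType} {d : nat}.
Local Notation vol := (@lebesgue_rV R d).
Variable Omega : set 'rV[R]_d.
Hypotheses (oO : open Omega) (finO : (vol Omega < +oo)%E).

Let mO : measurable Omega. Proof. exact: open_measurable_rV. Qed.

Lemma test_grad_L2v phi : test_fun Omega phi -> L2v vol Omega (grad phi).
Proof.
move=> tphi; apply: L2v_of_coord => // i; apply: test_fun_L2 => //.
exact: test_fun_grad.
Qed.

(** Each coordinate of the difference is orthogonal to all test functions. *)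
Lemma is_wgrad_unique w g g' : is_wgrad Omega w g -> is_wgrad Omega w g' ->
  \forall x \ae vol, Omega x -> g x = g' x.
Proof.
move=> [L2w L2g hg] [_ L2g' hg'].
have h i : \forall x \ae vol, Omega x -> g x ord0 i - g' x ord0 i = 0.
  have Li := L2v_coord mO i L2g; have Li' := L2v_coord mO i L2g'.
  apply: (@ae_eq0_of_test _ _ _ oO (fun x => g x ord0 i - g' x ord0 i)); first by apply: L2_integrable => //; exact: L2B.
  move=> phi tphi; have Lphi := test_fun_L2 oO finO tphi.
  under eq_Rintegral do rewrite mulrBl.
  rewrite RintegralB//; try exact: L2_mul.
  by have := hg _ tphi i; rewrite hg'// => /eqP; rewrite eqr_opp => /eqP ->; rewrite subrr.
have : \forall x \ae vol, forall i, Omega x -> g x ord0 i - g' x ord0 i = 0.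
  by apply: filter_forall => i; exact: h.
apply: filterS => x hx Ox; apply/rowP => i; apply/eqP.
by rewrite -subr_eq0 hx.
Qed.

Lemma is_wgradB w g w' g' : is_wgrad Omega w g -> is_wgrad Omega w' g' ->
  is_wgrad Omega (fun x => w x - w' x) (fun x => g x - g' x).
Proof.
move=> [L2w L2g hg] [L2w' L2g' hg']; split; [exact: L2B|exact: L2vB|].
move=> phi tphi i; have Lphi := test_fun_L2 oO finO tphi.
have Lgr := test_fun_L2 oO finO (test_fun_grad i tphi).
have Li := L2v_coord mO i L2g; have Li' := L2v_coord mO i L2g'.
under eq_Rintegral do rewrite mulrBl.
rewrite RintegralB//; try exact: L2_mul.
under [in RHS]eq_Rintegral do rewrite !mxE mulrBl.
rewrite RintegralB//; try exact: L2_mul.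
by rewrite hg// hg'// opprB addrC opprK.
Qed.

Lemma gradB (phi psi : 'rV[R]_d -> R^o) x : smooth phi -> smooth psi ->
  grad (fun x => phi x - psi x) x = grad phi x - grad psi x.
Proof.
move=> /(_ [::])[_ dphi] /(_ [::])[_ dpsi]; apply/rowP => i; rewrite !mxE.
by rewrite deriveB.
Qed.

(** The differences of approximating test functions approximate the difference. *)
Lemma H10B w w' : H10 Omega w -> H10 Omega w' -> H10 Omega (fun x => w x - w' x).
Proof.
move=> [g wg hg] [g' wg' hg']; exists (fun x => g x - g' x); first exact: is_wgradB.
move=> e e0; have e20 : 0 < e / 2 by rewrite divr_gt0.
have [phi tphi [h1 h2]] := hg _ e20; have [psi tpsi [h3 h4]] := hg' _ e20.
have tB := test_funB tphi tpsi.
have [Lw Lg _] := wg; have [Lw' Lg' _] := wg'.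
have Lphi := test_fun_L2 oO finO tphi; have Lpsi := test_fun_L2 oO finO tpsi.
have Lgphi := test_grad_L2v tphi; have Lgpsi := test_grad_L2v tpsi.
exists (fun x => phi x - psi x) => //; split.
  apply: (L2norm_lt_sum mO e0 _ _ _ _ h1 h3); try exact: L2B.
    exact: (L2_meas (L2B mO (L2B mO Lw Lw') (L2B mO Lphi Lpsi))).
  move=> x _.
  have -> : w x - w' x - (phi x - psi x) = (w x - phi x) - (w' x - psi x) by ring.
  exact: ler_normB.
have L1 := L2vB mO Lg Lgphi; have L3 := L2vB mO Lg' Lgpsi.
have mB : measurable_fun Omega (fun x => (g x - g' x) - grad (fun x => phi x - psi x) x).
  apply: measurable_rVB => //; first by case: (L2vB mO Lg Lg').
  by have [] := test_grad_L2v tB.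
apply: (L2norm_lt_sum mO e0 _ _ _ _ h2 h4).
- by have /L2vP[] := L1.
- by have /L2vP[] := L3.
- exact: measurable_enorm.
have nn (a : 'rV[R]_d) : `|enorm a| = enorm a by rewrite ger0_norm// enorm_ge0.
move=> x _.
have := enormB_le (g x - grad phi x) (g' x - grad psi x).
have -> : (g x - grad phi x) - (g' x - grad psi x) =
    g x - g' x - grad (fun x => phi x - psi x) x.
  rewrite gradB; [|by case: tphi|by case: tpsi].
  by apply/rowP => i; rewrite !mxE; ring.
by rewrite -[X in X <= _]nn -[X in _ <= X + _]nn -[X in _ <= _ + X]nn; apply.
Qed.

(** For a test function this is the definition of the weak divergence, and both
    sides are continuous in the [H^1] norm. *)
Lemma H10_ibp rho h w g : is_wdiv Omega rho h -> H10 Omega w -> is_wgrad Omega w g ->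
  \int[vol]_(x in Omega) dot (rho x) (g x) = - \int[vol]_(x in Omega) (h x * w x).
Proof.
move=> [Lr Lh hr] [g0 wg0 happ] wg.
have [Lw Lg0 _] := wg0; have [_ Lg _] := wg.
rewrite (_ : \int[vol]_(x in Omega) dot (rho x) (g x) =
   \int[vol]_(x in Omega) dot (rho x) (g0 x)); last first.
  apply: ae_eq_Rintegral => //; try by apply: measurable_dot; [case: Lr|case: Lg|case: Lg0].
  - by apply: measurable_dot; [case: Lr|case: Lg].
  - by apply: measurable_dot; [case: Lr|case: Lg0].
  have := is_wgrad_unique wg wg0; apply: filterS => x hx Ox; by rewrite hx.
apply/eqP; rewrite -subr_eq0 opprK; apply/eqP.
set A := (X in X + _); set B := (X in _ + X).
set r := Num.sqrt (\int[vol]_(x in Omega) (enorm (rho x) ^+ 2)).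
set s := Num.sqrt (\int[vol]_(x in Omega) (h x ^+ 2)).
have r0 : 0 <= r by exact: sqrtr_ge0.
have s0 : 0 <= s by exact: sqrtr_ge0.
have key e : 0 < e -> `|A + B| <= (r + s) * e.
  move=> e0; have [phi tphi [h1 h2]] := happ _ e0.
  have Lphi := test_fun_L2 oO finO tphi; have Lgphi := test_grad_L2v tphi.
  have L1 := L2B mO Lw Lphi; have L2' := L2vB mO Lg0 Lgphi.
  have -> : A + B = \int[vol]_(x in Omega) dot (rho x) (g0 x - grad phi x) +
                    \int[vol]_(x in Omega) (h x * (w x - phi x)).
    under eq_Rintegral do rewrite dotBr.
    under [X in _ = _ + X]eq_Rintegral do rewrite mulrBr.
    rewrite !RintegralB//; try exact: L2v_dot; try exact: L2_mul.
    by rewrite (hr _ tphi) -/A -/B; ring.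
  rewrite (le_trans (ler_normD _ _))// mulrDl lerD//.
    rewrite (le_trans (cauchy_schwarz_dot mO Lr L2'))// ler_wpM2l// ltW//.
    by move: h2; rewrite /L2normv L2normEfin//; have /L2vP[] := L2'.
  rewrite (le_trans (cauchy_schwarz mO Lh L1))// ler_wpM2l// ltW//.
  by move: h1; rewrite L2normEfin.
apply/eqP; rewrite -normr_le0; apply/ler_addgt0Pr => e e0.
have rs0 : 0 < r + s + 1 by rewrite ltr_wpDl ?addr_ge0.
rewrite add0r (le_trans (key _ (divr_gt0 e0 rs0)))//.
by rewrite mulrC mulrAC ler_pdivrMr// ler_wpM2l ?lerDl// ltW.
Qed.

End weak_gradients.

(** * Functions on a product and their fibres *)

Section fubini_rectangle.
Context {d1 d2 : measure_display} {T1 : measurableType d1} {T2 : measurableType d2}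
  {R : realType}.
Variables (m1 : {sigma_finite_measure set T1 -> \bar R})
  (m2 : {sigma_finite_measure set T2 -> \bar R}) (A : set T1) (B : set T2).
Hypotheses (mA : measurable A) (mB : measurable B).
Implicit Types f g : T1 * T2 -> R.
Local Notation m12 := (m1 \x m2)%E.
Local Notation AB := (A `*` B).

Let mAB : measurable AB. Proof. exact: measurableX. Qed.

Section patches.
Context {U : pointedType} (h : T1 * T2 -> U).

Lemma patch_rect1 x : A x ->
  (fun t => (h \_ AB) (x, t)) = (fun t => h (x, t)) \_ B.
Proof.
move=> Ax; apply/funext => t; rewrite !patchE; congr (if _ then _ else _).
by apply/idP/idP; rewrite !inE => // -[].
Qed.

Lemma patch_rect1N x : ~ A x -> (fun t => (h \_ AB) (x, t)) = (fun=> point).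
Proof.
by move=> nAx; apply/funext => t; rewrite patchE; case: ifPn => //; rewrite inE => -[].
Qed.

Lemma patch_rect2 t : B t ->
  (fun x => (h \_ AB) (x, t)) = (fun x => h (x, t)) \_ A.
Proof.
move=> Bt; apply/funext => x; rewrite !patchE; congr (if _ then _ else _).
by apply/idP/idP; rewrite !inE => // -[].
Qed.

Lemma patch_rect2N t : ~ B t -> (fun x => (h \_ AB) (x, t)) = (fun=> point).
Proof.
by move=> nBt; apply/funext => x; rewrite patchE; case: ifPn => //; rewrite inE => -[].
Qed.

End patches.

Lemma sect1_meas {d3 : measure_display} {T3 : measurableType d3} (f : T1 * T2 -> T3) x :
  measurable_fun AB f -> A x -> measurable_fun B (fun t => f (x, t)).
Proof.
move=> mf Ax mB' Y mY.
have := measurable_xsection x (mf mAB Y mY); congr measurable.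
apply/seteqP; split=> t; rewrite /xsection/= inE/=.
  by move=> [[_ Bt] Yt].
by move=> [Bt Yt].
Qed.

Lemma sect2_meas {d3 : measure_display} {T3 : measurableType d3} (f : T1 * T2 -> T3) t :
  measurable_fun AB f -> B t -> measurable_fun A (fun x => f (x, t)).
Proof.
move=> mf Bt mA' Y mY.
have := measurable_ysection t (mf mAB Y mY); congr measurable.
apply/seteqP; split=> x; rewrite /ysection/= inE/=.
  by move=> [[Ax _] Yt].
by move=> [Ax Yt].
Qed.

Section tonelli.
Variable F : T1 * T2 -> \bar R.
Hypotheses (mF : measurable_fun AB F) (F0 : forall u, AB u -> (0 <= F u)%E).

Let mFr : measurable_fun setT (F \_ AB).
Proof. exact/(measurable_restrictT F mAB). Qed.

Let Fr0 u : (0 <= (F \_ AB) u)%E.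
Proof. by rewrite patchE; case: ifPn => //; rewrite inE; exact: F0. Qed.

Let inner1 : (fun x => \int[m2]_t (F \_ AB) (x, t))%E =
             (fun x => \int[m2]_(t in B) F (x, t))%E \_ A.
Proof.
apply/funext => x; rewrite patchE; case: ifPn => [/set_mem Ax|/negP Ax].
  by rewrite patch_rect1// -integral_mkcond.
by rewrite patch_rect1N ?integral0_eq// => h; apply: Ax; rewrite inE.
Qed.

Let inner2 : (fun t => \int[m1]_x (F \_ AB) (x, t))%E =
             (fun t => \int[m1]_(x in A) F (x, t))%E \_ B.
Proof.
apply/funext => x; rewrite patchE; case: ifPn => [/set_mem Ax|/negP Ax].
  by rewrite patch_rect2// -integral_mkcond.
by rewrite patch_rect2N ?integral0_eq// => h; apply: Ax; rewrite inE.
Qed.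

Lemma tonelli_rect1 : measurable_fun A (fun x => \int[m2]_(t in B) F (x, t))%E /\
  (\int[m12]_(u in AB) F u = \int[m1]_(x in A) \int[m2]_(t in B) F (x, t))%E.
Proof.
split.
  apply/(measurable_restrictT _ mA); rewrite -inner1.
  exact: (measurable_fun_fubini_tonelli_F _ mFr Fr0).
rewrite integral_mkcond (fubini_tonelli1 _ mFr Fr0) /fubini_F inner1.
by rewrite -integral_mkcond.
Qed.

Lemma tonelli_rect2 : measurable_fun B (fun t => \int[m1]_(x in A) F (x, t))%E /\
  (\int[m12]_(u in AB) F u = \int[m2]_(t in B) \int[m1]_(x in A) F (x, t))%E.
Proof.
split.
  apply/(measurable_restrictT _ mB); rewrite -inner2.
  exact: (measurable_fun_fubini_tonelli_G _ mFr Fr0).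
rewrite integral_mkcond (fubini_tonelli2 _ mFr Fr0) /fubini_G inner2.
by rewrite -integral_mkcond.
Qed.

End tonelli.

Section fubini.
Variable f : T1 * T2 -> R.
Hypothesis intf : m12.-integrable AB (EFin \o f).

Let iFr : m12.-integrable setT ((EFin \o f) \_ AB).
Proof. exact/(integrable_mkcond _ mAB). Qed.

Lemma ae_intg1 : \forall x \ae m1, A x -> m2.-integrable B (fun t => (f (x, t))%:E).
Proof.
have := ae_integrable1 iFr; apply: filterS => x /[swap] Ax.
by rewrite patch_rect1// => /(integrable_mkcond _ mB).
Qed.

Lemma ae_intg2 : \forall t \ae m2, B t -> m1.-integrable A (fun x => (f (x, t))%:E).
Proof.
have := ae_integrable2 iFr; apply: filterS => x /[swap] Ax.
by rewrite patch_rect2// => /(integrable_mkcond _ mA).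
Qed.

Let F1 : fubini_F m2 ((EFin \o f) \_ AB) = (fun x => \int[m2]_(t in B) (f (x, t))%:E)%E \_ A.
Proof.
apply/funext => x; rewrite /fubini_F patchE; case: ifPn => [/set_mem Ax|/negP Ax].
  by rewrite patch_rect1// -integral_mkcond.
by rewrite patch_rect1N ?integral0_eq// => h; apply: Ax; rewrite inE.
Qed.

Let F2 : fubini_G m1 ((EFin \o f) \_ AB) = (fun t => \int[m1]_(x in A) (f (x, t))%:E)%E \_ B.
Proof.
apply/funext => x; rewrite /fubini_G patchE; case: ifPn => [/set_mem Ax|/negP Ax].
  by rewrite patch_rect2// -integral_mkcond.
by rewrite patch_rect2N ?integral0_eq// => h; apply: Ax; rewrite inE.
Qed.

Let i1 : m1.-integrable A (fun x => \int[m2]_(t in B) (f (x, t))%:E)%E.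
Proof. by apply/(integrable_mkcond _ mA); rewrite -F1; exact: integrable_fubini_F. Qed.

Let i2 : m2.-integrable B (fun t => \int[m1]_(x in A) (f (x, t))%:E)%E.
Proof.
have mi : measurable_fun B (fun t => \int[m1]_(x in A) (f (x, t))%:E)%E.
  by apply/(measurable_restrictT _ mB); rewrite -F2; apply: (measurable_fubini_G iFr).
apply/integrableP; split => //.
have /integrableP[mf foo] := intf.
have mabs : measurable_fun AB (fun u => `|(f u)%:E|)%E by exact: measurableT_comp.
have [m2i h2] := tonelli_rect2 mabs (fun _ _ => abse_ge0 _).
apply: le_lt_trans foo; rewrite [leRHS]h2.
apply: ge0_le_integral => //; first exact: measurableT_comp.
move=> t Bt; apply: le_abse_integral => //.
by apply/measurable_EFinP; apply: sect2_meas Bt; exact/measurable_EFinP.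
Qed.

Let fineE d (T : measurableType d) (m : {measure set T -> \bar R}) (C : set T)
    (G : T -> \bar R) : measurable C -> m.-integrable C G ->
  m.-integrable C (EFin \o (fine \o G)) /\
  (\int[m]_(x in C) G x = \int[m]_(x in C) (fine (G x))%:E)%E.
Proof.
move=> mC iG; have mfG : measurable_fun C (EFin \o (fine \o G)).
  by apply/measurable_EFinP; apply: measurableT_comp => //; exact: measurable_int iG.
have aeG : \forall x \ae m, C x -> G x = (fine (G x))%:E.
  by have := integrable_ae mC iG; apply: filterS => x h Cx; rewrite fineK// h.
split; last by apply: ae_eq_integral => //; exact: measurable_int iG.
apply/integrableP; split => //.
have /integrableP[mG] := iG; apply: le_lt_trans.
apply: ge0_le_integral => //; [exact: measurableT_comp|exact: measurableT_comp|].
by move=> x Cx /=; case: (G x) => [r| |] //=; rewrite ?normr0 ?leey.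
Qed.

Lemma Rfubini_rect1 : m1.-integrable A (EFin \o (fun x => \int[m2]_(t in B) f (x, t))) /\
  \int[m12]_(u in AB) f u = \int[m1]_(x in A) \int[m2]_(t in B) f (x, t).
Proof.
have [h1 h2] := fineE mA i1; split => //.
rewrite /Rintegral; congr fine; rewrite -h2 integral_mkcond.
by rewrite -integral12_prod_meas1// F1 -integral_mkcond.
Qed.

Lemma Rfubini_rect2 : m2.-integrable B (EFin \o (fun t => \int[m1]_(x in A) f (x, t))) /\
  \int[m12]_(u in AB) f u = \int[m2]_(t in B) \int[m1]_(x in A) f (x, t).
Proof.
have [h1 h2] := fineE mB i2; split => //.
rewrite /Rintegral; congr fine; rewrite -h2 integral_mkcond.
by rewrite -integral21_prod_meas1// F2 -integral_mkcond.
Qed.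

End fubini.

(** The integral of [|f - g|] over the product is computed slice by slice;
    measurability of [f] and [g] is what allows passing from almost all slices to
    almost all points. *)
Lemma ae_rect_of_sections f g : measurable_fun AB f -> measurable_fun AB g ->
  (\forall t \ae m2, B t -> \forall x \ae m1, A x -> f (x, t) = g (x, t)) ->
  \forall u \ae m12, AB u -> f u = g u.
Proof.
move=> mf mg h.
have mfg : measurable_fun AB (fun u => (f u - g u)%:E).
  by apply/measurable_EFinP; exact: measurable_funB.
have : (\int[m12]_(u in AB) `|(f u - g u)%:E| = 0)%E.
  have mabs : measurable_fun AB (fun u => `|(f u - g u)%:E|)%E by exact: measurableT_comp.
  have [mi ->] := tonelli_rect2 mabs (fun _ _ => abse_ge0 _).
  rewrite (@ae_eq_integral _ _ _ m2 B (cst 0%E))//; first exact: integral0.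
  move: h; apply: filterS => t ht Bt; rewrite (@ae_eq_integral _ _ _ m1 A (cst 0%E))//.
  - exact: integral0.
  - exact: (sect2_meas mabs Bt).
  - by move: (ht Bt); apply: filterS => x hx Ax /=; rewrite hx// subrr normr0.
move=> /(ae_eq_integral_abs _ mAB mfg); apply: filterS => u hu /hu /= [/eqP].
by rewrite subr_eq0 => /eqP.
Qed.

End fubini_rectangle.

(** * Orthonormal systems: Bessel and Parseval *)

Section orthonormal.
Context {dT : measure_display} {X : measurableType dT} {R : realType}.
Variables (mu : {measure set X -> \bar R}) (D : set X).
Hypothesis mD : measurable D.
Local Notation intg f := (mu.-integrable D (EFin \o f)).

Definition ip (f g : X -> R) : R := \int[mu]_(x in D) (f x * g x).

Lemma ipC f g : ip f g = ip g f.
Proof. by apply: eq_Rint => x _; rewrite mulrC. Qed.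

Lemma ipDl f g h : L2 mu D f -> L2 mu D g -> L2 mu D h ->
  ip (fun x => f x + g x) h = ip f h + ip g h.
Proof.
move=> Lf Lg Lh; rewrite -RintegralD//; try exact: L2_mul.
by apply: eq_Rint => x _; rewrite mulrDl.
Qed.

Lemma ipBl f g h : L2 mu D f -> L2 mu D g -> L2 mu D h ->
  ip (fun x => f x - g x) h = ip f h - ip g h.
Proof.
move=> Lf Lg Lh; rewrite -RintegralB//; try exact: L2_mul.
by apply: eq_Rint => x _; rewrite mulrBl.
Qed.

Lemma ipZl c f h : L2 mu D f -> L2 mu D h -> ip (fun x => c * f x) h = c * ip f h.
Proof.
move=> Lf Lh; rewrite -RintegralZl//; try exact: L2_mul.
by apply: eq_Rint => x _; rewrite mulrA.
Qed.

Lemma ip_ge0 f : 0 <= ip f f.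
Proof. by apply: Rintegral_ge0 => x _; rewrite -expr2 sqr_ge0. Qed.

Lemma ip_CS f g : L2 mu D f -> L2 mu D g ->
  `|ip f g| <= Num.sqrt (ip f f) * Num.sqrt (ip g g).
Proof. exact: cauchy_schwarz. Qed.

Variable e : nat -> X -> R.
Hypotheses (Le : forall i, L2 mu D (e i))
  (orth : forall i j, ip (e i) (e j) = (i == j)%:R).
Implicit Types u v : X -> R.

Definition proj n u (x : X) : R := \sum_(i < n) ip u (e i) * e i x.

Lemma proj_L2 n u : L2 mu D (proj n u).
Proof.
elim: n => [|n IH]; rewrite /proj.
  under eq_fun do rewrite big_ord0.
  have := L2Z mD 0 (Le 0%N); under eq_fun do rewrite mul0r.
  by [].
by under eq_fun do rewrite big_ord_recr /=; apply: L2D => //; exact: L2Z.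
Qed.

Lemma ip_proj n u v : L2 mu D v ->
  ip (proj n u) v = \sum_(i < n) ip u (e i) * ip v (e i).
Proof.
move=> Lv; elim: n => [|n IH].
  rewrite big_ord0 -(Rintegral0 mu D); apply: eq_Rint => x _.
  by rewrite /proj big_ord0 mul0r.
rewrite big_ord_recr /= -IH [ip v _]ipC -ipZl// -ipDl//; last 2 first.
- exact: proj_L2.
- exact: L2Z.
by apply: eq_Rint => x _; rewrite /proj big_ord_recr.
Qed.

Lemma ip_proj_e n u j : (j < n)%N -> ip (proj n u) (e j) = ip u (e j).
Proof.
move=> jn; rewrite ip_proj// (bigD1 (Ordinal jn))//= orth eqxx mulr1 big1 ?addr0//.
by move=> i /negbTE ij; rewrite orth eq_sym -val_eqE/= in ij *; rewrite ij mulr0.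
Qed.

(** The squared distance from [u] to the span of the first [n] vectors. *)
Definition defect n u : R := ip u u - \sum_(i < n) ip u (e i) ^+ 2.

(** Pythagoras: the residual of the projection is orthogonal to the projection. *)
Lemma defectE n u : L2 mu D u ->
  defect n u = ip (fun x => u x - proj n u x) (fun x => u x - proj n u x).
Proof.
move=> Lu; have Lp := proj_L2 n u; have Lr := L2B mD Lu Lp.
rewrite ipBl// ![ip _ (fun x => _ - _)]ipC !ipBl//.
rewrite [ip u (proj n u)]ipC ip_proj//.
rewrite ip_proj// /defect.
have -> : \sum_(i < n) ip u (e i) * ip (proj n u) (e i) = \sum_(i < n) ip u (e i) ^+ 2.
  by apply: eq_bigr => i _; rewrite ip_proj_e.
under [X in _ - X - _]eq_bigr do rewrite -expr2.
by ring.
Qed.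

Lemma defect_ge0 n u : L2 mu D u -> 0 <= defect n u.
Proof. by move=> Lu; rewrite defectE// ip_ge0. Qed.

Lemma bessel n u : L2 mu D u -> \sum_(i < n) ip u (e i) ^+ 2 <= ip u u.
Proof. by move=> /(defect_ge0 n); rewrite /defect subr_ge0. Qed.

Lemma defect_le n u : defect n u <= ip u u.
Proof. by rewrite /defect gerBl sumr_ge0// => i _; exact: sqr_ge0. Qed.

Lemma defect_nincr m n u : (m <= n)%N -> defect n u <= defect m u.
Proof.
move=> /subnK <-; elim: (n - m)%N => // k IH; apply: le_trans IH.
by rewrite addSn /defect big_ord_recr /= opprD addrA gerBl sqr_ge0.
Qed.

Lemma defectZ n c u : L2 mu D u -> defect n (fun x => c * u x) = c ^+ 2 * defect n u.
Proof.
move=> Lu; have Lcu := L2Z mD c Lu.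
rewrite /defect ipZl// ipC ipZl// mulrBr mulr_sumr mulrA -expr2; congr (_ - _).
by apply: eq_bigr => i _; rewrite ipZl// exprMn.
Qed.

Lemma defectD n u v : L2 mu D u -> L2 mu D v ->
  defect n (fun x => u x + v x) <= 2 * defect n u + 2 * defect n v.
Proof.
move=> Lu Lv; have LD := L2D mD Lu Lv; rewrite !defectE//.
have Lr := L2B mD Lu (proj_L2 n u); have Ls := L2B mD Lv (proj_L2 n v).
rewrite -!RintegralZl//; try exact: L2_mul.
rewrite -RintegralD//; try by apply: intgZ => //; exact: L2_mul.
apply: le_Rintegral => //.
- by apply: L2_mul => //; apply: L2B => //; exact: proj_L2.
- by apply: intgD => //; apply: intgZ => //; exact: L2_mul.
move=> x _; have -> : proj n (fun x => u x + v x) x = proj n u x + proj n v x.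
  by rewrite -big_split; apply: eq_bigr => i _ /=; rewrite ipDl// mulrDl.
by set a := proj n u x; set b := proj n v x; have := sqr_ge0 ((u x - a) - (v x - b)); nra.
Qed.

Lemma eq_defect n u v : (forall x, D x -> u x = v x) -> defect n u = defect n v.
Proof.
move=> uv; rewrite /defect; congr (_ - _).
  by apply: eq_Rint => x Dx; rewrite uv.
by apply: eq_bigr => i _; congr (_ ^+ 2); apply: eq_Rint => x Dx; rewrite uv.
Qed.

(** Membership in the closed linear span of the [e i]; one small defect is enough
    because defects decrease with [n]. *)
Definition spanned u := forall eps, 0 < eps -> exists n, defect n u < eps.

Lemma spannedP u : L2 mu D u -> spanned u <-> defect n u @[n --> \oo] --> (0 : R).
Proof.
move=> Lu; split=> [su|cu eps e0].
  apply/cvgr0Pnorm_lt => eps e0; have [n hn] := su _ e0; near=> m.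
  rewrite ger0_norm ?defect_ge0// (le_lt_trans _ hn)// defect_nincr//.
  by near: m; exists n.
have /cvgr0Pnorm_lt/(_ _ e0)[n _ hn] := cu; exists n.
by rewrite (le_lt_trans (ler_norm _))// hn /=.
Unshelve. all: by end_near. Qed.

Lemma spannedZ c u : L2 mu D u -> spanned u -> spanned (fun x => c * u x).
Proof.
move=> Lu su eps e0; have c0 : 0 < c ^+ 2 + 1 by rewrite ltr_wpDl ?sqr_ge0.
have [n hn] := su _ (divr_gt0 e0 c0); exists n; rewrite defectZ//.
have d0 := defect_ge0 n Lu; rewrite (@le_lt_trans _ _ ((c ^+ 2 + 1) * defect n u))//.
  by rewrite ler_wpM2r// lerDl.
by rewrite mulrC -ltr_pdivlMr.
Qed.

Lemma spannedD u v : L2 mu D u -> L2 mu D v -> spanned u -> spanned v ->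
  spanned (fun x => u x + v x).
Proof.
move=> Lu Lv su sv eps e0; have e4 : 0 < eps / 4 by rewrite divr_gt0.
have [n hn] := su _ e4; have [m hm] := sv _ e4; exists (maxn n m).
rewrite (le_lt_trans (defectD _ Lu Lv))//.
have := le_lt_trans (defect_nincr u (leq_maxl n m)) hn.
by have := le_lt_trans (defect_nincr v (leq_maxr n m)) hm; lra.
Qed.

Lemma spanned0 : spanned (fun=> 0).
Proof.
move=> eps e0; exists 0%N; rewrite /defect big_ord0 subr0 /ip.
by under eq_Rintegral do rewrite mulr0; rewrite Rintegral0.
Qed.

Lemma L2_sum (F : nat -> X -> R) k : (forall i, L2 mu D (F i)) ->
  L2 mu D (fun x => \sum_(i < k) F i x).
Proof.
move=> LF; elim: k => [|k IH].
  have := L2Z mD 0 (Le 0%N); congr L2; apply/funext => x.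
  by rewrite big_ord0 mul0r.
have := L2D mD IH (LF k); congr L2; apply/funext => x.
by rewrite big_ord_recr.
Qed.

Lemma spanned_sum (F : nat -> X -> R) k : (forall i, L2 mu D (F i)) ->
  (forall i, spanned (F i)) -> spanned (fun x => \sum_(i < k) F i x).
Proof.
move=> LF sF; elim: k => [|k IH].
  have := spanned0; congr spanned; apply/funext => x; by rewrite big_ord0.
have := spannedD (L2_sum k LF) (LF k) IH (sF k); congr spanned; apply/funext => x.
by rewrite big_ord_recr.
Qed.

(** The defect of [v] is at most twice that of [u k] plus twice the squared distance
    between them, since a defect never exceeds the squared norm. *)
Lemma spanned_lim (u : nat -> X -> R) v :
  (forall k, L2 mu D (u k)) -> L2 mu D v -> (forall k, spanned (u k)) ->
  \int[mu]_(x in D) ((v x - u k x) ^+ 2) @[k --> \oo] --> (0 : R) -> spanned v.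
Proof.
move=> Lu Lv su cu eps e0; have e4 : 0 < eps / 4 by rewrite divr_gt0.
have /cvgr0Pnorm_lt/(_ _ e4)[k _ hk] := cu.
have [n hn] := su k _ e4; exists n.
have LB := L2B mD Lv (Lu k).
rewrite (@eq_defect _ _ (fun x => (v x - u k x) + u k x)); last first.
  by move=> x _; rewrite subrK.
rewrite (le_lt_trans (defectD n LB (Lu k)))//.
have := hk k (leqnn k); rewrite /= ger0_norm; last first.
  by apply: Rintegral_ge0 => x _; exact: sqr_ge0.
have := defect_le n (fun x => v x - u k x).
rewrite /ip; under [X in _ <= X -> _]eq_Rintegral do rewrite -expr2.
by move=> h1 h2; lra.
Qed.

(** The error of the partial sum is the inner product of [v] with [u] minus its
    projection, whose norm is the square root of the defect of [u]. *)
Lemma parseval u v : L2 mu D u -> L2 mu D v -> spanned u ->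
  \sum_(i < n) ip u (e i) * ip v (e i) @[n --> \oo] --> ip u v.
Proof.
move=> Lu Lv /(spannedP Lu) su.
have h n : `|ip u v - \sum_(i < n) ip u (e i) * ip v (e i)| <=
    Num.sqrt (defect n u) * Num.sqrt (ip v v).
  rewrite -ip_proj// -ipBl//; last exact: proj_L2.
  rewrite defectE//; apply: ip_CS => //; apply: L2B => //; exact: proj_L2.
have lim0 : Num.sqrt (defect n u) * Num.sqrt (ip v v) @[n --> \oo] --> (0 : R).
  rewrite -(mul0r (Num.sqrt (ip v v))); apply: cvgMl.
  have := continuous_cvg _ (@sqrt_continuous R 0) su; rewrite sqrtr0; exact.
apply/subr_cvg0; apply/cvgr0Pnorm_lt => eps e0.
have /cvgr0Pnorm_lt/(_ _ e0)[n _ hn] := lim0; exists n => // m nm /=.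
rewrite distrC (le_lt_trans (h m))// (le_lt_trans (ler_norm _))//.
exact: hn.
Qed.

End orthonormal.

(** * The trigonometric system *)

Section intervals.
Context {R : realType}.
Local Notation leb := (@lebesgue_measure R).

Lemma open_itv_fin (a b : R) : (leb `]a, b[%classic < +oo)%E.
Proof. by rewrite lebesgue_measure_itv/=; case: ifP => _; rewrite ?ltry// -EFinB ltry. Qed.

Lemma continuous_intg (f : R -> R) (a b : R) : continuous f ->
  leb.-integrable `]a, b[ (EFin \o f).
Proof.
move=> cf; have h : leb.-integrable `[a, b] (EFin \o f).
  apply: continuous_compact_integrable; first exact: segment_compact.
  exact: continuous_subspaceT.
apply: integrableS h => //; exact: subset_itv_oo_cc.
Qed.

Lemma ftc_open (F f : R -> R) (a b : R) : a < b ->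
  (forall t, is_derive t (1 : R^o) (F : R^o -> R^o) (f t)) -> continuous f ->
  \int[leb]_(t in `]a, b[) f t = F b - F a.
Proof.
move=> ab dF cf.
have cF : continuous F.
  move=> t; apply: differentiable_continuous; apply/derivable1_diffP.
  by have [] := dF t.
have mf (c d : itv_bound R) : measurable_fun [set` Interval c d] (EFin \o f).
  by apply/measurable_EFinP; apply: measurable_funTS; exact: continuous_measurable_fun.
rewrite /Rintegral (_ : (\int[leb]_(t in `]a, b[) (f t)%:E = (F b)%:E - (F a)%:E)%E)//.
rewrite integral_itv_obnd_cbnd// integral_itv_bndo_bndc//.
apply: continuous_FTC2 => //.
- exact: continuous_subspaceT.
- split.
  + by move=> t _; have [] := dF t.
  + by apply: cvg_at_right_filter; exact: cF.
  + by apply: cvg_at_left_filter; exact: cF.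
- by move=> t _; rewrite derive1E; have [_ ->] := dF t.
Qed.

End intervals.

Section trigonometric_system.
Context {R : realType}.
Variable T : R.
Hypothesis T0 : 0 < T.
Local Notation leb := (@lebesgue_measure R).
Local Notation I := `]0, T[%classic.
Local Notation omega := (2 * pi / T).

Lemma omega_gt0 : 0 < omega. Proof. by rewrite divr_gt0// mulr_gt0// pi_gt0. Qed.

Lemma cos_wave_continuous (A phi : R) : continuous (fun t : R => cos (A * t - phi)).
Proof.
move=> t; apply: continuous_comp; last exact: continuous_cos.
by apply: cvgB; [apply: cvgMr; exact: cvg_id|exact: cvg_cst].
Qed.

Lemma integral_cos (A phi a : R) : A != 0 -> 0 < a ->
  \int[leb]_(t in `]0, a[) cos (A * t - phi) = (sin (A * a - phi) + sin phi) / A.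
Proof.
move=> A0 a0.
have dF (t : R) : is_derive t (1 : R^o)
    (fun t : R^o => A^-1 * sin (A * t - phi) : R^o) (cos (A * t - phi)).
  have dl : is_derive t (1 : R^o) (fun t : R^o => A * t - phi : R^o) A.
    have h1 : is_derive t (1 : R^o) (fun t : R^o => A *: t : R^o) (A *: 1).
      exact: is_deriveZ.
    have := is_deriveB h1 (is_derive_cst (phi : R^o) t 1).
    by rewrite subr0 /GRing.scale/= mulr1.
  have ds := @is_derive1_comp _ sin (fun t : R^o => A * t - phi : R^o) t _ _ (is_derive_sin _) dl.
  have := is_deriveZ A^-1 ds.
  by rewrite /GRing.scale/= mulrCA mulVf// mulr1.
rewrite (ftc_open a0 dF (@cos_wave_continuous A phi)).
by rewrite mulr0 sub0r sinN mulrN opprK -mulrDr mulrC.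
Qed.

Lemma sin_period (n : nat) (phi : R) : sin (n%:R * (2 * pi) - phi) = - sin phi.
Proof.
rewrite -sinN; elim: n => [|n IH]; first by rewrite mul0r sub0r.
rewrite -IH -[in RHS](sinD2pi (n%:R * (2 * pi) - phi)); congr sin.
by rewrite -natr1; ring.
Qed.

Lemma integral_cos_period (n : nat) (phi : R) :
  \int[leb]_(t in I) cos (n%:R * omega * t - phi) = if n == 0%N then T * cos phi else 0.
Proof.
case: eqP => [->|/eqP n0].
  under eq_Rintegral do rewrite !mul0r sub0r cosN.
  rewrite Rintegral_cst//= lebesgue_measure_itv/= lte_fin T0 -EFinB/= subr0.
  by rewrite mulrC.
have om0 := omega_gt0.
have A0 : n%:R * omega != 0 by rewrite mulf_neq0 ?pnatr_eq0// gt_eqF.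
rewrite integral_cos//.
have -> : n%:R * omega * T = n%:R * (2 * pi) by field; rewrite gt_eqF.
by rewrite sin_period addNr mul0r.
Qed.

(** Index [2k - 1] is the cosine of frequency [k] and index [2k] is the sine. *)
Definition trig (n : nat) (t : R) : R :=
  if n == 0%N then (Num.sqrt T)^-1
  else Num.sqrt (2 / T) * cos ((uphalf n)%:R * omega * t - (~~ odd n)%:R * (pi / 2)).

Lemma trig_continuous n : continuous (trig n).
Proof.
rewrite /trig; case: eqP => _ t; first exact: cvg_cst.
by apply: cvgMr; exact: cos_wave_continuous.
Qed.

Lemma continuous_L2 (f : R -> R) : continuous f -> L2 leb I f.
Proof.
move=> cf; apply/L2P => //; split.
  by apply: measurable_funTS; exact: continuous_measurable_fun.
by apply: continuous_intg => t; apply: cvgM; exact: cf.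
Qed.

Lemma trig_L2 n : L2 leb I (trig n).
Proof. by apply: continuous_L2; exact: trig_continuous. Qed.

(** Product to sum; on a full period only zero frequencies contribute. *)
Lemma integral_cos_cos (j k : nat) (a b : R) : (j <= k)%N ->
  \int[leb]_(t in I) (cos (j%:R * omega * t - a) * cos (k%:R * omega * t - b)) =
  ((if (k - j)%N == 0%N then T * cos (b - a) else 0) +
   (if (k + j)%N == 0%N then T * cos (b + a) else 0)) / 2.
Proof.
move=> jk; rewrite -!integral_cos_period -RintegralD//; last 2 first.
- by apply: continuous_intg; exact: cos_wave_continuous.
- by apply: continuous_intg; exact: cos_wave_continuous.
rewrite [RHS]mulrC -RintegralZl//; last first.
  by apply: continuous_intg => t; apply: cvgD; exact: cos_wave_continuous.
apply: eq_Rint => t _.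
rewrite natrB// natrD.
have -> : (k%:R - j%:R) * omega * t - (b - a) =
   (k%:R * omega * t - b) - (j%:R * omega * t - a) by ring.
have -> : (k%:R + j%:R) * omega * t - (b + a) =
   (k%:R * omega * t - b) + (j%:R * omega * t - a) by ring.
move: (k%:R * omega * t - b) (j%:R * omega * t - a) => x y.
by rewrite cosB cosD; field.
Qed.

Lemma trig_orthonormal i j : ip leb I (trig i) (trig j) = (i == j)%:R.
Proof.
wlog ij : i j / (i <= j)%N.
  move=> H; have [/H//|/ltnW /H] := leqP i j; by rewrite ipC eq_sym.
have sT : 0 < Num.sqrt T by rewrite sqrtr_gt0.
have sT2 : Num.sqrt T ^+ 2 = T by rewrite sqr_sqrtr// ltW.
have s2 : Num.sqrt (2 / T) ^+ 2 = 2 / T by rewrite sqr_sqrtr// divr_ge0// ltW.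
have u0 (n : nat) : n != 0%N -> (uphalf n == 0)%N = false by case: n => // -[].
rewrite /ip /trig; have [i0|i0] := eqVneq i 0%N.
  have [j0|j0] := eqVneq j 0%N.
    rewrite i0 j0 Rintegral_cst//= lebesgue_measure_itv/= lte_fin T0 -EFinB/= subr0.
    by rewrite -expr2 exprVn sT2 mulVf ?gt_eqF.
  rewrite i0 [LHS](_ : _ = \int[leb]_(t in I) ((Num.sqrt T)^-1 * Num.sqrt (2 / T) *
      cos ((uphalf j)%:R * omega * t - (~~ odd j)%:R * (pi / 2)))); last first.
    by apply: eq_Rint => t _; ring.
  rewrite RintegralZl//; last by apply: continuous_intg; exact: cos_wave_continuous.
  by rewrite integral_cos_period u0// mulr0 eq_sym (negbTE j0).
have j0 : j != 0%N by rewrite -lt0n (leq_trans _ ij)// lt0n.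
rewrite (negbTE j0) [LHS](_ : _ = \int[leb]_(t in I) ((2 / T) *
   (cos ((uphalf i)%:R * omega * t - (~~ odd i)%:R * (pi / 2)) *
    cos ((uphalf j)%:R * omega * t - (~~ odd j)%:R * (pi / 2))))); last first.
  by apply: eq_Rint => t _; move: (Num.sqrt (2 / T)) s2 => q <-; ring.
rewrite RintegralZl//; last first.
  by apply: continuous_intg => t; apply: cvgM; exact: cos_wave_continuous.
have hij : (uphalf i <= uphalf j)%N by rewrite !uphalfE half_leq.
rewrite integral_cos_cos// addn_eq0.
rewrite (u0 j) ?(u0 i)//= addr0 subn_eq0.
have [ji|ji] := leqP (uphalf j) (uphalf i); last first.
  rewrite mul0r mulr0; case: eqP => // eij; move: ji; by rewrite eij ltnn.
have {ji hij}eu : uphalf i = uphalf j by apply/eqP; rewrite eqn_leq hij ji.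
have -> : (i == j) = (odd i == odd j).
  apply/eqP/eqP => [->//|eo]; rewrite -(odd_double_half i) -(odd_double_half j) -eo.
  by move: eu; rewrite !uphalf_half -eo => /addnI ->.
have Tn0 : T != 0 by rewrite gt_eqF.
case: (odd i); case: (odd j); rewrite /= ?mul1r ?mul0r ?subrr ?subr0 ?sub0r ?cosN ?cos0 ?cos_pihalf.
- by field.
- by rewrite !(mulr0, mul0r).
- by rewrite !(mulr0, mul0r).
- by field.
Qed.

End trigonometric_system.

(** * The trigonometric series of a parabola *)

Section sawtooth_series.
Context {R : realType}.
Implicit Types (x s : R) (N : nat).

Local Notation is_der f x d := (is_derive (x : R^o) (1 : R^o) (f : R^o -> R^o) d).

Lemma is_derive_sinZ (c s : R) : is_der (fun t => sin (c * t)) s (c * cos (c * s)).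
Proof.
have dl : is_der (fun t => c * t) s c.
  have h : is_der (fun t => c *: (t : R^o)) s (c *: 1) by exact: is_deriveZ.
  by move: h; rewrite /GRing.scale/= mulr1.
have := @is_derive1_comp _ sin (fun t => c * t) s _ _ (is_derive_sin _) dl.
by rewrite mulrC.
Qed.

Lemma is_derive_cosZ (c s : R) : is_der (fun t => cos (c * t)) s (- (c * sin (c * s))).
Proof.
have dl : is_der (fun t => c * t) s c.
  have h : is_der (fun t => c *: (t : R^o)) s (c *: 1) by exact: is_deriveZ.
  by move: h; rewrite /GRing.scale/= mulr1.
have := @is_derive1_comp _ cos (fun t => c * t) s _ _ (is_derive_cos _) dl.
by rewrite mulNr mulrC.
Qed.

Lemma is_derive_inv (f : R -> R) (df s : R) : f s != 0 -> is_der f s df ->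
  is_der (fun t => (f t)^-1) s (- (f s) ^- 2 * df).
Proof. by move=> f0 dfs; exact: is_deriveV. Qed.

Lemma is_deriveMM (f g : R -> R) (df dg s : R) : is_der f s df -> is_der g s dg ->
  is_der (fun t => f t * g t) s (f s * dg + g s * df).
Proof. by move=> df' dg'; exact: is_deriveM. Qed.

Lemma is_deriveDD (f g : R -> R) (df dg s : R) : is_der f s df -> is_der g s dg ->
  is_der (fun t => f t + g t) s (df + dg).
Proof. by move=> df' dg'; exact: is_deriveD. Qed.

Lemma is_deriveZZ (c : R) (f : R -> R) (df s : R) : is_der f s df ->
  is_der (fun t => c * f t) s (c * df).
Proof. by move=> df'; exact: is_deriveZ. Qed.

Lemma is_der_cst (c s : R) : is_der (fun=> c) s 0.
Proof. exact: is_derive_cst. Qed.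

Lemma is_der_id (s : R) : is_der (fun t => t) s 1.
Proof. exact: is_derive_id. Qed.

Lemma is_der_eq (f : R -> R) (d d' s : R) : is_der f s d -> d = d' -> is_der f s d'.
Proof. by move=> h <-. Qed.

(** Partial sums of the series of [pi x / 2 - x ^ 2 / 4] on [0, 2 pi], and the
    difference with that polynomial. *)
Definition saw N x : R := \sum_(k < N) (1 - cos (k.+1%:R * x)) / k.+1%:R ^+ 2.
Definition saw_err N x : R := saw N x - (pi * x / 2 - x ^+ 2 / 4).
Let dsaw N x : R := \sum_(k < N) sin (k.+1%:R * x) / k.+1%:R - (pi / 2 - x / 2).
Let mid N : R := N%:R + 2^-1.

Lemma is_derive_saw_err N x : is_der (saw_err N) x (dsaw N x).
Proof.
elim: N => [|N IH].
  have -> : saw_err 0 = (fun t => - (pi / 2) * t + 4^-1 * (t * t)).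
    by apply/funext => t; rewrite /saw_err /saw big_ord0; field.
  have h := is_deriveDD (is_deriveZZ (- (pi / 2)) (is_der_id x))
    (is_deriveZZ 4^-1 (is_deriveMM (is_der_id x) (is_der_id x))).
  apply: (is_der_eq h).
  by rewrite /dsaw big_ord0; field.
have k0 : N.+1%:R != 0 :> R by rewrite pnatr_eq0.
have -> : saw_err N.+1 = (fun t => saw_err N t +
    (N.+1%:R ^- 2 * (1 + -1 * cos (N.+1%:R * t)))).
  by apply/funext => t; rewrite /saw_err /saw big_ord_recr /=; field.
have h := is_deriveDD IH (is_deriveZZ (N.+1%:R ^- 2) (is_deriveDD (is_der_cst 1 x)
  (is_deriveZZ (-1) (is_derive_cosZ N.+1%:R x)))).
apply: (is_der_eq h).
by rewrite /dsaw big_ord_recr /=; field.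
Qed.

Lemma dirichlet_kernel N s :
  2 * sin (s / 2) * (2^-1 + \sum_(k < N) cos (k.+1%:R * s)) = sin (mid N * s).
Proof.
elim: N => [|N IH].
  by rewrite big_ord0 addr0 /mid add0r mulrC mulKf ?pnatr_eq0// mulrC.
rewrite big_ord_recr /= addrA mulrDr IH /mid.
have -> : (N%:R + 2^-1) * s = N.+1%:R * s - s / 2 by rewrite -natr1; field.
have -> : (N.+1%:R + 2^-1) * s = N.+1%:R * s + s / 2 by field.
by rewrite sinB sinD; ring.
Qed.

Lemma is_derive_dsaw N x : is_der (dsaw N) x (\sum_(k < N) cos (k.+1%:R * x) + 2^-1).
Proof.
elim: N => [|N IH].
  have -> : dsaw 0 = (fun t => - (pi / 2) + 2^-1 * t).
    by apply/funext => t; rewrite /dsaw big_ord0; field.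
  have h := is_deriveDD (is_der_cst (- (pi / 2)) x) (is_deriveZZ 2^-1 (is_der_id x)).
  apply: (is_der_eq h).
  by rewrite big_ord0; ring.
have k0 : N.+1%:R != 0 :> R by rewrite pnatr_eq0.
have -> : dsaw N.+1 = (fun t => dsaw N t + (N.+1%:R^-1 * sin (N.+1%:R * t))).
  by apply/funext => t; rewrite /dsaw big_ord_recr /=; field.
have h := is_deriveDD IH (is_deriveZZ (N.+1%:R^-1) (is_derive_sinZ N.+1%:R x)).
apply: (is_der_eq h).
by rewrite big_ord_recr /=; field.
Qed.

Lemma sin_npi (n : nat) : sin (n%:R * pi) = 0 :> R.
Proof.
elim: n => [|n IH]; first by rewrite mul0r sin0.
by rewrite -natr1 mulrDl mul1r sinDpi IH oppr0.
Qed.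

Lemma dsaw_pi N : dsaw N pi = 0.
Proof. by rewrite /dsaw subrr subr0 big1// => k _; rewrite sin_npi mul0r. Qed.

Lemma half_sin_gt0 s : 0 < s <= pi -> 0 < sin (s / 2).
Proof. by move=> h; apply: sin_gt0_pi; have := @pi_gt0 R; lra. Qed.

Let mid_gt0 N : 0 < mid N. Proof. by rewrite ltr_wpDl. Qed.

(** Integrating the Dirichlet kernel by parts over [x, pi] gains a factor [1 / (N +
    1/2)]. What remains is [G], with [|G'| <= - K'] and [G pi = 0], so monotonicity
    of [G + K] and [G - K] yields [|G| <= K]. *)
Lemma dsaw_bound N x : 0 < x <= pi -> `|dsaw N x| <= (mid N * sin (x / 2))^-1.
Proof.
move=> hx; have m0 := mid_gt0 N; have p0 := @pi_gt0 R.
pose S s : R := sin (2^-1 * s).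
have SE s : S s = sin (s / 2) by rewrite /S mulrC.
have S0 s : x <= s <= pi -> 0 < S s by move=> h; rewrite SE half_sin_gt0//; lra.
pose K s : R := (2 * mid N)^-1 * (S s)^-1.
pose dK s : R := (2 * mid N)^-1 * (- (S s) ^- 2 * (2^-1 * cos (2^-1 * s))).
(* By the Dirichlet kernel, [dsaw] has derivative [sin (mid N * s) / (2 S s)]; [- K *
   cos] is a primitive of it up to the term [- K' * cos], which is of one order smaller
   in [N]. *)
pose G s : R := dsaw N s + K s * cos (mid N * s).
pose dG s : R := cos (mid N * s) * dK s.
have dKE s : x <= s <= pi -> is_der K s (dK s).
  move=> hs; have Sn0 : S s != 0 by rewrite gt_eqF ?S0.
  exact: (is_deriveZZ _ (is_derive_inv Sn0 (is_derive_sinZ 2^-1 s))).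
have dGE s : x <= s <= pi -> is_der G s (dG s).
  move=> hs; have := is_deriveDD (is_derive_dsaw N s)
    (is_deriveMM (dKE s hs) (is_derive_cosZ (mid N) s)).
  move=> /is_der_eq; apply.
  have := dirichlet_kernel N s; rewrite -SE; have := S0 s hs.
  rewrite /dG /K => s0 h; have Sn0 : S s != 0 by rewrite gt_eqF.
  have -> : \sum_(k < N) cos (k.+1%:R * s) + 2^-1 = sin (mid N * s) / (2 * S s).
    by rewrite -h; field; rewrite Sn0.
  by field; rewrite Sn0 gt_eqF.
have dK_le0 s : x <= s <= pi -> dK s <= 0.
  move=> hs; rewrite /dK mulrCA mulNr oppr_le0 mulr_ge0 ?invr_ge0 ?sqr_ge0//.
  rewrite mulr_ge0 ?invr_ge0 ?mulr_ge0 ?(ltW m0)// cos_ge0_pihalf//; lra.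
have xpi : x <= pi by case/andP: hx.
have mvt (H dH : R -> R) : (forall s, x <= s <= pi -> is_der H s (dH s)) ->
    exists2 c, x <= c <= pi & H pi - H x = dH c * (pi - x).
  move=> HdH; have [||c] := @MVT_segment R H dH x pi xpi.
  - by move=> s; rewrite in_itv/= => /andP[a b]; apply: HdH; rewrite !ltW.
  - apply: derivable_within_continuous => s; rewrite in_itv/= => hs.
    by have [] := HdH s hs.
  by rewrite in_itv/= => hc e; exists c.
have Kpi : 0 < K pi.
  rewrite /K SE sin_pihalf invr1 mulr1 invr_gt0 mulr_gt0//.
have Gpi : G pi = 0.
  rewrite /G dsaw_pi add0r /mid mulrDl mulrC -[2^-1 * pi]mulrC cosDpihalf.
  by rewrite sin_npi oppr0 mul0r.
have [c1 hc1 e1] := mvt (fun s => G s + K s) (fun s => dG s + dK s)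
  (fun s hs => is_deriveDD (dGE s hs) (dKE s hs)).
have [c2 hc2 e2] := mvt (fun s => G s + -1 * K s) (fun s => dG s + -1 * dK s)
  (fun s hs => is_deriveDD (dGE s hs) (is_deriveZZ _ (dKE s hs))).
have Kx : 0 < K x by rewrite mulr_gt0 ?invr_gt0 ?mulr_gt0// S0//; lra.
have px : 0 <= pi - x by rewrite subr_ge0.
have Gx : `|G x| <= K x.
  have a1 : (dG c1 + dK c1) * (pi - x) <= 0.
    by rewrite mulr_le0_ge0// /dG -[X in _ + X]mul1r -mulrDl mulr_ge0_le0 ?dK_le0//.
  have a2 : 0 <= (dG c2 + -1 * dK c2) * (pi - x).
    by rewrite mulr_ge0// /dG -mulrDl mulr_le0 ?dK_le0//.
  by rewrite ler_norml; move: e1 e2; rewrite Gpi => e1 e2; lra.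
have -> : dsaw N x = G x - K x * cos (mid N * x) by rewrite /G addrK.
have -> : (mid N * sin (x / 2))^-1 = K x + K x.
  have Sn0 : S x != 0 by rewrite gt_eqF// S0//; lra.
  by rewrite /K -SE; field; rewrite Sn0 gt_eqF.
rewrite (le_trans (ler_normB _ _))// lerD// normrM (gtr0_norm Kx).
by rewrite ler_piMr ?(ltW Kx)// cos_max.
Qed.

Lemma saw_err_var N d x : 0 < d -> d <= x <= pi ->
  `|saw_err N x - saw_err N d| <= pi / (mid N * sin (d / 2)).
Proof.
move=> d0 /andP[dx xp]; have m0 := mid_gt0 N; have p0 := @pi_gt0 R.
have [||c] := @MVT_segment R (saw_err N) (dsaw N) d x dx.
- by move=> s _; exact: is_derive_saw_err.
- apply: derivable_within_continuous => s _.
  by have [] := is_derive_saw_err N s.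
rewrite in_itv/= => /andP[dc cx] ->.
have sd : 0 < sin (d / 2) by rewrite half_sin_gt0//; lra.
have sc : 0 < sin (c / 2) by rewrite half_sin_gt0//; lra.
have sdc : sin (d / 2) <= sin (c / 2).
  move: dc; rewrite le_eqVlt => /predU1P[->//|dc].
  by rewrite ltW// ltr_sin ?in_itv/=; lra.
rewrite normrM mulrC ler_pM//.
  by rewrite ger0_norm ?subr_ge0//; lra.
rewrite (le_trans (dsaw_bound N _))//; first by lra.
by rewrite lef_pV2 ?posrE ?mulr_gt0// ler_wpM2l// ltW.
Qed.

Lemma saw_err_sym N x : saw_err N (2 * pi - x) = saw_err N x.
Proof.
rewrite /saw_err; congr (_ - _); last by field.
apply: eq_bigr => k _; congr ((1 - _) / _).
rewrite mulrBr cosB.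
have e (n : nat) : sin (n%:R * (2 * pi)) = 0 :> R by rewrite mulrA -natrM sin_npi.
have c (n : nat) : cos (n%:R * (2 * pi)) = 1 :> R.
  elim: n => [|n IH]; first by rewrite mul0r cos0.
  rewrite -[RHS]IH -[RHS]cosD2pi; congr cos; rewrite -natr1; ring.
by rewrite e c mul0r addr0 mul1r.
Qed.

(** The error varies little on [d, x] when [N] is large. At a small [d] it is at
    least [- pi d / 2], because the partial sums of the series are nonnegative; the
    upper bound by 0, a hypothesis here, comes from the Bessel inequality. The value
    of the sum at some particular point is thus never needed. *)
Lemma saw_err_small x eps : 0 < x < 2 * pi -> 0 < eps ->
  (forall N s, 0 <= s <= 2 * pi -> saw_err N s <= 0) ->
  exists N, `|saw_err N x| < eps.
Proof.
move=> hx e0 neg; have p0 := @pi_gt0 R.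
wlog xp : x hx / x <= pi.
  move=> H; have [xp|xp] := leP x pi; first exact: H.
  have [||N hN] := H (2 * pi - x); first by lra. by lra.
  by exists N; rewrite -saw_err_sym.
pose d := Num.min x (eps / (2 * pi)).
have d0 : 0 < d by rewrite lt_min divr_gt0 ?mulr_gt0// andbT; lra.
have dx : d <= x by rewrite ge_min lexx.
have de : d <= eps / (2 * pi) by rewrite ge_min lexx orbT.
have sd : 0 < sin (d / 2) by rewrite half_sin_gt0//; lra.
(* For [N] above [M], the error varies by at most [eps / 2] between [d] and [x]. *)
pose M := pi / sin (d / 2) / (eps / 2).
have [N hN] : exists N : nat, M < N%:R by exists (Num.truncn M).+1; exact: truncnS_gt.
exists N; have m0 := mid_gt0 N.
have dxp : d <= x <= pi by rewrite dx xp.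
have h1 := saw_err_var N d0 dxp.
have h2 : pi / (mid N * sin (d / 2)) < eps / 2.
  have mM : M < mid N by rewrite /mid (lt_trans hN)// ltrDl.
  move: mM; rewrite /M ltr_pdivrMr ?divr_gt0// => mM.
  rewrite invfM mulrCA mulrC ltr_pdivrMr// [X in _ < X]mulrC.
  by rewrite mulrC [X in _ < X]mulrC.
have h3 : - (eps / 2) < saw_err N d.
  have : 0 <= saw N d.
    by apply: sumr_ge0 => k _; rewrite divr_ge0 ?sqr_ge0// subr_ge0 cos_le1.
  move: de; rewrite ler_pdivlMr ?mulr_gt0// => de s0.
  rewrite /saw_err; have := sqr_ge0 d; nra.
have x2 : 0 <= x <= 2 * pi by lra.
have h4 := neg N x x2.
move: h1; rewrite ler_norml ltr_norml => /andP[h1 h1'].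
by apply/andP; split; lra.
Qed.

End sawtooth_series.

(** * Completeness of the trigonometric system *)

Section trig_completeness.
Context {R : realType}.
Variable T : R.
Hypothesis T0 : 0 < T.
Local Notation leb := (@lebesgue_measure R).
Local Notation I := `]0, T[%classic.
Local Notation omega := (2 * pi / T).
Local Notation e := (trig T).
Local Notation spanned := (spanned leb I e).
Local Notation defect := (defect leb I e).
Local Notation ip := (ip leb I).

Let mI : measurable (I : set (measurableTypeR R)). Proof. exact: measurable_itv. Qed.
Let finI : (leb I < +oo)%E. Proof. exact: open_itv_fin. Qed.
Let Le := trig_L2 T.
Let orth := trig_orthonormal T0.

Lemma indic_L2 (E : set (measurableTypeR R)) : measurable E -> L2 leb I (\1_E : R -> R).
Proof.
move=> mE; apply: (@L2_bounded _ _ _ _ _ mI 1) => //.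
by move=> t _; rewrite indicE; case: (_ \in _); rewrite ?normr1 ?normr0.
Qed.

Lemma spanned1 : spanned (fun=> 1).
Proof.
have -> : (fun=> 1 : R) = (fun t => Num.sqrt T * e 0 t).
  apply/funext => t; rewrite /trig /= mulfV// gt_eqF// sqrtr_gt0//.
apply: spannedZ => //; move=> eps eps0; exists 1%N.
by rewrite /defect big_ord_recr big_ord0/= !orth eqxx expr1n add0r subrr.
Qed.

(** Half-lines, restricted to the period, stand for the intervals [(0, a)]: they
    form a pi-system generating the Borel sets. *)
Lemma ip_prefix (a : R) (f : R -> R) : 0 < a <= T ->
  ip (\1_(`]-oo, a[) : R -> R) f = \int[leb]_(t in `]0, a[) f t.
Proof.
move=> /andP[a0 aT]; rewrite -(Rintegral_indic leb f _ (_ : `]0, a[%classic `<=` I))//.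
  apply: eq_Rint => t /=; rewrite in_itv/= => /andP[t0 tT]; rewrite mulrC; congr (_ * _).
  rewrite !indicE; have [ta|ta] := ltP t a.
    by rewrite !mem_set//= in_itv/= ?t0 ta.
  by rewrite !memNset//= in_itv/= ?t0/= => h; lra.
by apply: subset_itvl; rewrite bnd_simp.
Qed.

(** The coefficients of the indicator of [(0, a)] at frequency [k] are proportional
    to [sin (k omega a) / k] and [(1 - cos (k omega a)) / k], and the sum of their
    squares is [2 (1 - cos (k omega a)) / k^2]. *)
Lemma defect_prefix (a : R) (N : nat) : 0 < a <= T ->
  defect (N.*2.+1) (\1_(`]-oo, a[) : R -> R) =
  - (4 / (T * omega ^+ 2) * saw_err N (omega * a)).
Proof.
move=> aT; have /andP[a0 _] := aT; have om0 := omega_gt0 T0.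
have s2 : Num.sqrt (2 / T) ^+ 2 = 2 / T by rewrite sqr_sqrtr// divr_ge0// ltW.
have sT2 : Num.sqrt T ^+ 2 = T by rewrite sqr_sqrtr// ltW.
have p0 := @pi_gt0 R.
have Tn0 : T != 0 by rewrite gt_eqF.
elim: N => [|N IH].
  rewrite /defect big_ord_recr big_ord0/= add0r !ip_prefix//.
  rewrite [X in _ - X ^+ 2](_ : _ = a / Num.sqrt T); last first.
    rewrite /trig /= Rintegral_cst//= lebesgue_measure_itv/= lte_fin a0 -EFinB/= subr0.
    by rewrite mulrC.
  rewrite [X in X - _](_ : _ = a); last first.
    rewrite (eq_Rint leb (g := fun=> 1)); last first.
      by move=> t /=; rewrite in_itv/= => /andP[_ ta]; rewrite indicE mem_set//= in_itv/=.
    by rewrite Rintegral_cst//= lebesgue_measure_itv/= lte_fin a0 -EFinB/= subr0 mul1r.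
  rewrite expr_div_n sT2 /saw_err /saw big_ord0.
  by move: (@pi R) p0 => q q0; field; rewrite Tn0 gt_eqF.
rewrite doubleS {1}/defect big_ord_recr/= big_ord_recr/= opprD addrA opprD addrA.
rewrite -[X in X - _ - _]/(defect N.*2.+1 _) IH !ip_prefix//.
set A := N.+1%:R * omega.
have A0 : A != 0 by rewrite mulf_neq0 ?pnatr_eq0// gt_eqF.
have E1 : \int[leb]_(t in `]0, a[) e N.*2.+1 t = Num.sqrt (2 / T) * (sin (A * a) / A).
  rewrite /trig /= RintegralZl//; last by apply: continuous_intg; exact: cos_wave_continuous.
  rewrite odd_double /= doubleK mul0r -/A.
  by rewrite integral_cos// subr0 sin0 addr0.
have E2 : \int[leb]_(t in `]0, a[) e N.*2.+2 t = Num.sqrt (2 / T) * ((1 - cos (A * a)) / A).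
  rewrite /trig /= RintegralZl//; last by apply: continuous_intg; exact: cos_wave_continuous.
  rewrite odd_double /= uphalf_double mul1r -/A.
  by rewrite integral_cos// sinBpihalf sin_pihalf addrC.
rewrite E1 E2 !exprMn s2 /saw_err /saw big_ord_recr /=.
have -> : N.+1%:R * (omega * a) = A * a by rewrite /A; ring.
have h : sin (A * a) ^+ 2 = 1 - cos (A * a) ^+ 2 by rewrite -(cos2Dsin2 (A * a)) addrAC subrr add0r.
rewrite !exprVn h /A; move: (cos _) (\sum_(i < N) _) => c S.
have n0 : N.+1%:R != 0 :> R by rewrite pnatr_eq0.
by move: (@pi R) p0 (N.+1%:R : R) n0 => q q0 n n0; field; rewrite Tn0 n0 gt_eqF.
Qed.

(** Defects are nonnegative, by the Bessel inequality. *)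
Lemma saw_err_le0 N (s : R) : 0 <= s <= 2 * pi -> saw_err N s <= 0.
Proof.
move=> /andP[s0 s2]; have om0 := omega_gt0 T0.
move: s0; rewrite le_eqVlt => /predU1P[<-|s0].
  rewrite /saw_err /saw big1; first by rewrite mulr0 !mul0r expr0n mul0r !subr0.
  by move=> k _; rewrite mulr0 cos0 subrr mul0r.
have aT : 0 < s / omega <= T.
  rewrite divr_gt0//= ler_pdivrMr// (_ : T * omega = 2 * pi)//.
  by rewrite mulrC divfK// gt_eqF.
have := defect_prefix N aT.
rewrite (_ : omega * (s / omega) = s); last by rewrite mulrCA mulfV ?mulr1// gt_eqF.
move=> h.
have := defect_ge0 mI Le orth N.*2.+1 (indic_L2 (measurable_itv `]-oo, (s / omega)[)).
rewrite h oppr_ge0 pmulr_rle0// divr_gt0// mulr_gt0// exprn_gt0//.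
Qed.

Lemma spanned_prefix (a : R) : spanned (\1_(`]-oo, a[) : R -> R).
Proof.
have om0 := omega_gt0 T0.
have [a0|a0] := leP a 0.
  move=> eps eps0; exists 0%N; rewrite (@eq_defect _ _ _ _ _ _ 0%N _ (fun t => 0 * 1)).
    rewrite defectZ//; last exact: L2_cst.
    by rewrite expr0n mul0r.
  move=> t /=; rewrite in_itv/= => /andP[t0 _]; rewrite mul0r indicE memNset//=.
  by rewrite in_itv/= => ta; lra.
have [Ta|aT] := leP T a.
  move=> eps eps0; have [n hn] := spanned1 eps0; exists n.
  rewrite (@eq_defect _ _ _ _ _ _ n _ (fun=> 1))// => t /=.
  by rewrite in_itv/= => /andP[_ tT]; rewrite indicE mem_set//= in_itv/=; lra.
move=> eps eps0; pose c := 4 / (T * omega ^+ 2).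
have c0 : 0 < c by rewrite divr_gt0// mulr_gt0// exprn_gt0.
have [||N hN] := @saw_err_small _ (omega * a) (eps / c) _ _ saw_err_le0.
- rewrite mulr_gt0//= -[X in _ < X](_ : omega * T = _); first by rewrite ltr_pM2l.
  by field; rewrite gt_eqF.
- by rewrite divr_gt0.
exists N.*2.+1; rewrite defect_prefix ?a0 ?ltW//.
rewrite (le_lt_trans (ler_norm _))// normrN normrM (gtr0_norm c0) mulrC.
by rewrite -ltr_pdivlMr.
Qed.

(** Monotone class argument: complements by linearity, disjoint countable unions by
    [spanned_lim]. *)
Lemma spanned_indic (E : set (measurableTypeR R)) : measurable E -> spanned (\1_E : R -> R).
Proof.
have gen : @measurable _ (measurableTypeR R) = <<s @RGenInftyO.G R >>.
  exact: RGenInftyO.measurableE.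
move=> mE; have : <<s @RGenInftyO.G R >> E by rewrite -gen.
apply: (@dynkin_induction _ _ _ (fun E => spanned (\1_E : R -> R)) gen).
- move=> _ _ [a ->] [b ->]; exists (Num.min a b).
  apply/seteqP; split=> t /=; rewrite !in_itv/= lt_min; first by move=> [-> ->].
  by move=> /andP[-> ->].
- have := spanned1; congr spanned; apply/funext => t.
  by rewrite indicT.
- by move=> _ [a ->]; exact: spanned_prefix.
- move=> S mS sS; have LS := indic_L2 mS.
  have := spannedD mI Le orth (L2_cst mI 1 finI) (L2Z mI (-1) LS) spanned1
    (spannedZ mI Le orth (-1) LS sS).
  congr spanned; apply/funext => t; rewrite !indicE in_setC.
  by case: (t \in S); rewrite /= ?mulr1 ?mulr0 ?subrr ?addr0.
- move=> F mF tF sF.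
  have mU n : measurable (\big[setU/set0]_(i < n) F i : set (measurableTypeR R)).
    by apply: bigsetU_measurable => i _; exact: mF.
  have mUU : measurable (\bigcup_k F k : set (measurableTypeR R)) by exact: bigcupT_measurable.
  have Usum n : (\1_(\big[setU/set0]_(i < n) F i) : R -> R) =
      (fun t => \sum_(i < n) \1_(F i) t).
    elim: n => [|n IH]; apply/funext => t; first by rewrite !big_ord0 indic0.
    rewrite !big_ord_recr/= -[X in _ = X + _](congr1 (fun h => h t) IH) !indicE in_setU.
    have [/set_mem tn|_] := boolP (t \in F n); last by rewrite orbF addr0.
    rewrite orbT memNset ?add0r// -bigcup_mkord => -[i /= i_n ti].
    have ein : i = n by apply: tF => //; exists t.
    by move: i_n; rewrite ein ltnn.
  apply: (@spanned_lim _ _ _ _ _ mI _ Le orth (fun n => \1_(\big[setU/set0]_(i < n) F i))).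
  + by move=> n; exact: indic_L2.
  + exact: indic_L2.
  + elim=> [|n IH].
      rewrite big_ord0 => eps eps0; exists 0%N.
      rewrite (@eq_defect _ _ _ _ _ _ 0%N _ (fun t => 0 * 1)).
        by rewrite defectZ ?expr0n ?mul0r//; exact: L2_cst.
      by move=> t _; rewrite indic0 mul0r.
    have := spannedD mI Le orth (indic_L2 (mU n)) (indic_L2 (mF n)) IH (sF n).
    congr spanned; rewrite !Usum; apply/funext => t.
    by rewrite big_ord_recr.
  + have [|||||_] := @Rdominated _ _ _ leb I mI
      (fun n t => (\1_(\bigcup_k F k) t - \1_(\big[setU/set0]_(i < n) F i) t) ^+ 2)
      (fun=> 0) (fun=> 1).
    * by move=> n; apply: measurable_funX; apply: measurable_funB; exact: measurable_indic.
    * exact: measurable_cst.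
    * exact: L2_integrable (L2_cst mI 1 finI).
    * apply: aeW => t _; have [[k _ Fkt]|nF] := pselect ((\bigcup_k F k) t).
        apply: cvg_near_cst; exists k.+1 => // n kn /=.
        have h1 : (\bigcup_k F k) t by exists k.
        have h2 : (\big[setU/set0]_(i < n) F i) t by rewrite -bigcup_mkord; exists k.
        by rewrite !indicE (mem_set h1) (mem_set h2) subrr expr0n.
      rewrite (_ : (fun n => _) = cst 0); first exact: cvg_cst.
      apply/funext => n; rewrite !indicE !memNset ?subrr ?expr0n//.
      by rewrite -bigcup_mkord => -[k _ Fkt]; apply: nF; exists k.
    * apply: aeW => t _ n; rewrite !indicE.
      by case: (_ \in _); case: (_ \in _); rewrite /= ?subrr ?subr0 ?sub0r ?sqrrN ?expr0n ?expr1n ?normr0 ?normr1.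
    by rewrite Rintegral0.
Qed.

Import HBNNSimple.

(** Increasing approximation by simple functions, in the mean square by dominated
    convergence. *)
Lemma spanned_ge0 (u : R -> R) : L2 leb I u -> (forall t, I t -> 0 <= u t) -> spanned u.
Proof.
move=> Lu u0; have mu := L2_meas Lu.
have mu' : measurable_fun I (EFin \o u) by exact/measurable_EFinP.
have u0' t : I t -> (0 <= (EFin \o u) t)%E by move=> It; rewrite lee_fin u0.
pose g := nnsfun_approx mI mu'.
have gu n t : I t -> 0 <= g n t <= u t.
  move=> It; rewrite fun_ge0 /= -lee_fin nnsfun_approxE; exact: le_approx.
have mg n : measurable_fun I (g n : measurableTypeR R -> R).
  have h : measurable_fun [set: measurableTypeR R] (g n) by [].
  exact: measurable_funTS h.
have Lg n : L2 leb I (g n).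
  apply: (L2_le mI (mg n) _ Lu) => t It; have /andP[h1 h2] := gu n t It.
  by rewrite !ger0_norm// (le_trans h1).
apply: (@spanned_lim _ _ _ _ _ mI _ Le orth (fun n => g n : R -> R)) => //.
- move=> n; have [m [s gE]] : exists m (s : seq R), forall t,
      g n t = \sum_(i < m) s`_i * \1_(g n @^-1` [set s`_i]) t.
    by eexists; eexists => t; exact: fimfunEord.
  have -> : (g n : R -> R) = (fun t => \sum_(i < m) (s`_i * \1_(g n @^-1` [set s`_i]) t)).
    by apply/funext.
  have mp i : measurable (g n @^-1` [set s`_i] : set (measurableTypeR R)).
    exact: measurable_funPTI.
  apply: (spanned_sum mI Le orth (F := fun i t => s`_i * \1_(g n @^-1` [set s`_i]) t)).
    by move=> i; apply: L2Z => //; exact: indic_L2.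
  by move=> i; apply: spannedZ => //; [exact: indic_L2|exact: spanned_indic].
have [|||||_] := @Rdominated _ _ _ leb I mI (fun n t => (u t - g n t) ^+ 2)
   (fun=> 0) (fun t => u t ^+ 2).
- by move=> n; apply: measurable_funX; apply: (measurable_funB mu (mg n)).
- exact: measurable_cst.
- exact: L2_sqr.
- apply: aeW => t It.
  have h : g n t @[n --> \oo] --> u t.
    apply: (@fine_cvg _ _ _ _ (fun n => (g n t)%:E)).
    exact: (cvg_nnsfun_approx mI mu' u0' It).
  rewrite (_ : 0 = (u t - u t) ^+ 2); last by rewrite subrr expr0n.
  have hB : u t - g n t @[n --> \oo] --> u t - u t.
    by apply: cvgB; [exact: cvg_cst|exact: h].
  exact: (cvgM hB hB).
- apply: aeW => t It n; have /andP[h1 h2] := gu n t It.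
  by rewrite ger0_norm ?sqr_ge0// lerXn2r ?nnegrE; lra.
by rewrite Rintegral0.
Qed.

Lemma spanned_L2 (u : R -> R) : L2 leb I u -> spanned u.
Proof.
move=> Lu; have mu := L2_meas Lu.
have Lp : L2 leb I u^\+.
  apply: (L2_le mI _ _ Lu); first exact: measurable_funrpos.
  by move=> t _; rewrite /funrpos; case: (leP (u t) 0) => h; rewrite ?normr0.
have Ln : L2 leb I u^\-.
  apply: (L2_le mI _ _ Lu); first exact: measurable_funrneg.
  by move=> t _; rewrite /funrneg; case: (leP (- u t) 0) => h; rewrite ?normr0 ?normrN.
have := spannedD mI Le orth Lp (L2Z mI (-1) Ln) (spanned_ge0 Lp (fun t _ => funrpos_ge0 u t))
  (spannedZ mI Le orth (-1) Ln (spanned_ge0 Ln (fun t _ => funrneg_ge0 u t))).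
congr spanned; apply/funext => t; rewrite mulN1r -[in RHS](funrposBneg u).
by [].
Qed.

End trig_completeness.

(** * Fourier coefficients on a period *)

Section fourier_coefficients.
Context {R : realType}.
Variable T : R.
Hypothesis T0 : 0 < T.
Local Notation leb := (@lebesgue_measure R).
Local Notation I := `]0, T[%classic.
Local Notation omega := (2 * pi / T).
Local Notation e := (trig T).
Local Notation ip := (ip leb I).

Let mI : measurable (I : set (measurableTypeR R)). Proof. exact: measurable_itv. Qed.
Let finI : (leb I < +oo)%E. Proof. exact: open_itv_fin. Qed.

Definition fcos (u : R -> R) (k : nat) : R :=
  2 / T * \int[leb]_(t in I) (u t * cos (k%:R * omega * t)).
Definition fsin (u : R -> R) (k : nat) : R :=
  2 / T * \int[leb]_(t in I) (u t * sin (k%:R * omega * t)).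

Lemma cos_L2 k : L2 leb I (fun t => cos (k%:R * omega * t)).
Proof.
have -> : (fun t => cos (k%:R * omega * t)) =
  (fun t => cos (k%:R * omega * t - 0)) by apply/funext => t; rewrite subr0.
by apply: continuous_L2; exact: cos_wave_continuous.
Qed.

Lemma sin_L2 k : L2 leb I (fun t => sin (k%:R * omega * t)).
Proof.
have -> : (fun t => sin (k%:R * omega * t)) =
  (fun t => cos (k%:R * omega * t - pi / 2)) by apply/funext => t; rewrite cosBpihalf.
by apply: continuous_L2; exact: cos_wave_continuous.
Qed.

Lemma sqrt_half_period : Num.sqrt (T / 2) = Num.sqrt (2 / T) * (T / 2).
Proof.
have Tn0 : T != 0 by rewrite gt_eqF.
have T2 : 0 <= T / 2 by rewrite divr_ge0// ltW.
have {2}<- : Num.sqrt ((T / 2) ^+ 2) = T / 2 by rewrite sqrtr_sqr ger0_norm.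
rewrite -sqrtrM; last by rewrite divr_ge0// ltW.
by congr Num.sqrt; field.
Qed.

Lemma ip_trig_odd u k : L2 leb I u -> ip u (e k.*2.+1) = Num.sqrt (T / 2) * fcos u k.+1.
Proof.
move=> Lu; rewrite sqrt_half_period.
rewrite /fcos -mulrA [_ * (2 / T * _)]mulrA (_ : T / 2 * (2 / T) = 1); last by field; rewrite gt_eqF.
rewrite mul1r -RintegralZl//; last by apply: L2_mul => //; exact: cos_L2.
apply: eq_Rint => t _; rewrite /trig /= odd_double /= doubleK mul0r subr0; ring.
Qed.

Lemma ip_trig_even u k : L2 leb I u -> ip u (e k.*2.+2) = Num.sqrt (T / 2) * fsin u k.+1.
Proof.
move=> Lu; rewrite sqrt_half_period.
rewrite /fsin -mulrA [_ * (2 / T * _)]mulrA (_ : T / 2 * (2 / T) = 1); last by field; rewrite gt_eqF.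
rewrite mul1r -RintegralZl//; last by apply: L2_mul => //; exact: sin_L2.
apply: eq_Rint => t _; rewrite /trig /= odd_double /= uphalf_double mul1r cosBpihalf; ring.
Qed.

Lemma ip_trig0 u : L2 leb I u -> ip u (e 0) = (Num.sqrt T)^-1 * \int[leb]_(t in I) u t.
Proof.
move=> Lu; rewrite -RintegralZl//; last exact: L2_integrable.
by apply: eq_Rint => t _; rewrite /trig /= mulrC.
Qed.

Lemma fourier_partial_sum n u v : L2 leb I u -> L2 leb I v ->
  \sum_(i < n.*2.+1) ip u (e i) * ip v (e i) =
  T^-1 * (\int[leb]_(t in I) u t * \int[leb]_(t in I) v t) +
  \sum_(k < n) T / 2 * (fcos u k.+1 * fcos v k.+1 + fsin u k.+1 * fsin v k.+1).
Proof.
move=> Lu Lv; have s2 : Num.sqrt (T / 2) ^+ 2 = T / 2 by rewrite sqr_sqrtr// divr_ge0// ltW.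
have sT2 : Num.sqrt T ^+ 2 = T by rewrite sqr_sqrtr// ltW.
elim: n => [|n IH].
  rewrite big_ord_recr !big_ord0/= add0r addr0 !ip_trig0//.
  by rewrite mulrACA -expr2 exprVn sT2.
rewrite doubleS [LHS]big_ord_recr/= [X in X + _ = _]big_ord_recr/= IH.
rewrite [in RHS]big_ord_recr/= [RHS]addrA -[LHS]addrA; congr +%R.
rewrite (ip_trig_odd n Lu) (ip_trig_odd n Lv) (ip_trig_even n Lu) (ip_trig_even n Lv).
by rewrite mulrDr; congr +%R; rewrite [LHS]mulrACA -expr2 s2.
Qed.

Lemma fourier_bessel n u : L2 leb I u ->
  \sum_(k < n) T / 2 * (fcos u k.+1 ^+ 2 + fsin u k.+1 ^+ 2) <=
  \int[leb]_(t in I) (u t ^+ 2).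
Proof.
move=> Lu; have := bessel mI (trig_L2 T) (trig_orthonormal T0) n.*2.+1 Lu.
under eq_bigr do rewrite expr2; rewrite fourier_partial_sum//.
have -> : ip u u = \int[leb]_(t in I) (u t ^+ 2) by apply: eq_Rint => t _; rewrite expr2.
move=> h; apply: le_trans h; rewrite -[leLHS]add0r lerD//.
  by rewrite mulr_ge0 ?invr_ge0 ?(ltW T0)// -expr2 sqr_ge0.
Qed.

Lemma fourier_parseval u v : L2 leb I u -> L2 leb I v ->
  T^-1 * (\int[leb]_(t in I) u t * \int[leb]_(t in I) v t) +
  \sum_(k < n) T / 2 * (fcos u k.+1 * fcos v k.+1 + fsin u k.+1 * fsin v k.+1)
  @[n --> \oo] --> \int[leb]_(t in I) (u t * v t).
Proof.
move=> Lu Lv; have := parseval mI (trig_L2 T) (trig_orthonormal T0) Lu Lv (spanned_L2 T0 Lu).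
move=> /cvgrPdist_lt h; apply/cvgrPdist_lt => eps eps0.
have [N _ hN] := h _ eps0; exists N => // n Nn /=.
rewrite -fourier_partial_sum//; apply: hN => /=.
by rewrite (leq_trans Nn)// -addnn ltnW// ltnS leq_addr.
Qed.

(** The bound does not depend on [n]: it dominates the partial sums when the
    Parseval formula is integrated over the space variable. *)
Lemma fourier_partial_bound n u v : L2 leb I u -> L2 leb I v ->
  \sum_(k < n) `|T / 2 * (fcos u k.+1 * fcos v k.+1 + fsin u k.+1 * fsin v k.+1)| <=
  \int[leb]_(t in I) (u t ^+ 2) + \int[leb]_(t in I) (v t ^+ 2).
Proof.
move=> Lu Lv; apply: le_trans (lerD (fourier_bessel n Lu) (fourier_bessel n Lv)).
rewrite -big_split; apply: ler_sum => k _ /=.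
have T2 : 0 <= T / 2 by rewrite divr_ge0// ltW.
rewrite normrM (ger0_norm T2) -mulrDr ler_wpM2l//.
move: (fcos u _) (fsin u _) (fcos v _) (fsin v _) => a b c d.
have h1 := sqr_ge0 (a - c); have h2 := sqr_ge0 (a + c).
have h3 := sqr_ge0 (b - d); have h4 := sqr_ge0 (b + d).
have h5 := sqr_ge0 a; have h6 := sqr_ge0 b; have h7 := sqr_ge0 c; have h8 := sqr_ge0 d.
rewrite ler_norml; apply/andP; split; rewrite -subr_ge0.
  rewrite (_ : _ - _ = 2^-1 * ((a + c) ^+ 2 + (b + d) ^+ 2 + a ^+ 2 + b ^+ 2 + c ^+ 2 + d ^+ 2)); last by field.
  by rewrite mulr_ge0// !addr_ge0.
rewrite (_ : _ - _ = 2^-1 * ((a - c) ^+ 2 + (b - d) ^+ 2 + a ^+ 2 + b ^+ 2 + c ^+ 2 + d ^+ 2)); last by field.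
by rewrite mulr_ge0// !addr_ge0.
Qed.

End fourier_coefficients.

(** * Almost-everywhere comparison and square integrability of fibres *)

Section ae_monotone.
Context {dT : measure_display} {X : measurableType dT} {R : realType}.
Variables (mu : {measure set X -> \bar R}) (D : set X).
Hypothesis mD : measurable D.

Lemma ae_le_Rintegral (f g : X -> R) :
  mu.-integrable D (EFin \o f) -> mu.-integrable D (EFin \o g) ->
  (\forall x \ae mu, D x -> f x <= g x) ->
  \int[mu]_(x in D) f x <= \int[mu]_(x in D) g x.
Proof.
move=> hf hg fg; have mf := intg_meas hf; have mg := intg_meas hg.
have mm : measurable_fun D (fun x => Num.min (f x) (g x)) by exact: measurable_minr.
have e : \forall x \ae mu, D x -> f x = Num.min (f x) (g x).
  by move: fg; apply: filterS => x h Dx; rewrite min_l// h.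
rewrite (ae_eq_Rintegral mD mf mm e); apply: le_Rintegral => //.
  exact: intg_ae_eq e hf.
by move=> x _; rewrite ge_min lexx orbT.
Qed.

Lemma ae_eq0_Rintegral (f : X -> R) : mu.-integrable D (EFin \o f) ->
  (forall x, D x -> 0 <= f x) -> \int[mu]_(x in D) f x <= 0 ->
  \forall x \ae mu, D x -> f x = 0.
Proof.
move=> hf f0 If; have mf := intg_meas hf.
have mf' : measurable_fun D (EFin \o f) by exact/measurable_EFinP.
have : (\int[mu]_(x in D) `|(EFin \o f) x| = 0)%E.
  rewrite (_ : (\int[mu]_(x in D) _ = \int[mu]_(x in D) (f x)%:E)%E); last first.
    by apply: eq_integral => x /set_mem Dx; rewrite /= ger0_norm ?f0.
  rewrite -[LHS]fineK; last exact: integrable_fin_num.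
  congr EFin; apply/eqP; rewrite eq_le If /=; apply: Rintegral_ge0 => x Dx; exact: f0.
by move=> /(ae_eq_integral_abs _ mD mf'); apply: filterS => x h Dx; have [] := h Dx.
Qed.

End ae_monotone.

Section rectangle_L2.
Context {d1 d2 : measure_display} {T1 : measurableType d1} {T2 : measurableType d2}
  {R : realType}.
Variables (m1 : {sigma_finite_measure set T1 -> \bar R})
  (m2 : {sigma_finite_measure set T2 -> \bar R}) (A : set T1) (B : set T2).
Hypotheses (mA : measurable A) (mB : measurable B).
Local Notation m12 := (m1 \x m2)%E.
Local Notation AB := (A `*` B).

Lemma rect_fin : (m1 A < +oo)%E -> (m2 B < +oo)%E -> (m12 AB < +oo)%E.
Proof. by move=> Aoo Boo; rewrite product_measure1E// lte_mul_pinfty// ge0_fin_numE. Qed.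

Lemma L2_sect1 (f : T1 * T2 -> R) : L2 m12 AB f ->
  \forall x \ae m1, A x -> L2 m2 B (fun t => f (x, t)).
Proof.
have mAB : measurable AB by exact: measurableX.
move=> /(L2P _ mAB)[mf f2]; have := ae_intg1 mA mB f2.
apply: filterS => x h Ax; apply/(L2P _ mB); split; first exact: sect1_meas mf Ax.
exact: h.
Qed.

Lemma L2_sect2 (f : T1 * T2 -> R) : L2 m12 AB f ->
  \forall t \ae m2, B t -> L2 m1 A (fun x => f (x, t)).
Proof.
have mAB : measurable AB by exact: measurableX.
move=> /(L2P _ mAB)[mf f2]; have := ae_intg2 mA mB f2.
apply: filterS => x h Ax; apply/(L2P _ mA); split; first exact: sect2_meas mf Ax.
exact: h.
Qed.

Lemma measurable_rect_fst (f : T1 -> R) : measurable_fun A f ->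
  measurable_fun AB (fun u => f u.1).
Proof.
move=> mf; apply: (@measurable_comp _ _ _ _ _ _ A f AB fst) => //.
  by move=> _ [u [? ?] <-].
by apply: measurable_funTS; exact: measurable_fst.
Qed.

Lemma measurable_rect_snd (f : T2 -> R) : measurable_fun B f ->
  measurable_fun AB (fun u => f u.2).
Proof.
move=> mf; apply: (@measurable_comp _ _ _ _ _ _ B f AB snd) => //.
  by move=> _ [u [? ?] <-].
by apply: measurable_funTS; exact: measurable_snd.
Qed.

Lemma L2_rect_fst (f : T1 -> R) : (m2 B < +oo)%E -> L2 m1 A f ->
  L2 m12 AB (fun u => f u.1).
Proof.
move=> Boo /(L2P _ mA)[mf f2].
have mAB : measurable AB by exact: measurableX.
apply/(L2P _ mAB); split; first exact: measurable_rect_fst.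
have mf2 : measurable_fun AB (fun u => (f u.1 ^+ 2)%:E).
  by apply/measurable_EFinP; apply: measurable_funX; exact: measurable_rect_fst.
apply/integrableP; split => //.
under eq_integral do rewrite /= ger0_norm ?sqr_ge0//.
have [_ ->] := tonelli_rect1 m1 m2 mA mB mf2 (fun u _ => sqr_ge0 _).
rewrite (eq_integral (fun x => (f x ^+ 2)%:E * m2 B)%E); last first.
  by move=> x _; exact: (integral_cst m2 mB (f x ^+ 2)%:E).
have b0 : m2 B \is a fin_num by rewrite ge0_fin_numE.
rewrite -[m2 B]fineK// integralZr//.
by rewrite lte_mul_pinfty ?integral_ge0//; [move=> *; rewrite lee_fin sqr_ge0
  |exact: integrable_fin_num|rewrite ltry].
Qed.

End rectangle_L2.

(** * Fourier coefficients of the time derivative *)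

Section time_derivative.
Context {R : realType} {d : nat}.
Variables (Omega : set 'rV[R]_d) (T : R).
Hypotheses (oO : open Omega) (finO : (lebesgue_rV d Omega < +oo)%E) (T0 : 0 < T).
Local Notation vol := (@lebesgue_rV R d).
Local Notation leb := (@lebesgue_measure R).
Local Notation I := `]0, T[%classic.
Local Notation st := (spacetime R d).

Let mO : measurable Omega. Proof. exact: open_measurable_rV. Qed.
Let mI : measurable (I : set (measurableTypeR R)). Proof. exact: measurable_itv. Qed.
Let finI : (leb I < +oo)%E. Proof. exact: open_itv_fin. Qed.
Let mQ : measurable (QT Omega T). Proof. exact: measurableX. Qed.
Let finQ : (@stvol R d (QT Omega T) < +oo)%E. Proof. exact: rect_fin. Qed.

Lemma L2_norm1_le (f : 'rV[R]_d -> R) : L2 vol Omega f ->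
  \int[vol]_(x in Omega) `|f x| <=
  Num.sqrt (\int[vol]_(x in Omega) (f x ^+ 2)) * Num.sqrt (fine (vol Omega)).
Proof.
move=> Lf; have Lnf : L2 vol Omega (fun x => `|f x|).
  apply: (L2_le mO _ _ Lf) => [|x _]; last by rewrite normr_id.
  by apply: measurableT_comp => //; case: Lf.
have := cauchy_schwarz mO Lnf (L2_cst mO 1 finO).
have -> : \int[vol]_(x in Omega) (`|f x| * 1) = \int[vol]_(x in Omega) `|f x|.
  by apply: eq_Rint => x _; rewrite mulr1.
have -> : \int[vol]_(x in Omega) (`|f x| ^+ 2) = \int[vol]_(x in Omega) (f x ^+ 2).
  by apply: eq_Rint => x _; rewrite real_normK ?num_real.
rewrite [X in _ * Num.sqrt X](_ : _ = fine (vol Omega)); last first.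
  by rewrite expr1n Rintegral_cst// mul1r.
exact: le_trans (ler_norm _).
Qed.

(** Near the time [s], almost every slice of [v] is close in [L^2(Omega)], hence in
    [L^1(Omega)], to the slice at [s] of its continuous representative. *)
Lemma boundary_layer (v : st -> R) (V : st -> R) (c : R -> R) (s : R) :
  measurable_fun (QT Omega T) v ->
  time_continuous_rep Omega T v V -> continuous c -> s \in `[0, T] ->
  forall eps, 0 < eps -> exists2 delta, 0 < delta &
    \forall t \ae leb, I t -> `|t - s| < delta ->
      \int[vol]_(x in Omega) `|c t * v (x, t) - c s * V (x, s)| <= eps.
Proof.
move=> mv [Vv LV contV] cc sT eps eps0.
have LVs := LV s sT.
set m := fine (vol Omega).
set N1 := \int[vol]_(x in Omega) `|V (x, s)|.
have N10 : 0 <= N1 by apply: Rintegral_ge0.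
have iVs : vol.-integrable Omega (EFin \o (fun x => V (x, s))) by exact: L2_integrable.
set M := `|c s| + 1.
have M0 : 0 < M by rewrite ltr_wpDl.
set e1 := eps / (2 * M * (Num.sqrt m + 1)).
set e2 := Num.min 1 (eps / (2 * (N1 + 1))).
have sm0 : 0 < Num.sqrt m + 1 by rewrite ltr_wpDl ?sqrtr_ge0.
have N11 : 0 < N1 + 1 by rewrite ltr_wpDl.
have e10 : 0 < e1 by rewrite divr_gt0// !mulr_gt0.
have e20 : 0 < e2 by rewrite lt_min ltr01 divr_gt0// mulr_gt0.
have : within `[0, T]%classic (nbhs (s : R^o))
    (fun t => L2norm vol Omega (fun x => V (x, t) - V (x, s))%R < e1%:E)%E.
  apply: (contV s sT [set y | (y < e1%:E)%E]).
  have : \forall y \near (0 : R), y < e1 by exact: lt_nbhsl.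
  by apply: filterS => y /=; rewrite lte_fin.
move=> /nbhs_ballP[d1 /= d10 hd1].
have : \forall t \near (s : R^o), `|c s - c t| < e2.
  by have /cvgrPdist_lt := cc s; apply.
move=> /nbhs_ballP[d2 /= d20 hd2].
exists (Num.min d1 d2); first by rewrite lt_min d10.
move: Vv; apply: (@filterS _ _ (ae_filter_ringOfSetsType leb)) => t hVv It; rewrite lt_min => /andP[ht1 ht2].
have tT : t \in `[0, T] by move: It; rewrite /= !in_itv/= => /andP[/ltW -> /ltW ->].
have LVt := LV t tT.
have h1 : (L2norm vol Omega (fun x => V (x, t) - V (x, s))%R < e1%:E)%E.
  by apply: (hd1 t); [rewrite /ball/= distrC|exact: tT].
have h2 : `|c s - c t| < e2 by apply: hd2; rewrite /ball/= distrC.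
have LB := L2B mO LVt LVs.
have mvt : measurable_fun Omega (fun x => v (x, t)) := sect2_meas mO mI mv It.
have mfe : measurable_fun Omega (fun x => `|c t * v (x, t) - c s * V (x, s)|).
  apply: measurableT_comp => //; apply: measurable_funB.
    by apply: measurable_funM => //; exact: measurable_cst.
  by case: (L2Z mO (c s) LVs).
have mfe' : measurable_fun Omega (fun x => `|c t * V (x, t) - c s * V (x, s)|).
  apply: measurableT_comp => //.
  by case: (L2B mO (L2Z mO (c t) LVt) (L2Z mO (c s) LVs)).
rewrite (ae_eq_Rintegral mO mfe mfe'); last first.
  by have := hVv It; apply: filterS => x hx Ox; rewrite hx.
have iB : vol.-integrable Omega (EFin \o (fun x => `|V (x, t) - V (x, s)|)).
  by apply: integrable_norm; exact: L2_integrable.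
have iN : vol.-integrable Omega (EFin \o (fun x => `|V (x, s)|)) by exact: integrable_norm.
apply: (@le_trans _ _ (\int[vol]_(x in Omega)
    (`|c t| * `|V (x, t) - V (x, s)| + `|c s - c t| * `|V (x, s)|))).
  apply: le_Rintegral => //.
  - apply: integrable_norm; apply: L2_integrable => //.
    exact: (L2B mO (L2Z mO (c t) LVt) (L2Z mO (c s) LVs)).
  - by apply: intgD => //; exact: intgZ.
  move=> x _; rewrite -!normrM.
  have -> : c t * V (x, t) - c s * V (x, s) =
     c t * (V (x, t) - V (x, s)) - (c s - c t) * V (x, s) by ring.
  exact: ler_normB.
rewrite RintegralD//; try exact: intgZ.
rewrite !RintegralZl// -/N1.
have ctM : `|c t| <= M.
  have := ler_normB (c s) (c s - c t); rewrite opprB addrC subrK => /le_trans; apply.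
  by rewrite lerD2l ltW// (lt_le_trans h2)// ge_min lexx.
have hB : \int[vol]_(x in Omega) `|V (x, t) - V (x, s)| <= e1 * Num.sqrt m.
  apply: le_trans (L2_norm1_le LB) _; rewrite ler_wpM2r ?sqrtr_ge0//.
  by move: h1; rewrite L2normEfin// lte_fin => /ltW.
have b1 : `|c t| * \int[vol]_(x in Omega) `|V (x, t) - V (x, s)| <= eps / 2.
  apply: (@le_trans _ _ (M * (e1 * Num.sqrt m))).
    by apply: ler_pM => //; apply: Rintegral_ge0.
  apply: (@le_trans _ _ (M * (e1 * (Num.sqrt m + 1)))).
    by rewrite !ler_wpM2l ?(ltW M0) ?(ltW e10)// lerDl.
  rewrite le_eqVlt; apply/orP; left; apply/eqP; rewrite /e1; field.
  by rewrite !gt_eqF.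
have b2 : `|c s - c t| * N1 <= eps / 2.
  apply: (@le_trans _ _ (eps / (2 * (N1 + 1)) * (N1 + 1))).
    apply: ler_pM => //; last by rewrite lerDl.
    by rewrite ltW// (lt_le_trans h2)// ge_min lexx orbT.
  rewrite le_eqVlt; apply/orP; left; apply/eqP; field.
  by rewrite gt_eqF.
by rewrite [leRHS]splitr lerD.
Qed.

End time_derivative.

Section time_ibp.
Context {R : realType} {d : nat}.
Variables (Omega : set 'rV[R]_d) (T : R).
Hypotheses (oO : open Omega) (finO : (lebesgue_rV d Omega < +oo)%E) (T0 : 0 < T).
Local Notation vol := (@lebesgue_rV R d).
Local Notation leb := (@lebesgue_measure R).
Local Notation I := `]0, T[%classic.
Local Notation st := (spacetime R d).

Let mO : measurable Omega. Proof. exact: open_measurable_rV. Qed.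
Let mI : measurable (I : set (measurableTypeR R)). Proof. exact: measurable_itv. Qed.
Let finI : (leb I < +oo)%E. Proof. exact: open_itv_fin. Qed.
Let mQ : measurable (QT Omega T). Proof. exact: measurableX. Qed.
Let finQ : (@stvol R d (QT Omega T) < +oo)%E. Proof. exact: rect_fin. Qed.

Lemma bounded_on_period (f : R -> R) : continuous f ->
  exists2 M, 0 <= M & forall t, I t -> `|f t| <= M.
Proof.
move=> cf; have cn : {within `[0, T], continuous (fun t => `|f t|)}.
  apply: continuous_subspaceT => t; apply: continuous_comp; first exact: cf.
  exact: norm_continuous.
have [c _ hc] := EVT_max (ltW T0) cn; exists `|f c| => // t It.
by apply: hc; move: It; rewrite /= !in_itv/= => /andP[/ltW -> /ltW ->].
Qed.

Lemma measurable_time (f : R -> R) : continuous f ->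
  measurable_fun (QT Omega T) (fun u => f u.2).
Proof.
move=> cf; apply: measurable_rect_snd => //.
by apply: measurable_funTS; exact: continuous_measurable_fun.
Qed.

Lemma L2Q_time_mul (f : R -> R) (v : st -> R) : continuous f -> L2Q Omega T v ->
  L2Q Omega T (fun u => f u.2 * v u).
Proof.
move=> cf Lv; have [M _ hM] := bounded_on_period cf.
apply: (L2_bounded_mul mQ (c := M)) => //; first exact: measurable_time.
by move=> u [_ /hM].
Qed.

Lemma L2_time_mul (f u : R -> R) : continuous f -> L2 leb I u ->
  L2 leb I (fun t => f t * u t).
Proof.
move=> cf Lv; have [M _ hM] := bounded_on_period cf.
apply: (L2_bounded_mul mI (c := M)) => //.
by apply: measurable_funTS; exact: continuous_measurable_fun.
Qed.

Lemma measurable_time_integral (w : st -> R) : stvol.-integrable (QT Omega T) (EFin \o w) ->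
  measurable_fun Omega (fun x => \int[leb]_(t in I) w (x, t)).
Proof. by move=> /(Rfubini_rect1 mO mI)[/intg_meas]. Qed.

Section layer_estimate.
Variables (v V : st -> R) (c : R -> R) (C : R) (dchi : R -> R) (n : nat) (eps : R).
Hypotheses (Lv : L2Q Omega T v) (repV : time_continuous_rep Omega T v V)
  (V0T : \forall x \ae vol, Omega x -> V (x, 0) = V (x, T))
  (cc : continuous c) (c0T : c 0 = c T) (eps0 : 0 <= eps).
Hypotheses (cdchi : continuous dchi) (dchiC : forall t, `|dchi t| <= C * n.+1%:R)
  (dchi0 : forall t, 2 / n.+1%:R < t < T - 2 / n.+1%:R -> dchi t = 0)
  (Idchi : \int[leb]_(t in I) dchi t = 0).
Let r : R := 2 / n.+1%:R.
Hypotheses (rT : r < T)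
  (layer0 : \forall t \ae leb, I t -> t <= r ->
      \int[vol]_(x in Omega) `|c t * v (x, t) - c 0 * V (x, 0)| <= eps)
  (layerT : \forall t \ae leb, I t -> T - r <= t ->
      \int[vol]_(x in Omega) `|c t * v (x, t) - c T * V (x, T)| <= eps).

(** The derivative of the cut-off has integral zero, so the common end value of [c
    v] may be subtracted under the integral. The rest is at most [eps] in
    [L^1(Omega)] on two layers of width [2 / (n + 1)], where the derivative is at
    most [C (n + 1)]. The truncation at 1 allows dominated convergence in [n]. *)
Lemma layer_estimate :
  \int[vol]_(x in Omega) (Num.min `|\int[leb]_(t in I) (dchi t * (c t * v (x, t)))| 1)
  <= 4 * C * eps.
Proof.
have r0 : 0 < r by rewrite divr_gt0.
have [_ LV _] := repV.
have LV0 : L2 vol Omega (fun x => V (x, 0)) by apply: LV; rewrite in_itv/= lexx ltW.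
have LVT : L2 vol Omega (fun x => V (x, T)) by apply: LV; rewrite in_itv/= lexx ltW.
have Lcv : L2Q Omega T (fun u => c u.2 * v u) by exact: L2Q_time_mul.
have LW : L2Q Omega T (fun u => c u.2 * v u - c 0 * V (u.1, 0)).
  apply: (L2B mQ Lcv); apply: (L2Z mQ).
  exact: (L2_rect_fst mO mI (f := fun x => V (x, 0)) finI LV0).
have LF := L2Q_time_mul cdchi LW.
have LG := L2Q_time_mul cdchi Lcv.
have iF := integrable_norm (L2_integrable mQ finQ LF).
have iG := L2_integrable mQ finQ LG.
have [ik1 k1] := Rfubini_rect1 mO mI iF; have [ik2 k2] := Rfubini_rect2 mO mI iF.
have mh := measurable_time_integral iG.
have imin : vol.-integrable Omega (EFin \o (fun x =>
    Num.min `|\int[leb]_(t in I) (dchi t * (c t * v (x, t)))| 1)).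
  apply: (intg_le mO _ _ (L2_integrable mO finO (L2_cst mO 1 finO))).
    apply: measurable_minr; last exact: measurable_cst.
    by apply: measurableT_comp => //; exact: mh.
  move=> x _; set a := \int[leb]_(t in I) _.
  rewrite [X in X <= _]ger0_norm; first by rewrite ge_min lexx orbT.
  by rewrite le_min normr_ge0 ler01.
apply: (@le_trans _ _ (\int[vol]_(x in Omega) \int[leb]_(t in I)
    `|dchi t * (c t * v (x, t) - c 0 * V (x, 0))|)).
  apply: ae_le_Rintegral => //.
  have := L2_sect1 mO mI Lv; apply: filterS => x hx Ox; have Lvx := hx Ox.
  rewrite ge_min; apply/orP; left.
  have Lx : L2 leb I (fun t => dchi t * (c t * v (x, t))).
    by apply: L2_time_mul => //; exact: L2_time_mul.
  have Ld : L2 leb I (fun t => dchi t * (c 0 * V (x, 0))).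
    by apply: L2_time_mul => //; exact: L2_cst.
  have -> : \int[leb]_(t in I) (dchi t * (c t * v (x, t))) =
            \int[leb]_(t in I) (dchi t * (c t * v (x, t) - c 0 * V (x, 0))).
    have -> : (fun t => dchi t * (c t * v (x, t) - c 0 * V (x, 0))) =
      (fun t => dchi t * (c t * v (x, t)) - dchi t * (c 0 * V (x, 0))).
      by apply/funext => t; rewrite mulrBr.
    rewrite RintegralB//; try exact: L2_integrable.
    rewrite RintegralZr//; last exact: continuous_intg.
    by rewrite Idchi mul0r subr0.
  apply: le_normr_Rintegral => //; apply: L2_integrable => //.
  have := L2B mI Lx Ld; congr L2; apply/funext => t; by rewrite mulrBr.
rewrite -k1 k2 /=.
pose E1 : set (measurableTypeR R) := `]0, r]%classic.
pose E2 : set (measurableTypeR R) := `[T - r, T[%classic.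
have mE1 : measurable E1 by exact: measurable_itv.
have mE2 : measurable E2 by exact: measurable_itv.
have E1I : E1 `<=` I by move=> t; rewrite /E1/= !in_itv/= => /andP[-> /le_lt_trans]; apply.
have E2I : E2 `<=` I.
  by move=> t; rewrite /E2/= !in_itv/= => /andP[h ->]; rewrite andbT (lt_le_trans _ h)// subr_gt0.
pose K := C * n.+1%:R * eps.
have C0 : 0 <= C * n.+1%:R by apply: le_trans (dchiC 0).
have K0 : 0 <= K by rewrite mulr_ge0.
have ind (E : set (measurableTypeR R)) : measurable E -> E `<=` I ->
    leb.-integrable I (EFin \o (fun t => K * \1_E t)).
  move=> mE _; apply: (intg_le mI _ _ (L2_integrable mI finI (L2_cst mI K finI))).
    by apply: measurable_funM => //; exact: measurable_indic.
  move=> t _; rewrite normrM (ger0_norm K0) indicE.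
  by case: (t \in E); rewrite /= ?normr1 ?normr0 ?mulr1 ?mulr0.
apply: (@le_trans _ _ (\int[leb]_(t in I) (K * \1_E1 t + K * \1_E2 t))).
  apply: ae_le_Rintegral => //.
    by apply: intgD => //; exact: ind.
  have := L2_sect2 mO mI Lv; have := layerT; have := layer0.
  apply: (@filterS3 _ _ (ae_filter_ringOfSetsType leb)) => t h0 hT hv It.
  have Lvt := hv It.
  have i1 : 0 <= K * \1_E1 t by rewrite mulr_ge0// indicE.
  have i2 : 0 <= K * \1_E2 t by rewrite mulr_ge0// indicE.
  have Lx : L2 vol Omega (fun x => c t * v (x, t) - c 0 * V (x, 0)).
    by apply: L2B => //; exact: L2Z.
  have -> : \int[vol]_(x in Omega) `|dchi t * (c t * v (x, t) - c 0 * V (x, 0))| =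
     `|dchi t| * \int[vol]_(x in Omega) `|c t * v (x, t) - c 0 * V (x, 0)|.
    rewrite -RintegralZl//; last by apply: integrable_norm; exact: L2_integrable.
    by apply: eq_Rint => x _; rewrite normrM.
  have [mid|] := boolP (r < t < T - r).
    by rewrite dchi0// normr0 mul0r addr_ge0.
  have W0 : 0 <= \int[vol]_(x in Omega) `|c t * v (x, t) - c 0 * V (x, 0)|.
    by apply: Rintegral_ge0.
  have {}It := It; move: (It); rewrite /= in_itv/= => /andP[t0 tT].
  rewrite negb_and -!leNgt => /orP[tr|tr].
    have -> : \1_E1 t = 1 :> R by rewrite indicE mem_set//; rewrite /E1/= in_itv/= t0.
    rewrite mulr1 -[leLHS]addr0 lerD//; apply: ler_pM => //; exact: h0.
  have -> : \1_E2 t = 1 :> R by rewrite indicE mem_set//; rewrite /E2/= in_itv/= tr.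
  rewrite mulr1 -[leLHS]add0r lerD//; apply: ler_pM => //.
  apply: le_trans (hT It tr); rewrite le_eqVlt; apply/orP; left; apply/eqP.
  have LxT : L2 vol Omega (fun x => c t * v (x, t) - c T * V (x, T)).
    by apply: L2B => //; exact: L2Z.
  apply: ae_eq_Rintegral => //.
  - by apply: measurableT_comp => //; case: Lx.
  - by apply: measurableT_comp => //; case: LxT.
  by move: V0T; apply: filterS => x hx Ox; rewrite hx// c0T.
rewrite RintegralD//; try exact: ind.
have IE (E : set (measurableTypeR R)) : measurable E -> E `<=` I ->
    \int[leb]_(t in I) (K * \1_E t) = K * fine (leb E).
  move=> mE EI; rewrite (Rintegral_indic leb (fun=> K) mE EI).
  by rewrite Rintegral_cst.
rewrite !IE// !lebesgue_measure_itv/= !lte_fin r0 -!EFinB/= subr0.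
rewrite ifT; last by lra.
rewrite /= le_eqVlt; apply/orP; left; apply/eqP.
rewrite (_ : T - (T - r) = r); last by ring.
have : n.+1%:R != 0 :> R by [].
by rewrite /K /r; move: (n.+1%:R : R) => N N0; field.
Qed.

End layer_estimate.

(** Testing with [chi_n c], where [chi_n] is a cut-off, leaves the term [\int chi_n'
    c v] besides the expected ones. It converges pointwise, and its limit is zero by
    [layer_estimate], as [c v] has equal end values. *)
Lemma ibp_time (v g : st -> R) (c dc : R^o -> R^o) :
  is_dt Omega T v g -> time_periodic Omega T v -> smooth_alg c -> continuous dc ->
  (forall t, is_derive t (1 : R^o) c (dc t)) -> c 0 = c T ->
  \forall x \ae vol, Omega x ->
    \int[leb]_(t in I) (v (x, t) * dc t) = - \int[leb]_(t in I) (g (x, t) * c t).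
Proof.
move=> [Lv Lg vg] [V repV V0T] sc cdc dcE c0T.
have cc : continuous c by exact: smooth_alg_continuous.
have [C [chi [dchi hchi]]] := time_cutoff T0.
have C0 : 0 <= C.
  by have [_ _ _ _ [/(_ 0) h _ _ _]] := hchi 0%N; rewrite mulr1 in h; exact: le_trans h.
have cdchi n : continuous (dchi n) by have [] := hchi n.
have chiE n t : is_derive t (1 : R^o) (chi n) (dchi n t) by have [] := hchi n.
have cchi n : continuous (chi n).
  move=> t; have [/derivable1_diffP h _] := chiE n t.
  exact: differentiable_continuous h.
have chi01 n t : 0 <= chi n t <= 1 by have [] := hchi n.
pose P n x := \int[leb]_(t in I) (dchi n t * (c t * v (x, t))).
pose H x := \int[leb]_(t in I) (c t * g (x, t)) + \int[leb]_(t in I) (dc t * v (x, t)).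
have iQ (w : st -> R) : L2Q Omega T w -> stvol.-integrable (QT Omega T) (EFin \o w).
  by move=> Lw; exact: L2_integrable.
have Lcv : L2Q Omega T (fun u => c u.2 * v u) by exact: L2Q_time_mul.
have Lcg : L2Q Omega T (fun u => c u.2 * g u) by exact: L2Q_time_mul.
have Ldcv : L2Q Omega T (fun u => dc u.2 * v u) by exact: L2Q_time_mul.
have mP n : measurable_fun Omega (P n).
  exact: (measurable_time_integral (iQ _ (L2Q_time_mul (cdchi n) Lcv))).
have mH : measurable_fun Omega H.
  exact: measurable_funD (measurable_time_integral (iQ _ Lcg))
    (measurable_time_integral (iQ _ Ldcv)).
have Pcvg : \forall x \ae vol, Omega x -> P n x @[n --> \oo] --> - H x.
  have hder n : \forall x \ae vol, Omega x ->
      \int[leb]_(t in I) (v (x, t) * derive1 (fun t => chi n t * c t : R^o) t) =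
      - \int[leb]_(t in I) (g (x, t) * (chi n t * c t)).
    by apply: vg; have [h _ _ _ _] := hchi n; exact: h.
  have := L2_sect1 mO mI Lg; have := L2_sect1 mO mI Lv.
  have /ae_foralln := hder.
  apply: filterS3 => x hx hv hg Ox; have {}hv := hv Ox; have {}hg := hg Ox.
  have Lcgx := L2_time_mul cc hg; have Ldvx := L2_time_mul cdc hv.
  have PE n : P n x = - (\int[leb]_(t in I) (chi n t * (c t * g (x, t))) +
       \int[leb]_(t in I) (chi n t * (dc t * v (x, t)))).
    have := hx n Ox.
    have dE t : derive1 (fun t => chi n t * c t : R^o) t = dchi n t * c t + chi n t * dc t.
      rewrite derive1E; have := is_deriveM (chiE n t) (dcE t); move=> [_ ->].
      by rewrite addrC; congr (_ + _); exact: mulrC.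
    have -> : \int[leb]_(t in I) (v (x, t) * derive1 (fun t => chi n t * c t : R^o) t) =
       P n x + \int[leb]_(t in I) (chi n t * (dc t * v (x, t))).
      rewrite -RintegralD//; last 2 first.
      - by apply: L2_integrable => //; apply: L2_time_mul => //; exact: L2_time_mul.
      - by apply: L2_integrable => //; exact: L2_time_mul.
      by apply: eq_Rint => t _; rewrite dE; ring.
    have -> : \int[leb]_(t in I) (g (x, t) * (chi n t * c t)) =
       \int[leb]_(t in I) (chi n t * (c t * g (x, t))).
      by apply: eq_Rint => t _; ring.
    by move=> h; apply: (addIr (\int[leb]_(t in I) (chi n t * (dc t * v (x, t)))));
      rewrite h; ring.
  have lim (w : R -> R) : L2 leb I w ->
      \int[leb]_(t in I) (chi n t * w t) @[n --> \oo] --> \int[leb]_(t in I) w t.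
    move=> Lw; have iw := L2_integrable mI finI Lw.
    have [|||||_ h] := @Rdominated _ _ _ leb I mI (fun n t => chi n t * w t) w
      (fun t => `|w t|); last exact: h.
    - by move=> n; apply: L2_meas; exact: L2_time_mul.
    - exact: L2_meas Lw.
    - exact: integrable_norm.
    - apply: aeW => t /= It; apply: cvg_near_cst.
      move: It; rewrite in_itv/= => /andP[t0 tT].
      have m0 : 0 < Num.min t (T - t) / 2 by rewrite divr_gt0// lt_min t0 subr_gt0.
      have := near_infty_natSinv_lt (PosNum m0); apply: filterS => n /= hn.
      have [_ _ _ _ [_ h _ _]] := hchi n.
      have {}hn : 2 / n.+1%:R < Num.min t (T - t) by rewrite mulrC -ltr_pdivlMr.
      have [_ ->] : dchi n t = 0 /\ chi n t = 1; last by rewrite mul1r.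
      by apply: h; move: hn; rewrite lt_min => /andP[-> ?]; rewrite ltrBrDr addrC -ltrBrDr.
    apply: aeW => t /= _ n; rewrite normrM ler_piMl//.
    by have /andP[? ?] := chi01 n t; rewrite ger0_norm.
  under eq_cvg do rewrite PE.
  by apply: cvgN; apply: cvgD; exact: lim.
have iM (f : 'rV[R]_d -> R) : measurable_fun Omega f ->
    vol.-integrable Omega (EFin \o (fun x => Num.min `|f x| 1)).
  move=> mf; apply: (intg_le mO _ _ (L2_integrable mO finO (L2_cst mO 1 finO))).
    apply: measurable_minr; last exact: measurable_cst.
    exact: measurableT_comp.
  move=> x _; set a := f x.
  rewrite [X in X <= _]ger0_norm; first by rewrite ge_min lexx orbT.
  by rewrite le_min normr_ge0 ler01.
have Kcvg : \int[vol]_(x in Omega) Num.min `|P n x| 1 @[n --> \oo] -->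
            \int[vol]_(x in Omega) Num.min `|H x| 1.
  have [|||||_ h] := @Rdominated _ _ _ vol Omega mO (fun n x => Num.min `|P n x| 1)
    (fun x => Num.min `|H x| 1) (fun=> 1); last exact: h.
  - by move=> n; exact: (intg_meas (iM _ (mP n))).
  - exact: (intg_meas (iM _ mH)).
  - exact: (L2_integrable mO finO (L2_cst mO 1 finO)).
  - move: Pcvg; apply: filterS => x hx Ox.
    have {}hx : `|P n x| @[n --> \oo] --> `|H x|.
      by rewrite -[`|H x|]normrN; apply: cvg_norm; exact: hx.
    under eq_cvg do rewrite minr_absE; rewrite minr_absE.
    apply: cvgMl; apply: cvgB; first by apply: cvgD => //; exact: cvg_cst.
    by apply: cvg_norm; apply: cvgB => //; exact: cvg_cst.
  apply: aeW => x /= _ n; set a := P n x.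
  rewrite [X in X <= _]ger0_norm; first by rewrite ge_min lexx orbT.
  by rewrite le_min normr_ge0 ler01.
have K0 : \int[vol]_(x in Omega) Num.min `|H x| 1 <= 0.
  apply/ler_addgt0Pl => e e0; rewrite addr0.
  (* The estimate of the layers is [4 * C * eps]. *)
  pose eps := e / (4 * C + 1).
  have C1 : 0 < 4 * C + 1 by rewrite ltr_wpDl ?mulr_ge0.
  have eps0 : 0 < eps by rewrite divr_gt0.
  have mv : measurable_fun (QT Omega T) v by case: Lv.
  have z0 : (0 : R) \in `[0, T] by rewrite in_itv/= lexx ltW.
  have zT : T \in `[0, T] by rewrite in_itv/= lexx ltW.
  have [d0 d00 h0] := boundary_layer oO finO mv repV cc z0 eps0.
  have [dT dT0 hT] := boundary_layer oO finO mv repV cc zT eps0.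
  have m0 : 0 < Num.min T (Num.min d0 dT) / 2 by rewrite divr_gt0// !lt_min T0 d00.
  rewrite -(cvg_lim _ Kcvg)//; apply: limr_le; first by apply/cvg_ex; eexists; exact: Kcvg.
  have := near_infty_natSinv_lt (PosNum m0); apply: filterS => n /= hn.
  have {}hn : 2 / n.+1%:R < Num.min T (Num.min d0 dT) by rewrite mulrC -ltr_pdivlMr.
  move: hn; rewrite !lt_min => /andP[hnT /andP[hn0 hnd]].
  have [_ _ _ _ [dC dchi0 chi0 chiT]] := hchi n.
  apply: (@le_trans _ _ (4 * C * eps)).
    apply: (@layer_estimate v V c C (dchi n) n eps) => //; first exact: ltW.
    - by move=> t ht; have [] := dchi0 t ht.
    - by rewrite (ftc_open T0 (chiE n) (cdchi n)) chi0 chiT subrr.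
    - move: h0; apply: (@filterS _ _ (ae_filter_ringOfSetsType leb)) => t h It tr.
      apply: h => //; rewrite subr0 ger0_norm; first exact: le_lt_trans tr hn0.
      by move: It; rewrite /= in_itv/= => /andP[/ltW].
    move: hT; apply: (@filterS _ _ (ae_filter_ringOfSetsType leb)) => t h It tr.
    apply: h => //; rewrite ltr0_norm; last by move: It; rewrite /= in_itv/= subr_lt0 => /andP[].
    by rewrite opprB; apply: le_lt_trans hnd; rewrite lerBlDr addrC -lerBlDr.
  rewrite /eps mulrCA ger_pMr// ler_pdivrMr// mul1r lerDl//.
have Hmin0 x : 0 <= Num.min `|H x| 1 by rewrite le_min normr_ge0 ler01.
have := ae_eq0_Rintegral mO (iM _ mH) (fun x _ => Hmin0 x) K0.
apply: filterS => x h Ox; have := h Ox; rewrite /Num.min; case: ifP => [_ /normr0_eq0|_ /eqP].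
  rewrite /H => /(canRL (addrK _)); rewrite sub0r => e.
  have -> : \int[leb]_(t in I) (g (x, t) * c t) = \int[leb]_(t in I) (c t * g (x, t)).
    by apply: eq_Rint => t _; rewrite mulrC.
  by rewrite e opprK; apply: eq_Rint => t _; rewrite mulrC.
by rewrite oner_eq0.
Qed.

End time_ibp.

Section coefficients.
Context {R : realType} {d : nat}.
Variables (Omega : set 'rV[R]_d) (T : R).
Hypotheses (oO : open Omega) (finO : (lebesgue_rV d Omega < +oo)%E) (T0 : 0 < T).
Local Notation vol := (@lebesgue_rV R d).
Local Notation leb := (@lebesgue_measure R).
Local Notation I := `]0, T[%classic.
Local Notation st := (spacetime R d).
Local Notation omega := (2 * pi / T).

Let mO : measurable Omega. Proof. exact: open_measurable_rV. Qed.
Let mI : measurable (I : set (measurableTypeR R)). Proof. exact: measurable_itv. Qed.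
Let finI : (leb I < +oo)%E. Proof. exact: open_itv_fin. Qed.
Let mQ : measurable (QT Omega T). Proof. exact: measurableX. Qed.
Let finQ : (@stvol R d (QT Omega T) < +oo)%E. Proof. exact: rect_fin. Qed.

Lemma wave_derive (A t : R) :
  is_derive t (1 : R^o) (fun t => cos (A * t + 0) : R^o) (- A * sin (A * t)) /\
  is_derive t (1 : R^o) (fun t => sin (A * t + 0) : R^o) (A * cos (A * t)).
Proof.
have e0 (f : R -> R) : (fun t => f (A * t + 0)) = (fun t => f (A * t)).
  by apply/funext => s; rewrite addr0.
by rewrite !e0; split; [rewrite mulNr; exact: is_derive_cosZ|exact: is_derive_sinZ].
Qed.

Lemma linear_wave_continuous (A : R) :
  continuous (fun t : R => cos (A * t)) /\ continuous (fun t : R => sin (A * t)).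
Proof.
split=> t; (apply: continuous_comp; first by apply: cvgMr; exact: cvg_id).
  exact: continuous_cos.
exact: continuous_sin.
Qed.

(** Integration by parts against 1, cosines and sines, which are periodic. One null
    set serves all frequencies. *)
Lemma dt_coefficients (v g : st -> R) : is_dt Omega T v g -> time_periodic Omega T v ->
  \forall x \ae vol, Omega x ->
    \int[leb]_(t in I) g (x, t) = 0 /\
    forall k, cosc T g k x = k%:R * omega * sinc T v k x /\
              sinc T g k x = - (k%:R * omega * cosc T v k x).
Proof.
move=> vg pv; have [Lv _ _] := vg.
have c0 : continuous ((fun=> 0) : R^o -> R^o) by move=> t; exact: cvg_cst.
have h1 : \forall x \ae vol, Omega x -> \int[leb]_(t in I) g (x, t) = 0.
  have := ibp_time oO finO T0 vg pv (dc := fun=> 0) (smooth_cst (1 : R)) c0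
    (fun t => is_derive_cst (1 : R^o) t 1) erefl.
  apply: filterS => x h Ox; have := h Ox.
  under eq_Rintegral do rewrite mulr0; rewrite Rintegral0.
  under eq_Rintegral do rewrite mulr1.
  by move=> /esym/eqP; rewrite oppr_eq0 => /eqP.
have iwave u k : L2 leb I u ->
    leb.-integrable I (EFin \o (fun t => u t * cos (k%:R * omega * t))) /\
    leb.-integrable I (EFin \o (fun t => u t * sin (k%:R * omega * t))).
  by move=> Lu; split; apply: (L2_mul mI Lu); [exact: cos_L2|exact: sin_L2].
have wave_end k : cos (k%:R * omega * T) = 1 :> R /\ sin (k%:R * omega * T) = 0 :> R.
  have -> : k%:R * omega * T = k%:R * (2 * pi) by field; rewrite gt_eqF.
  split; last by have := sin_period k (0 : R); rewrite subr0 sin0 oppr0.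
  by rewrite -sinDpihalf -[pi / 2]opprK sin_period sinN opprK sin_pihalf.
have hc : \forall x \ae vol, forall k, Omega x -> cosc T g k x = k%:R * omega * sinc T v k x.
  apply/ae_foralln => k; set A := k%:R * omega.
  have e0T : cos (A * 0 + 0) = cos (A * T + 0) :> R.
    by rewrite mulr0 !addr0 cos0; have [->] := wave_end k.
  have cd : continuous (fun t => - A * sin (A * t)).
    by move=> t; apply: cvgMr; have [_] := linear_wave_continuous A; exact.
  have := ibp_time oO finO T0 vg pv (smooth_cos (affine_line A 0)) cd
    (fun t => (wave_derive A t).1) e0T.
  have := L2_sect1 mO mI Lv; apply: filterS2 => x hv h Ox; have {}hv := hv Ox.
  rewrite /cosc /sinc -/A mulrCA; congr (_ * _).
  have -> : \int[leb]_(t in I) (g (x, t) * cos (A * t)) =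
            \int[leb]_(t in I) (g (x, t) * cos (A * t + 0)).
    by apply: eq_Rint => t _; rewrite addr0.
  rewrite -RintegralZl//; last by exact: (iwave _ _ hv).2.
  apply: oppr_inj; rewrite -h// -RintegralN//; last by exact: (intgZ mI A (iwave _ _ hv).2).
  by apply: eq_Rint => t _; ring.
have hs : \forall x \ae vol, forall k, Omega x -> sinc T g k x = - (k%:R * omega * cosc T v k x).
  apply/ae_foralln => k; set A := k%:R * omega.
  have e0T : sin (A * 0 + 0) = sin (A * T + 0) :> R.
    by rewrite mulr0 !addr0 sin0; have [_ ->] := wave_end k.
  have cd : continuous (fun t => A * cos (A * t)).
    by move=> t; apply: cvgMr; have [h _] := linear_wave_continuous A; exact: h.
  have := ibp_time oO finO T0 vg pv (smooth_sin (affine_line A 0)) cd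
    (fun t => (wave_derive A t).2) e0T.
  have := L2_sect1 mO mI Lv; apply: filterS2 => x hv h Ox; have {}hv := hv Ox.
  rewrite /cosc /sinc -/A mulrCA -mulrN; congr (_ * _).
  have -> : \int[leb]_(t in I) (g (x, t) * sin (A * t)) =
            \int[leb]_(t in I) (g (x, t) * sin (A * t + 0)).
    by apply: eq_Rint => t _; rewrite addr0.
  rewrite -RintegralZl//; last by exact: (iwave _ _ hv).1.
  apply: oppr_inj; rewrite -h// opprK.
  by apply: eq_Rint => t _; ring.
move: h1 hc hs; apply: filterS3 => x g0 hc hs Ox; split; first exact: g0.
by move=> k; split; [exact: hc|exact: hs].
Qed.

End coefficients.

(** * The half-order time derivative *)

Section coefficients_L2.
Context {R : realType} {d : nat}.
Variables (Omega : set 'rV[R]_d) (T : R).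
Hypotheses (oO : open Omega) (finO : (lebesgue_rV d Omega < +oo)%E) (T0 : 0 < T).
Local Notation vol := (@lebesgue_rV R d).
Local Notation leb := (@lebesgue_measure R).
Local Notation I := `]0, T[%classic.
Local Notation st := (spacetime R d).
Local Notation omega := (2 * pi / T).
Local Notation cosc := (cosc T).
Local Notation sinc := (sinc T).
Local Notation L2Q := (L2Q Omega T).

Let mO : measurable Omega. Proof. exact: open_measurable_rV. Qed.
Let mI : measurable (I : set (measurableTypeR R)). Proof. exact: measurable_itv. Qed.
Let finI : (leb I < +oo)%E. Proof. exact: open_itv_fin. Qed.
Let mQ : measurable (QT Omega T). Proof. exact: measurableX. Qed.
Let finQ : (@stvol R d (QT Omega T) < +oo)%E. Proof. exact: rect_fin. Qed.
Let w0 : 0 < omega. Proof. exact: omega_gt0. Qed.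

Lemma intg_ae_le {dT : measure_display} {X : measurableType dT}
    (mu : {measure set X -> \bar R}) (D : set X) (f g : X -> R) : measurable D ->
  measurable_fun D f -> (\forall x \ae mu, D x -> `|f x| <= g x) ->
  mu.-integrable D (EFin \o g) -> mu.-integrable D (EFin \o f).
Proof.
move=> mD mf fg ig; have mg := intg_meas ig.
(* Clipping [f] between [- g] and [g] changes it on a null set only, and makes the
   bound hold everywhere. *)
pose h x := Num.max (- g x) (Num.min (f x) (g x)).
have mh : measurable_fun D h.
  by apply: measurable_maxr; [exact: measurableT_comp|exact: measurable_minr].
have ih : mu.-integrable D (EFin \o h).
  apply: (intg_le mD mh _ (integrable_norm ig)) => x _; rewrite /h ler_norml.
  by rewrite le_max lerN2 ler_norm /= ge_max ge_min ler_norm orbT andbT -normrN ler_norm.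
apply: (intg_ae_eq mD mf _ ih); move: fg; apply: filterS => x h1 Dx.
by have := h1 Dx; rewrite ler_norml => /andP[? ?]; rewrite /h min_l// max_r.
Qed.

Lemma measurable_coef (w : st -> R) k : L2Q w ->
  measurable_fun Omega (cosc w k) /\ measurable_fun Omega (sinc w k).
Proof.
move=> Lw; have [cc cs] := linear_wave_continuous (k%:R * omega : R).
have lw (f : R -> R) : continuous f ->
    measurable_fun Omega (fun x => 2 / T * \int[leb]_(t in I) (w (x, t) * f t)).
  move=> cf; apply: measurable_funM; first exact: measurable_cst.
  under eq_fun do under eq_Rintegral do rewrite mulrC.
  apply: (measurable_time_integral oO (w := fun u => f u.2 * w u)) => //.
  exact: (L2_integrable mQ finQ (L2Q_time_mul oO T0 cf Lw)).
by split; exact: lw.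
Qed.

Lemma coef_bessel (w : st -> R) : L2Q w ->
  vol.-integrable Omega (EFin \o (fun x => \int[leb]_(t in I) (w (x, t) ^+ 2))) /\
  \forall x \ae vol, Omega x -> forall n,
    \sum_(k < n) T / 2 * (cosc w k.+1 x ^+ 2 + sinc w k.+1 x ^+ 2) <=
    \int[leb]_(t in I) (w (x, t) ^+ 2).
Proof.
move=> Lw; split.
  by have [] := Rfubini_rect1 mO mI (L2_sqr mQ Lw).
have := L2_sect1 mO mI Lw; apply: filterS => x h Ox n.
exact: (fourier_bessel T0 n (h Ox)).
Qed.

(** In almost every fibre, the squared coefficients are bounded by the integral over
    the period of [w^2], by the Bessel inequality. *)
Lemma coef_L2 (w : st -> R) k : L2Q w -> (0 < k)%N ->
  L2 vol Omega (cosc w k) /\ L2 vol Omega (sinc w k).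
Proof.
case: k => // k Lw _; have [ib bes] := coef_bessel Lw.
have [mc ms] := measurable_coef k.+1 Lw.
have b : \forall x \ae vol, Omega x -> cosc w k.+1 x ^+ 2 + sinc w k.+1 x ^+ 2 <=
   2 / T * \int[leb]_(t in I) (w (x, t) ^+ 2).
  move: bes; apply: filterS => x h Ox; have := h Ox k.+1; rewrite big_ord_recr/=.
  move=> hk; have T2 : 0 < T / 2 by rewrite divr_gt0.
  rewrite -(ler_pM2l T2) [leRHS]mulrA (_ : T / 2 * (2 / T) = 1); last by field; rewrite gt_eqF.
  rewrite mul1r; apply: le_trans hk; rewrite lerDr; apply: sumr_ge0 => i _.
  by rewrite mulr_ge0 ?addr_ge0 ?sqr_ge0// divr_ge0// ltW.
by split; apply/(L2P _ mO); split=> //;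
  (apply: (intg_ae_le mO _ _ (intgZ mO (2 / T) ib)); first exact: measurable_funX);
  move: b; apply: filterS => x h Ox; rewrite ger0_norm ?sqr_ge0//;
  apply: le_trans (h Ox); rewrite ?lerDl ?lerDr sqr_ge0.
Qed.

Definition energy (w : st -> R) (k : nat) : R :=
  \int[vol]_(x in Omega) (cosc w k x ^+ 2 + sinc w k x ^+ 2).

Lemma energy_ge0 w k : 0 <= energy w k.
Proof. by apply: Rintegral_ge0 => x _; rewrite addr_ge0 ?sqr_ge0. Qed.

Lemma energy_intg (w : st -> R) k : L2Q w -> (0 < k)%N ->
  vol.-integrable Omega (EFin \o (fun x => cosc w k x ^+ 2 + sinc w k x ^+ 2)).
Proof.
by move=> Lw k0; have [Lc Ls] := coef_L2 Lw k0; apply: intgD => //; exact: L2_sqr.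
Qed.

Lemma half_norm2E (w : st -> R) : L2Q w -> half_norm2 Omega T w =
  ((T / 2)%:E * \sum_(1 <= k <oo) (k%:R * omega * energy w k)%:E)%E.
Proof.
move=> Lw; congr (_ * _)%E; apply: congr_lim; apply/funext => n.
apply: eq_big_nat => k /andP[k0 _]; have [Lc Ls] := coef_L2 Lw k0.
rewrite !L2norm_sqr// [RHS]EFinM; congr mule; rewrite /energy RintegralD//; try exact: L2_sqr.
rewrite EFinD /Rintegral !fineK//; apply: integrable_fin_num => //; exact: L2_sqr.
Qed.

Lemma half_norm2_finP (w : st -> R) : L2Q w -> (half_norm2 Omega T w < +oo)%E <->
  exists M, forall n, \sum_(0 <= k < n) k%:R * omega * energy w k <= M.
Proof.
move=> Lw; rewrite half_norm2E//.
pose F k := k%:R * omega * energy w k.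
have F0 k : 0 <= F k.
  by apply: mulr_ge0; [apply: mulr_ge0; [exact: ler0n|exact: ltW]|exact: energy_ge0].
have FE n : \sum_(0 <= k < n) F k = \sum_(1 <= k < n) F k.
  case: n => [|n]; first by rewrite !big_geq.
  by rewrite big_ltn// {1}/F !mul0r add0r.
have T2 : (0 < (T / 2)%:E :> \bar R)%E by rewrite lte_fin divr_gt0.
split=> [h|[M hM]].
  have S0 : (0 <= \sum_(1 <= k <oo) (F k)%:E)%E by apply: nneseries_ge0 => k _ _; rewrite lee_fin.
  have Sfin : (\sum_(1 <= k <oo) (F k)%:E \is a fin_num)%E.
    rewrite ge0_fin_numE// ltNge leye_eq; apply/negP => /eqP e.
    by move: h; rewrite -/F e gt0_muley// ltxx.
  exists (fine (\sum_(1 <= k <oo) (F k)%:E)%E) => n; rewrite -/F FE -lee_fin fineK//.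
  rewrite -sumEFin; apply: (nneseries_lim_ge n) => k _ _; by rewrite lee_fin.
apply: lte_mul_pinfty => //; first exact: ltW.
apply: (@le_lt_trans _ _ M%:E); last exact: ltry.
apply: lime_le; first by apply: is_cvg_nneseries => k _ _; rewrite lee_fin F0.
by apply: nearW => n; rewrite sumEFin lee_fin -/F -FE; exact: hM.
Qed.

End coefficients_L2.

Section half_order.
Context {R : realType} {d : nat}.
Variables (Omega : set 'rV[R]_d) (T : R).
Hypotheses (oO : open Omega) (finO : (lebesgue_rV d Omega < +oo)%E) (T0 : 0 < T).
Local Notation vol := (@lebesgue_rV R d).
Local Notation leb := (@lebesgue_measure R).
Local Notation I := `]0, T[%classic.
Local Notation st := (spacetime R d).
Local Notation omega := (2 * pi / T).
Local Notation cosc := (cosc T).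
Local Notation sinc := (sinc T).
Local Notation L2Q := (L2Q Omega T).
Local Notation energy := (energy Omega T).
Local Notation half_fin w := (half_norm2 Omega T w < +oo)%E.

Let mO : measurable Omega. Proof. exact: open_measurable_rV. Qed.
Let mI : measurable (I : set (measurableTypeR R)). Proof. exact: measurable_itv. Qed.
Let finI : (leb I < +oo)%E. Proof. exact: open_itv_fin. Qed.
Let mQ : measurable (QT Omega T). Proof. exact: measurableX. Qed.
Let finQ : (@stvol R d (QT Omega T) < +oo)%E. Proof. exact: rect_fin. Qed.
Let w0 : 0 < omega. Proof. exact: omega_gt0. Qed.

Lemma coefB (y1 y2 : st -> R) : L2Q y1 -> L2Q y2 ->
  \forall x \ae vol, Omega x -> forall k,
    cosc (y1 \- y2) k x = cosc y1 k x - cosc y2 k x /\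
    sinc (y1 \- y2) k x = sinc y1 k x - sinc y2 k x.
Proof.
move=> L1 L2; have := L2_sect1 mO mI L2; have := L2_sect1 mO mI L1.
apply: filterS2 => x h1 h2 Ox k; have {}h1 := h1 Ox; have {}h2 := h2 Ox.
rewrite /cosc /sinc -!mulrBr -!RintegralB//; last 4 first.
- exact: (L2_mul mI h1 (sin_L2 T k)).
- exact: (L2_mul mI h2 (sin_L2 T k)).
- exact: (L2_mul mI h1 (cos_L2 T k)).
- exact: (L2_mul mI h2 (cos_L2 T k)).
by split; congr (_ * _); apply: eq_Rint => t _; rewrite /= mulrBl.
Qed.

Lemma half_norm2B_fin (y1 y2 : st -> R) : L2Q y1 -> L2Q y2 ->
  half_fin y1 -> half_fin y2 -> half_fin (y1 \- y2)%R.
Proof.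
move=> L1 L2 /(half_norm2_finP oO finO T0 L1)[M1 h1] /(half_norm2_finP oO finO T0 L2)[M2 h2].
have L12 : L2Q (y1 \- y2) by exact: L2B.
apply/(half_norm2_finP oO finO T0 L12); exists (2 * (M1 + M2)) => n.
apply: (@le_trans _ _ (2 * (\sum_(0 <= k < n) k%:R * omega * energy y1 k +
    \sum_(0 <= k < n) k%:R * omega * energy y2 k))); last exact: (ler_wpM2l (ler0n _ 2) (lerD (h1 n) (h2 n))).
rewrite -big_split mulr_sumr; apply: ler_sum => k _ /=.
have [->|k0] := posnP k.
  by move: (energy _ 0) (energy y1 0) (energy y2 0) => E E1 E2; rewrite !mul0r addr0 mulr0.
rewrite -mulrDr [leRHS]mulrCA; apply: ler_wpM2l; first by rewrite mulr_ge0// ltW.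
have i1 := energy_intg oO finO T0 L1 k0; have i2 := energy_intg oO finO T0 L2 k0.
rewrite /energy -RintegralD// -RintegralZl//; last exact: intgD.
apply: ae_le_Rintegral => //.
- exact: energy_intg.
- by apply: intgZ => //; exact: intgD.
have := coefB L1 L2; apply: filterS => x h Ox; have [-> ->] := h Ox k.
set a := cosc y1 k x; set b := cosc y2 k x; set a' := sinc y1 k x; set b' := sinc y2 k x.
rewrite -subr_ge0 (_ : _ - _ = (a + b) ^+ 2 + (a' + b') ^+ 2); last by ring.
by rewrite addr_ge0 ?sqr_ge0.
Qed.

(** With [g = d_t v], the coefficients satisfy [k omega |v_k|^2 = |g_k|^2 / (k
    omega) <= |g_k|^2 / omega], and the latter are summable by the Bessel
    inequality. *)
Lemma dt_half_norm2_fin (v g : st -> R) : is_dt Omega T v g ->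
  time_periodic Omega T v -> half_fin v.
Proof.
move=> vg pv; have [Lv Lg _] := vg.
apply/(half_norm2_finP oO finO T0 Lv).
have [ib bes] := coef_bessel oO T0 Lg.
pose J := \int[vol]_(x in Omega) \int[leb]_(t in I) (g (x, t) ^+ 2).
have J0 : 0 <= J by apply: Rintegral_ge0 => x _; apply: Rintegral_ge0 => t _; rewrite sqr_ge0.
have T2 : 0 < T / 2 by rewrite divr_gt0.
exists (omega^-1 * (2 / T) * J) => -[|n].
  by rewrite big_geq// mulr_ge0// mulr_ge0 ?invr_ge0 ?(ltW w0)// divr_ge0// ltW.
rewrite big_ltn// !mul0r add0r big_add1/= big_mkord.
have egv (i : 'I_n) : energy g i.+1 = (i.+1%:R * omega) ^+ 2 * energy v i.+1.
  rewrite /energy -RintegralZl//; last exact: energy_intg.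
  have [mcg msg] := measurable_coef oO finO T0 i.+1 Lg.
  have [mcv msv] := measurable_coef oO finO T0 i.+1 Lv.
  apply: ae_eq_Rintegral => //.
  - by apply: measurable_funD; exact: measurable_funX.
  - apply: measurable_funM; first exact: measurable_cst.
    by apply: measurable_funD; exact: measurable_funX.
  have := dt_coefficients oO finO T0 vg pv; apply: filterS => x h Ox.
  have [_ /(_ i.+1)[-> ->]] := h Ox.
  move: (i.+1%:R * omega) (sinc v _ x) (cosc v _ x) => W p q; ring.
have gJ : \sum_(i < n) T / 2 * energy g i.+1 <= J.
  have ig (i : 'I_n) : vol.-integrable Omega (EFin \o (fun x =>
      T / 2 * (cosc g i.+1 x ^+ 2 + sinc g i.+1 x ^+ 2))).
    by apply: intgZ => //; exact: energy_intg.
  have [isum sumE] := Rintegral_sum mO (index_enum 'I_n) ig.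
  have -> : \sum_(i < n) T / 2 * energy g i.+1 =
     \sum_(i < n) \int[vol]_(x in Omega) (T / 2 * (cosc g i.+1 x ^+ 2 + sinc g i.+1 x ^+ 2)).
    by apply: eq_bigr => i _; rewrite /energy RintegralZl//; exact: energy_intg.
  rewrite -sumE; apply: ae_le_Rintegral => //.
  by move: bes; apply: filterS => x h Ox; exact: h.
apply: (@le_trans _ _ (\sum_(i < n) omega^-1 * (2 / T) * (T / 2 * energy g i.+1))); last first.
  rewrite -mulr_sumr; apply: ler_wpM2l => //.
  by rewrite mulr_ge0 ?invr_ge0 ?(ltW w0)// divr_ge0// ltW.
apply: ler_sum => i _; rewrite egv; have := energy_ge0 Omega T v i.+1.
have i1 : (1 : R) <= i.+1%:R by rewrite ler1n.
move: (energy v _) (i.+1%:R : R) i1 => E N N1 E0.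
rewrite (_ : omega^-1 * (2 / T) * (T / 2 * ((N * omega) ^+ 2 * E)) = N * (N * omega * E)).
  by rewrite ler_peMl// mulr_ge0// mulr_ge0 ?(ltW w0)// (le_trans _ N1).
by move: omega w0 => w w0'; field; rewrite !gt_eqF.
Qed.

End half_order.

Section half_order_form.
Context {R : realType} {d : nat}.
Variables (Omega : set 'rV[R]_d) (T : R).
Hypotheses (oO : open Omega) (finO : (lebesgue_rV d Omega < +oo)%E) (T0 : 0 < T).
Local Notation vol := (@lebesgue_rV R d).
Local Notation leb := (@lebesgue_measure R).
Local Notation I := `]0, T[%classic.
Local Notation st := (spacetime R d).
Local Notation omega := (2 * pi / T).
Local Notation cosc := (cosc T).
Local Notation sinc := (sinc T).
Local Notation L2Q := (L2Q Omega T).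
Local Notation energy := (energy Omega T).
Local Notation half_fin w := (is_true (Order.lt (half_norm2 Omega T w) (+oo)%E)).
Variables (sigma : 'rV[R]_d -> R) (s_hi : R).
Hypotheses (msigma : measurable_fun Omega sigma)
  (sigma_hi : forall x, Omega x -> `|sigma x| <= s_hi).

Let mO : measurable Omega. Proof. exact: open_measurable_rV. Qed.
Let mI : measurable (I : set (measurableTypeR R)). Proof. exact: measurable_itv. Qed.
Let finI : (leb I < +oo)%E. Proof. exact: open_itv_fin. Qed.
Let mQ : measurable (QT Omega T). Proof. exact: measurableX. Qed.
Let finQ : (@stvol R d (QT Omega T) < +oo)%E. Proof. exact: rect_fin. Qed.
Let w0 : 0 < omega. Proof. exact: omega_gt0. Qed.

Definition mode_form (y v : st -> R) (k : nat) : R :=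
  \int[vol]_(x in Omega)
    (sigma x * cosc y k x * - sinc v k x + sigma x * sinc y k x * cosc v k x).

Definition half_terms (y v : st -> R) (k : nat) : R := k%:R * omega * mode_form y v k.

Lemma half_terms0 y v : half_terms y v 0 = 0.
Proof. by rewrite /half_terms !mul0r. Qed.

Lemma half_formE y v : half_form Omega T sigma y v = T / 2 * limn (series (half_terms y v)).
Proof.
suff -> : series (half_terms y v) = (fun n => \sum_(1 <= k < n) half_terms y v k) by [].
apply/funext => -[|n]; first by rewrite /series/= !big_geq.
by rewrite /series/= [LHS]big_ltn// half_terms0 add0r.
Qed.

Lemma mode_form_intg y v k : L2Q y -> L2Q v -> (0 < k)%N ->
  vol.-integrable Omega (EFin \o (fun x =>
    sigma x * cosc y k x * - sinc v k x + sigma x * sinc y k x * cosc v k x)).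
Proof.
move=> Ly Lv k0; have [cy sy] := coef_L2 oO finO T0 Ly k0.
have [cv sv] := coef_L2 oO finO T0 Lv k0.
by apply: intgD => //; apply: L2_mul => //; (try exact: L2N);
  exact: (L2_bounded_mul mO msigma sigma_hi).
Qed.

Lemma mode_form_le y v k : L2Q y -> L2Q v -> (0 < k)%N ->
  `|mode_form y v k| <= s_hi * (energy y k + energy v k).
Proof.
move=> Ly Lv k0; have im := mode_form_intg Ly Lv k0.
have iy := energy_intg oO finO T0 Ly k0; have iv := energy_intg oO finO T0 Lv k0.
apply: (le_trans (le_normr_Rintegral mO im)).
rewrite /energy -RintegralD// -RintegralZl//; last exact: intgD.
apply: le_Rintegral => //.
- exact: integrable_norm.
- by apply: intgZ => //; exact: intgD.
move=> x Ox; have s0 := sigma_hi Ox.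
move: (cosc y k x) (sinc y k x) (cosc v k x) (sinc v k x) => a b c e.
rewrite (_ : _ + _ = sigma x * (a * - e + b * c)); last by ring.
rewrite normrM; apply: ler_pM => //.
have h1 := sqr_ge0 (a - e); have h2 := sqr_ge0 (a + e).
have h3 := sqr_ge0 (b - c); have h4 := sqr_ge0 (b + c).
have h5 := sqr_ge0 a; have h6 := sqr_ge0 b; have h7 := sqr_ge0 c; have h8 := sqr_ge0 e.
rewrite ler_norml; apply/andP; split; rewrite -subr_ge0.
  rewrite (_ : _ - _ = 2^-1 * ((a - e) ^+ 2 + (b + c) ^+ 2 + a ^+ 2 + b ^+ 2 + c ^+ 2 + e ^+ 2)); last by field.
  by rewrite mulr_ge0// !addr_ge0.
rewrite (_ : _ - _ = 2^-1 * ((a + e) ^+ 2 + (b - c) ^+ 2 + a ^+ 2 + b ^+ 2 + c ^+ 2 + e ^+ 2)); last by field.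
by rewrite mulr_ge0// !addr_ge0.
Qed.

(** Absolute convergence: the k-th term is at most the k-th terms of the two half-
    order norms, up to the bound of [sigma]. *)
Lemma half_terms_cvg y v : L2Q y -> L2Q v -> half_fin y -> half_fin v ->
  cvgn (series (half_terms y v)).
Proof.
move=> Ly Lv /(half_norm2_finP oO finO T0 Ly)[My hy] /(half_norm2_finP oO finO T0 Lv)[Mv hv].
have s0 : 0 <= `|s_hi| by [].
apply: normed_cvg; pose u k := `|s_hi| * (k%:R * omega * energy y k + k%:R * omega * energy v k).
have u0 k : 0 <= u k.
  rewrite /u; apply: mulr_ge0 => //; apply: addr_ge0; apply: mulr_ge0; rewrite ?energy_ge0//.
    by rewrite mulr_ge0// ltW.
  by rewrite mulr_ge0// ltW.
apply: (@series_le_cvg _ _ u) => // [k|k|]; first exact: normr_ge0.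
  rewrite /=; have [->|k0] := posnP k; first by rewrite half_terms0 normr0.
  have kw : 0 <= k%:R * omega by rewrite mulr_ge0// ltW.
  have -> : u k = k%:R * omega * (`|s_hi| * (energy y k + energy v k)).
    by rewrite /u -mulrDr [LHS]mulrCA.
  rewrite /half_terms normrM (ger0_norm kw); apply: ler_wpM2l => //.
  apply: le_trans (mode_form_le Ly Lv k0) _; apply: ler_wpM2r; last exact: ler_norm.
  by rewrite addr_ge0// energy_ge0.
apply: nondecreasing_is_cvgn; first by apply: nondecreasing_series.
exists (`|s_hi| * (My + Mv)) => _ [n _ <-]; rewrite /series/= /u -mulr_sumr big_split/=.
exact: (ler_wpM2l s0 (lerD (hy n) (hv n))).
Qed.

(** The form is defined by a limit, which is additive only because both series
    converge. *)
Lemma half_formB y1 y2 v : L2Q y1 -> L2Q y2 -> L2Q v ->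
  half_fin y1 -> half_fin y2 -> half_fin v ->
  half_form Omega T sigma (y1 \- y2) v =
  half_form Omega T sigma y1 v - half_form Omega T sigma y2 v.
Proof.
move=> L1 L2 Lv f1 f2 fv; rewrite !half_formE -mulrBr -limB; try exact: half_terms_cvg.
suff -> : series (half_terms (y1 \- y2) v) =
    series (half_terms y1 v) - series (half_terms y2 v) by [].
apply/funext => n; rewrite /series/= fctE -sumrB.
apply: eq_bigr => k _; have [->|k0] := posnP k; first by rewrite !half_terms0 subrr.
rewrite /half_terms -mulrBr; congr (_ * _).
rewrite /mode_form -RintegralB//; try exact: mode_form_intg.
have L12 : L2Q (y1 \- y2) by exact: L2B.
apply: ae_eq_Rintegral => //.
- exact: (intg_meas (mode_form_intg L12 Lv k0)).
- by apply: measurable_funB; exact: (intg_meas (mode_form_intg _ Lv k0)).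
have := coefB oO L1 L2; apply: filterS => x h Ox; have [-> ->] := h Ox k; ring.
Qed.

(** By [dt_coefficients] the partial sums are integrals over [Omega] of [sigma]
    times partial Parseval sums for [g] and [q]; the missing constant mode vanishes
    as [g] has mean zero. Dominated convergence over [Omega] applies by
    [fourier_partial_bound]. *)
Lemma half_form_dt v g q : is_dt Omega T v g -> time_periodic Omega T v -> L2Q q ->
  half_form Omega T sigma v q = \int[stvol]_(u in QT Omega T) (sigma u.1 * g u * q u).
Proof.
move=> vg pv Lq; have [Lv Lg _] := vg.
pose p k x := T / 2 * (cosc g k x * cosc q k x + sinc g k x * sinc q k x).
pose J x := \int[leb]_(t in I) (g (x, t) * q (x, t)).
have igq := L2_mul mQ Lg Lq.
have mcg k := measurable_coef oO finO T0 k Lg.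
have mcq k := measurable_coef oO finO T0 k Lq.
have mp k : measurable_fun Omega (p k).
  have [? ?] := mcg k; have [? ?] := mcq k.
  apply: measurable_funM; first exact: measurable_cst.
  by apply: measurable_funD; exact: measurable_funM.
have [iG bG] := coef_bessel oO T0 Lg; have [iq bq] := coef_bessel oO T0 Lq.
have termE k : (0 < k)%N -> T / 2 * half_terms v q k = \int[vol]_(x in Omega) (sigma x * p k x).
  move=> k0; rewrite /half_terms /mode_form mulrA.
  have im := mode_form_intg Lv Lq k0; rewrite -RintegralZl//.
  apply: ae_eq_Rintegral => //.
  - by apply: measurable_funM; [exact: measurable_cst|exact: intg_meas im].
  - exact: measurable_funM.
  have := dt_coefficients oO finO T0 vg pv; apply: filterS => x h Ox.
  rewrite /p.
  have -> : cosc g k x = k%:R * omega * sinc v k x by have [_ /(_ k)[]] := h Ox.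
  have -> : sinc g k x = - (k%:R * omega * cosc v k x) by have [_ /(_ k)[]] := h Ox.
  by move: (k%:R * omega) => W; ring.
have hlim : \int[vol]_(x in Omega) (sigma x * \sum_(k < n) p k.+1 x) @[n --> \oo] -->
            \int[vol]_(x in Omega) (sigma x * J x).
  pose b x := s_hi * (\int[leb]_(t in I) (g (x, t) ^+ 2) + \int[leb]_(t in I) (q (x, t) ^+ 2)).
  have mJ : measurable_fun Omega J by exact: (measurable_time_integral oO igq).
  have [|||||_ h] := @Rdominated _ _ _ vol Omega mO
    (fun n x => sigma x * \sum_(k < n) p k.+1 x) (fun x => sigma x * J x) b; last exact: h.
  - by move=> n; apply: measurable_funM => //; apply: measurable_sum => k; exact: mp.
  - exact: measurable_funM.
  - by apply: intgZ => //; exact: intgD.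
  - have := dt_coefficients oO finO T0 vg pv.
    have := L2_sect1 mO mI Lq; have := L2_sect1 mO mI Lg.
    apply: filterS3 => x hg hq h Ox; have [g0 _] := h Ox.
    apply: cvgMr; have := fourier_parseval T0 (hg Ox) (hq Ox).
    by rewrite g0 mul0r mulr0; under eq_cvg do rewrite add0r.
  have := L2_sect1 mO mI Lq; have := L2_sect1 mO mI Lg.
  apply: filterS2 => x hg hq Ox n; rewrite normrM; apply: ler_pM => //; first exact: sigma_hi.
  apply: le_trans (ler_norm_sum _ _ _) _.
  exact: (fourier_partial_bound T0 n (hg Ox) (hq Ox)).
have isp k : vol.-integrable Omega (EFin \o (fun x => sigma x * p k.+1 x)).
  apply: (intg_le mO (measurable_funM msigma (mp k.+1)) _ (g := fun x => `|s_hi * p k.+1 x|)).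
    by move=> x Ox; rewrite !normrM ler_wpM2r// (le_trans (sigma_hi Ox))// ler_norm.
  apply: integrable_norm; apply: intgZ => //; apply: intgZ => //.
  have [cg sg] := coef_L2 oO finO T0 Lg (ltn0Sn k).
  have [cq sq] := coef_L2 oO finO T0 Lq (ltn0Sn k).
  by apply: intgD => //; exact: L2_mul.
have sumE n : T / 2 * \sum_(0 <= k < n.+1) half_terms v q k =
    \int[vol]_(x in Omega) (sigma x * \sum_(k < n) p k.+1 x).
  rewrite big_ltn// half_terms0 add0r big_add1/= big_mkord mulr_sumr.
  have [_ h] := Rintegral_sum mO (index_enum 'I_n) (fun i : 'I_n => isp i).
  under eq_bigr do rewrite termE//.
  by rewrite -h; apply: eq_Rint => x _; rewrite mulr_sumr.
have hl : T / 2 * series (half_terms v q) n @[n --> \oo] -->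
    \int[vol]_(x in Omega) (sigma x * J x).
  rewrite -cvg_shiftS /series/=; under eq_cvg do rewrite sumE; exact: hlim.
have T2 : T / 2 != 0 by rewrite gt_eqF// divr_gt0.
have -> : half_form Omega T sigma v q = \int[vol]_(x in Omega) (sigma x * J x).
  rewrite half_formE; set L := \int[vol]_(x in Omega) _.
  have hs : series (half_terms v q) n @[n --> \oo] --> (T / 2)^-1 * L.
    have h : (T / 2)^-1 * (T / 2 * series (half_terms v q) n) @[n --> \oo] --> (T / 2)^-1 * L.
      by apply: cvgMr; exact: hl.
    by move: h; under eq_cvg do rewrite mulKf//.
  by rewrite (cvg_lim _ hs)// mulVKf.
have isgq : stvol.-integrable (QT Omega T) (EFin \o (fun u => sigma u.1 * g u * q u)).
  apply: (L2_mul mQ) => //; apply: (L2_bounded_mul mQ (c := s_hi)) => //.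
    exact: measurable_rect_fst.
  by move=> u [Ou _]; exact: sigma_hi.
have [_ ->] := Rfubini_rect1 mO mI isgq.
have igq1 := ae_intg1 mO mI igq.
apply: ae_eq_Rintegral => //.
- by apply: measurable_funM => //; exact: (measurable_time_integral oO igq).
- exact: (measurable_time_integral oO isgq).
move: igq1; apply: filterS => x h Ox; rewrite /J -RintegralZl//; last exact: h.
by apply: eq_Rint => t _; rewrite mulrA.
Qed.

End half_order_form.

(** * The energy spaces *)

Section spaces.
Context {R : realType} {d : nat}.
Variables (Omega : set 'rV[R]_d) (T : R).
Hypotheses (oO : open Omega) (finO : (lebesgue_rV d Omega < +oo)%E) (T0 : 0 < T).
Local Notation vol := (@lebesgue_rV R d).
Local Notation leb := (@lebesgue_measure R).
Local Notation I := `]0, T[%classic.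
Local Notation st := (spacetime R d).

Let mO : measurable Omega. Proof. exact: open_measurable_rV. Qed.
Let mI : measurable (I : set (measurableTypeR R)). Proof. exact: measurable_itv. Qed.
Let mQ : measurable (QT Omega T). Proof. exact: measurableX. Qed.

Lemma is_sgradB (v w : st -> R) g h : is_sgrad Omega T v g -> is_sgrad Omega T w h ->
  is_sgrad Omega T (v \- w) (fun u => g u - h u).
Proof.
move=> [mg hg] [mh hh]; split; first exact: measurable_rVB.
move: hg hh; apply: (@filterS2 _ _ (ae_filter_ringOfSetsType leb)) => t h1 h2 It.
exact: (is_wgradB oO finO (h1 It) (h2 It)).
Qed.

(** Uniqueness holds in almost every time slice, for each coordinate. *)
Lemma is_sgrad_unique (v : st -> R) g h : is_sgrad Omega T v g -> is_sgrad Omega T v h ->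
  \forall u \ae stvol, QT Omega T u -> g u = h u.
Proof.
move=> [mg hg] [mh hh].
have e (i : 'I_d) : \forall u \ae (@stvol R d), QT Omega T u -> g u ord0 i = h u ord0 i.
  apply: (@ae_rect_of_sections _ _ _ _ _ vol leb Omega I mO mI (fun u => g u ord0 i)
    (fun u => h u ord0 i)); try exact: measurable_fun_coord.
  move: hg hh; apply: (@filterS2 _ _ (ae_filter_ringOfSetsType leb)) => t h1 h2 It.
  have := is_wgrad_unique oO finO (h1 It) (h2 It).
  by apply: filterS => x h3 Ox; rewrite h3.
have : \forall u \ae (@stvol R d), forall i : 'I_d, QT Omega T u -> g u ord0 i = h u ord0 i.
  exact: filter_forall.
by apply: filterS => u hu Qu; apply/rowP => i; exact: hu.
Qed.

(** The representative picked for the difference need not be the difference of those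
    picked for each function, but uniqueness makes them equal almost everywhere. *)
Lemma sgradB (v w : st -> R) : is_sgrad Omega T v (sgrad Omega T v) ->
  is_sgrad Omega T w (sgrad Omega T w) ->
  is_sgrad Omega T (v \- w) (sgrad Omega T (v \- w)) /\
  \forall u \ae stvol, QT Omega T u ->
    sgrad Omega T (v \- w) u = sgrad Omega T v u - sgrad Omega T w u.
Proof.
move=> hv hw; have hB := is_sgradB hv hw.
have hs : is_sgrad Omega T (v \- w) (sgrad Omega T (v \- w)).
  by apply: (@xgetPex _ (cst 0) (is_sgrad Omega T (v \- w))); exists (fun u => sgrad Omega T v u - sgrad Omega T w u).
by split; [|exact: is_sgrad_unique hs hB].
Qed.

Lemma zero_lateralB (v w : st -> R) : zero_lateral Omega T v -> zero_lateral Omega T w ->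
  zero_lateral Omega T (v \- w).
Proof.
move=> hv hw; move: hv hw; apply: (@filterS2 _ _ (ae_filter_ringOfSetsType leb)) => t h1 h2 It.
exact: (H10B oO finO (h1 It) (h2 It)).
Qed.

Lemma H1halfB (v w : st -> R) : H1half Omega T v -> H1half Omega T w ->
  H1half Omega T (v \- w).
Proof.
move=> [Lv sv Lsv fv lv] [Lw sw Lsw fw lw].
have [sB eB] := sgradB sv sw; split.
- exact: (L2B mQ Lv Lw).
- exact: sB.
- apply: (ae_eq_L2v mQ (g := fun u => sgrad Omega T v u - sgrad Omega T w u)).
  + by case: sB.
  + by move: eB; apply: filterS => u h Qu; rewrite h.
  + exact: (L2vB mQ Lsv Lsw).
- exact: (half_norm2B_fin oO finO T0 Lv Lw fv fw).
- exact: (zero_lateralB lv lw).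
Qed.

Lemma H11_H1half (v : st -> R) : H11 Omega T v -> H1half Omega T v.
Proof.
move=> [Lv [sv Lsv] dv lv pv]; split; [exact: Lv|exact: sv|exact: Lsv| |exact: lv].
exact: (dt_half_norm2_fin oO finO T0 dv pv).
Qed.

(** The square integrability of the divergence on the cylinder is needed to
    integrate over time the identity known in each slice. *)
Lemma sdiv_ibp (rho : st -> 'rV[R]_d) (q : st -> R) : Hdiv Omega T rho ->
  L2Q Omega T (sdiv Omega T rho) -> H1half Omega T q ->
  \int[stvol]_(u in QT Omega T) dot (rho u) (sgrad Omega T q u) =
  - \int[stvol]_(u in QT Omega T) (sdiv Omega T rho u * q u).
Proof.
move=> [Lr [_ hr]] Lh [Lq [mq sq] Lsq _ lq].
have i1 := L2v_dot mQ Lr Lsq; have i2 := L2_mul mQ Lh Lq.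
have [j1 ->] := Rfubini_rect2 mO mI i1; have [j2 ->] := Rfubini_rect2 mO mI i2.
rewrite -RintegralN//; apply: ae_eq_Rintegral => //.
- exact: (intg_meas j1).
- by apply: measurableT_comp => //; exact: (intg_meas j2).
move: hr sq lq; apply: (@filterS3 _ _ (ae_filter_ringOfSetsType leb)) => t h1 h2 h3 It.
exact: (H10_ibp oO finO (h1 It) (h3 It) (h2 It)).
Qed.

Lemma friedrichs_QT (C_F : R) (q : st -> R) : friedrichs_constant Omega C_F ->
  H1half Omega T q ->
  (normQ Omega T q <= C_F%:E * normvQ Omega T (sgrad Omega T q))%E.
Proof.
move=> [C0 hF] [Lq [mq sq] Lsq _ lq].
have LE := ((L2vP _ _ _).1 Lsq).2.
rewrite /normQ /normvQ /L2normv !L2normEfin// -EFinM lee_fin.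
have C0' := ltW C0; rewrite -(ger0_norm C0') -sqrtr_sqr -sqrtrM ?sqr_ge0//.
apply: ler_wsqrtr; rewrite -RintegralZl//; last exact: L2_sqr.
have i1 := L2_sqr mQ Lq; have i2 := intgZ mQ (C_F ^+ 2) (L2_sqr mQ LE).
have [j1 ->] := Rfubini_rect2 mO mI i1; have [j2 ->] := Rfubini_rect2 mO mI i2.
apply: ae_le_Rintegral => //.
move: sq lq; apply: (@filterS2 _ _ (ae_filter_ringOfSetsType leb)) => t h1 h2 It.
have := hF _ _ (h2 It) (h1 It).
have [Lqt Lgt _] := h1 It; have LEt := ((L2vP _ _ _).1 Lgt).2.
rewrite /L2normv !L2normEfin// -EFinM lee_fin => h.
rewrite RintegralZl//; last exact: L2_sqr.
move: h; set a := \int[vol]_(x in Omega) _; set b := \int[vol]_(x in Omega) _ => h.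
have a0 : 0 <= a by apply: Rintegral_ge0 => x _; rewrite sqr_ge0.
have b0 : 0 <= b by apply: Rintegral_ge0 => x _; rewrite sqr_ge0.
by rewrite -(sqr_sqrtr a0) -(sqr_sqrtr b0) -exprMn ler_sqr ?nnegrE ?mulr_ge0 ?sqrtr_ge0.
Qed.

End spaces.

(** * The residual identity *)

Section residuals.
Context {R : realType} {d : nat}.
Variables (Omega : set 'rV[R]_d) (T : R).
Hypotheses (oO : open Omega) (finO : (lebesgue_rV d Omega < +oo)%E) (T0 : 0 < T).
Local Notation vol := (@lebesgue_rV R d).
Local Notation st := (spacetime R d).
Local Notation Q := (QT Omega T).
Local Notation L2Q := (L2Q Omega T).
Local Notation L2vQ := (L2vQ Omega T).
Local Notation H1half := (H1half Omega T).
Local Notation sgrad := (sgrad Omega T).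
Local Notation sdiv := (sdiv Omega T).
Local Notation dt := (dt Omega T).
Local Notation intQ f := (\int[stvol]_(u in Q) f u).
Variables (sigma nu : 'rV[R]_d -> R) (s_hi n_hi lambda : R).
Hypotheses (msigma : measurable_fun Omega sigma) (mnu : measurable_fun Omega nu)
  (sigma_hi : forall x, Omega x -> `|sigma x| <= s_hi)
  (nu_hi : forall x, Omega x -> `|nu x| <= n_hi).

Let mO : measurable Omega. Proof. exact: open_measurable_rV. Qed.
Let mI : measurable (`]0, T[%classic : set (measurableTypeR R)).
Proof. exact: measurable_itv. Qed.
Let mQ : measurable Q. Proof. exact: measurableX. Qed.

Lemma nu_grad_L2v (g : st -> 'rV[R]_d) : L2vQ g -> L2vQ (fun u => nu u.1 *: g u).
Proof.
apply: (L2v_bounded_mul mQ (k := n_hi)); first exact: measurable_rect_fst.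
by move=> u [Ou _]; exact: nu_hi.
Qed.

Lemma sigma_mul_L2 (g : st -> R) : L2Q g -> L2Q (fun u => sigma u.1 * g u).
Proof.
apply: (L2_bounded_mul mQ (c := s_hi)); first exact: measurable_rect_fst.
by move=> u [Ou _]; exact: sigma_hi.
Qed.

(** The part of the bilinear form without half-order derivatives. *)
Definition bulk (y p z q : st -> R) : R :=
  intQ (fun u => y u * z u) - intQ (fun u => dot (nu u.1 *: sgrad p u) (sgrad z u)) +
  intQ (fun u => dot (nu u.1 *: sgrad y u) (sgrad q u)) + lambda^-1 * intQ (fun u => p u * q u).

Lemma BE y p z q : H1half y -> H1half p -> H1half z -> H1half q ->
  B Omega T sigma nu lambda y p z q =
  bulk y p z q + half_form Omega T sigma p z + half_form Omega T sigma y q.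
Proof.
move=> [Ly _ Gy _ _] [Lp _ Gp _ _] [Lz _ Gz _ _] [Lq _ Gq _ _].
have i1 := L2_mul mQ Ly Lz; have i2 := L2v_dot mQ (nu_grad_L2v Gp) Gz.
have i3 := L2v_dot mQ (nu_grad_L2v Gy) Gq; have i4 := L2_mul mQ Lp Lq.
congr (_ + _ + _); rewrite /bulk -RintegralB// -RintegralD//; last exact: intgB.
rewrite -RintegralZl// -RintegralD//; last 2 first.
- by apply: intgD => //; exact: intgB.
- exact: intgZ.
by apply: eq_Rint => u _; rewrite !dotZl.
Qed.

Lemma bulkB y p y' p' z q : H1half y -> H1half p -> H1half y' -> H1half p' ->
  H1half z -> H1half q ->
  bulk (y \- y') (p \- p') z q = bulk y p z q - bulk y' p' z q.
Proof.
move=> hy hp hy' hp' hz hq.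
have [Ly sy Gy _ _] := hy; have [Lp sp Gp _ _] := hp; have [Ly' sy' Gy' _ _] := hy'.
have [Lp' sp' Gp' _ _] := hp'; have [Lz _ Gz _ _] := hz; have [Lq _ Gq _ _] := hq.
have linL (a a' b : st -> R) : L2Q a -> L2Q a' -> L2Q b ->
    intQ (fun u => (a \- a') u * b u) = intQ (fun u => a u * b u) - intQ (fun u => a' u * b u).
  move=> ha ha' hb; rewrite -RintegralB//; try exact: (L2_mul mQ).
  by apply: eq_Rint => u _; rewrite /= mulrBl.
have linG (a a' b : st -> R) : H1half a -> H1half a' -> L2vQ (sgrad b) ->
    intQ (fun u => dot (nu u.1 *: sgrad (a \- a') u) (sgrad b u)) =
    intQ (fun u => dot (nu u.1 *: sgrad a u) (sgrad b u)) -
    intQ (fun u => dot (nu u.1 *: sgrad a' u) (sgrad b u)).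
  move=> ha ha' hb; have [_ sa Ga _ _] := ha; have [_ sa' Ga' _ _] := ha'.
  have i1 := L2v_dot mQ (nu_grad_L2v Ga) hb; have i2 := L2v_dot mQ (nu_grad_L2v Ga') hb.
  have [_ _ GB _ _] := H1halfB oO finO T0 ha ha'.
  have i3 := L2v_dot mQ (nu_grad_L2v GB) hb.
  rewrite -RintegralB//; apply: ae_eq_Rintegral => //.
  - exact: (intg_meas i3).
  - exact: (intg_meas (intgB mQ i1 i2)).
  have [_] := sgradB oO finO sa sa'; apply: filterS => u h Qu.
  by rewrite h// scalerBr dotBl.
have alg (X1 X2 X3 X4 a a' b b' c c' e e' : R) :
    X1 = a - a' -> X2 = b - b' -> X3 = c - c' -> X4 = e - e' ->
    X1 - X2 + X3 + lambda^-1 * X4 =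
    (a - b + c + lambda^-1 * e) - (a' - b' + c' + lambda^-1 * e').
  by move=> -> -> -> ->; ring.
exact: (alg _ _ _ _ _ _ _ _ _ _ _ _ (linL _ _ _ Ly Ly' Lz) (linG _ _ _ hp hp' Gz)
  (linG _ _ _ hy hy' Gq) (linL _ _ _ Lp Lp' Lq)).
Qed.

Variables (y_d : st -> R) (y p eta zeta : st -> R) (tau rho : st -> 'rV[R]_d).
Hypotheses (Ld : L2Q y_d) (hy : H1half y) (hp : H1half p)
  (sol : optimality_system Omega T sigma nu lambda y_d y p)
  (heta : H11 Omega T eta) (hzeta : H11 Omega T zeta)
  (htau : Hdiv Omega T tau) (hrho : Hdiv Omega T rho)
  (Ltau : L2Q (sdiv tau)) (Lrho : L2Q (sdiv rho)).

Local Notation R1 := (R1 Omega T sigma lambda eta zeta tau).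
Local Notation R2 := (R2 Omega T nu eta tau).
Local Notation R3 := (R3 Omega T sigma y_d eta zeta rho).
Local Notation R4 := (R4 Omega T nu zeta rho).

(** The error satisfies the system with the residuals as data: the equations for
    [(y, p)] remove the exact solution, [half_form_dt] turns the half-order terms of
    [(eta, zeta)] into time derivatives, and [sdiv_ibp] inserts the fluxes. *)
Lemma residual_identity z q : H1half z -> H1half q ->
  B Omega T sigma nu lambda (y \- eta) (p \- zeta) z q =
  intQ (fun u => dot (R4 u) (sgrad z u)) - intQ (fun u => R3 u * z u) +
  (intQ (fun u => dot (R2 u) (sgrad q u)) - intQ (fun u => R1 u * q u)).
Proof.
move=> hz hq; have he := H11_H1half oO finO T0 heta; have hze := H11_H1half oO finO T0 hzeta.
have hB1 := H1halfB oO finO T0 hy he; have hB2 := H1halfB oO finO T0 hp hze.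
rewrite BE// bulkB//.
have [Ly _ _ fy _] := hy; have [Lp _ _ fp _] := hp.
have [Le _ Ge fe _] := he; have [Lze _ Gze fze _] := hze.
have [Lz _ Gz fz _] := hz; have [Lq _ Gq fq _] := hq.
rewrite (half_formB oO finO T0 msigma sigma_hi Lp Lze Lz)//.
rewrite (half_formB oO finO T0 msigma sigma_hi Ly Le Lq)//.
have := sol hz hq; rewrite BE//.
have [_ _ dteta _ peta] := heta; have [_ _ dtzeta _ pzeta] := hzeta.
rewrite (half_form_dt oO finO T0 msigma sigma_hi dteta peta Lq).
rewrite (half_form_dt oO finO T0 msigma sigma_hi dtzeta pzeta Lz).
have [_ Lde _] := dteta; have [_ Ldz _] := dtzeta.
have [Gtau _] := htau; have [Grho _] := hrho.
have e4 : intQ (fun u => dot (R4 u) (sgrad z u)) =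
   intQ (fun u => dot (nu u.1 *: sgrad zeta u) (sgrad z u)) - intQ (fun u => sdiv rho u * z u).
  have i1 := L2v_dot mQ Grho Gz; have i2 := L2v_dot mQ (nu_grad_L2v Gze) Gz.
  apply: (etrans (eq_Rint stvol (fun u _ => dotDl _ _ _))).
  by apply: (etrans (RintegralD mQ i1 i2)); rewrite (sdiv_ibp oO finO hrho Lrho hz) addrC.
have e2 : intQ (fun u => dot (R2 u) (sgrad q u)) =
   - intQ (fun u => dot (nu u.1 *: sgrad eta u) (sgrad q u)) - intQ (fun u => sdiv tau u * q u).
  have i1 := L2v_dot mQ Gtau Gq; have i2 := L2v_dot mQ (nu_grad_L2v Ge) Gq.
  apply: (etrans (eq_Rint stvol (fun u _ => dotBl _ _ _))).
  by apply: (etrans (RintegralB mQ i1 i2)); rewrite (sdiv_ibp oO finO htau Ltau hq) addrC.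
have iz1 := L2_mul mQ (sigma_mul_L2 Ldz) Lz; have iz2 := L2_mul mQ Le Lz.
have iz3 := L2_mul mQ Lrho Lz; have iz4 := L2_mul mQ Ld Lz.
have e3 : intQ (fun u => R3 u * z u) = intQ (fun u => sigma u.1 * dt zeta u * z u) +
   intQ (fun u => eta u * z u) - intQ (fun u => sdiv rho u * z u) - intQ (fun u => y_d u * z u).
  rewrite -RintegralD// -RintegralB//; last exact: intgD.
  rewrite -RintegralB//; last by apply: intgB => //; exact: intgD.
  by apply: eq_Rint => u _; rewrite /R3; ring.
have iq1 := L2_mul mQ (sigma_mul_L2 Lde) Lq; have iq2 := L2_mul mQ Lze Lq.
have iq3 := L2_mul mQ Ltau Lq.
have e1 : intQ (fun u => R1 u * q u) = intQ (fun u => sigma u.1 * dt eta u * q u) +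
   lambda^-1 * intQ (fun u => zeta u * q u) - intQ (fun u => sdiv tau u * q u).
  rewrite -RintegralZl// -RintegralD//; last exact: intgZ.
  rewrite -RintegralB//; last by apply: intgD => //; exact: intgZ.
  by apply: eq_Rint => u _; rewrite /R1; ring.
have alg (X1 X2 X3 X4 b1 h1 h2 Yd A1 B1 C1 D1 Sz Sq dz dq : R) :
    X4 = B1 - dz -> X3 = Sz + A1 - dz - Yd -> X2 = - C1 - dq ->
    X1 = Sq + lambda^-1 * D1 - dq -> b1 + h1 + h2 = Yd ->
    b1 - (A1 - B1 + C1 + lambda^-1 * D1) + (h1 - Sz) + (h2 - Sq) = (X4 - X3) + (X2 - X1).
  by move=> -> -> -> -> <-; ring.
exact: (alg _ _ _ _ _ _ _ _ _ _ _ _ _ _ _ _ e4 e3 e2 e1).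
Qed.

End residuals.

(** * The error bound *)

Section error_bound.
Context {R : realType} {d : nat}.
Variables (Omega : set 'rV[R]_d) (T : R).
Hypotheses (oO : open Omega) (finO : (lebesgue_rV d Omega < +oo)%E) (T0 : 0 < T).
Local Notation vol := (@lebesgue_rV R d).
Local Notation st := (spacetime R d).
Local Notation Q := (QT Omega T).
Local Notation L2Q := (L2Q Omega T).
Local Notation L2vQ := (L2vQ Omega T).
Local Notation H1half := (H1half Omega T).
Local Notation sgrad := (sgrad Omega T).
Local Notation sdiv := (sdiv Omega T).
Local Notation dt := (dt Omega T).
Local Notation normQ := (normQ Omega T).
Local Notation normvQ := (normvQ Omega T).

Let mO : measurable Omega. Proof. exact: open_measurable_rV. Qed.
Let mI : measurable (`]0, T[%classic : set (measurableTypeR R)).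
Proof. exact: measurable_itv. Qed.
Let mQ : measurable Q. Proof. exact: measurableX. Qed.

Lemma half_norm2_ge0 (v : st -> R) : (0 <= half_norm2 Omega T v)%E.
Proof.
apply: mule_ge0; first by rewrite lee_fin divr_ge0// ltW.
apply: nneseries_ge0 => k _ _; apply: mule_ge0.
  by rewrite lee_fin mulr_ge0// ltW// omega_gt0.
by apply: adde_ge0; rewrite expe2; apply: mule_ge0; exact: L2norm_ge0.
Qed.

Lemma seminorm2_fin (v : st -> R) : H1half v ->
  (normvQ (sgrad v) ^+ 2 <= seminorm2 Omega T v)%E /\ (seminorm2 Omega T v < +oo)%E.
Proof.
move=> [_ _ [mG Goo] foo _]; split; first by rewrite /seminorm2 leeDl// half_norm2_ge0.
rewrite /seminorm2 lte_add_pinfty// expe2 lte_mul_pinfty ?L2norm_ge0//.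
by rewrite ge0_fin_numE ?L2norm_ge0.
Qed.

Lemma sqrte_sum_bounds (m n a b : \bar R) : (0 <= m)%E -> (0 <= n)%E ->
  (m ^+ 2 <= a)%E -> (n ^+ 2 <= b)%E -> (a < +oo)%E -> (b < +oo)%E ->
  exists2 s, sqrte (a + b)%E = s%:E & [/\ 0 <= s, (m <= s%:E)%E & (n <= s%:E)%E].
Proof.
move=> m0 n0 ma nb aoo boo.
have sq0 (x : \bar R) : (0 <= x ^+ 2)%E by rewrite sqre_ge0.
have a0 := le_trans (sq0 m) ma; have b0 := le_trans (sq0 n) nb.
have s0 := adde_ge0 a0 b0.
have fs : sqrte (a + b)%E \is a fin_num.
  by rewrite (sqrte_fin_num s0) (ge0_fin_numE s0); exact: lte_add_pinfty.
exists (fine (sqrte (a + b)%E)); rewrite fineK//; split.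
- by apply: fine_ge0; exact: sqrte_ge0.
- rewrite -[leLHS]gee0_abs// -sqrte_sqr lee_sqrt//.
  by apply: (le_trans ma); rewrite leeDl.
rewrite -[leLHS]gee0_abs// -sqrte_sqr lee_sqrt//.
by apply: (le_trans nb); rewrite leeDr.
Qed.

Lemma pair_seminorm_bounds (z q : st -> R) : H1half z -> H1half q ->
  exists2 s, pair_seminorm Omega T z q = s%:E &
    [/\ 0 <= s, (normvQ (sgrad z) <= s%:E)%E & (normvQ (sgrad q) <= s%:E)%E].
Proof.
move=> /seminorm2_fin[hz zoo] /seminorm2_fin[hq qoo].
exact: (sqrte_sum_bounds (L2norm_ge0 _ _ _) (L2norm_ge0 _ _ _) hz hq zoo qoo).
Qed.

Lemma normQ_cauchy (f z : st -> R) (c : R) : L2Q f -> L2Q z -> (normQ z <= c%:E)%E ->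
  `|\int[stvol]_(u in Q) (f u * z u)| <= fine (normQ f) * c.
Proof.
move=> Lf Lz; rewrite /normQ !L2normEfin// lee_fin => zc.
by apply: (le_trans (cauchy_schwarz mQ Lf Lz)); rewrite ler_wpM2l ?sqrtr_ge0.
Qed.

Lemma normvQ_cauchy (f g : st -> 'rV[R]_d) (c : R) : L2vQ f -> L2vQ g ->
  (normvQ g <= c%:E)%E ->
  `|\int[stvol]_(u in Q) dot (f u) (g u)| <= fine (normvQ f) * c.
Proof.
move=> Lf Lg; have [_ Lf'] := (L2vP _ _ _).1 Lf; have [_ Lg'] := (L2vP _ _ _).1 Lg.
rewrite /normvQ /L2normv !L2normEfin// lee_fin => gc.
by apply: (le_trans (cauchy_schwarz_dot mQ Lf Lg)); rewrite ler_wpM2l ?sqrtr_ge0.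
Qed.

End error_bound.

Theorem theorem1 (R : realType) (d : nat) (d_range : (1 <= d <= 3)%N)
  (Omega : set 'rV[R]_d) (Omega_dom : bounded_lipschitz_domain Omega)
  (T : R) (T_gt0 : 0 < T)
  (sigma nu : 'rV[R]_d -> R) (sigma_lo sigma_hi nu_lo nu_hi : R)
  (sigma_meas : measurable_fun Omega sigma)
  (nu_meas : measurable_fun Omega nu)
  (sigma_lo_gt0 : 0 < sigma_lo) (nu_lo_gt0 : 0 < nu_lo)
  (sigma_bounds : forall x, Omega x -> sigma_lo <= sigma x <= sigma_hi)
  (nu_bounds : forall x, Omega x -> nu_lo <= nu x <= nu_hi)
  (C_F : R) (C_F_friedrichs : friedrichs_constant Omega C_F)
  (lambda : R) (lambda_gt0 : 0 < lambda)
  (y_d : spacetime R d -> R)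
  (y_d_L2 : L2Q Omega T y_d)
  (y p : spacetime R d -> R)
  (y_H : H1half Omega T y) (p_H : H1half Omega T p)
  (yp_sol : optimality_system Omega T sigma nu lambda y_d y p)
  (eta zeta : spacetime R d -> R)
  (eta_H : H11 Omega T eta) (zeta_H : H11 Omega T zeta)
  (tau rho : spacetime R d -> 'rV[R]_d)
  (tau_H : Hdiv Omega T tau) (rho_H : Hdiv Omega T rho)
  (B_inf_sup : inf_sup Omega T sigma nu lambda
                 (mu1_const nu_lo sigma_lo lambda)) :
  [/\ H1half Omega T (y \- eta), H1half Omega T (p \- zeta) &
    (pair_seminorm Omega T (y \- eta)%R (p \- zeta)%R <=
     (mu1_const nu_lo sigma_lo lambda)^-1%:E *
       (C_F%:E * normQ Omega T (R1 Omega T sigma lambda eta zeta tau)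
        + normvQ Omega T (R2 Omega T nu eta tau)
        + C_F%:E * normQ Omega T (R3 Omega T sigma y_d eta zeta rho)
        + normvQ Omega T (R4 Omega T nu zeta rho)))%E].
Proof.
have [_ oO _ bO _] := Omega_dom.
have mO : measurable Omega by exact: open_measurable_rV.
have finO : (lebesgue_rV d Omega < +oo)%E by exact: bounded_vol_fin.
have mI : measurable (`]0, T[%classic : set (measurableTypeR R)) by exact: measurable_itv.
have mQ : measurable (QT Omega T) by exact: measurableX.
have sigma_hi' x : Omega x -> `|sigma x| <= sigma_hi.
  move=> /sigma_bounds /andP[lo hi]; rewrite ger0_norm//.
  exact: le_trans (ltW sigma_lo_gt0) lo.
have nu_hi' x : Omega x -> `|nu x| <= nu_hi.
  move=> /nu_bounds /andP[lo hi]; rewrite ger0_norm//.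
  exact: le_trans (ltW nu_lo_gt0) lo.
have heta := H11_H1half oO finO T_gt0 eta_H; have hzeta := H11_H1half oO finO T_gt0 zeta_H.
have he1 := H1halfB oO finO T_gt0 y_H heta; have he2 := H1halfB oO finO T_gt0 p_H hzeta.
split; [exact: he1|exact: he2|].
have mu0 : 0 < mu1_const nu_lo sigma_lo lambda.
  by rewrite divr_gt0 ?sqrtr_gt0// mulr_gt0// lt_min ?nu_lo_gt0 ?sigma_lo_gt0// lambda_gt0 invr_gt0.
rewrite lee_pdivlMl//.
have C0 : 0 < C_F by case: C_F_friedrichs.
set N1 := normQ Omega T (R1 _ _ _ _ _ _ _); set N2 := normvQ Omega T (R2 _ _ _ _ _).
set N3 := normQ Omega T (R3 _ _ _ _ _ _ _); set N4 := normvQ Omega T (R4 _ _ _ _ _).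
have N10 : (0 <= N1)%E by exact: L2norm_ge0.
have N20 : (0 <= N2)%E by exact: L2norm_ge0.
have N30 : (0 <= N3)%E by exact: L2norm_ge0.
have N40 : (0 <= N4)%E by exact: L2norm_ge0.
have CN1 : (0 <= C_F%:E * N1)%E by rewrite mule_ge0// lee_fin ltW.
have CN3 : (0 <= C_F%:E * N3)%E by rewrite mule_ge0// lee_fin ltW.
have CF0 : (0 < C_F%:E)%E by rewrite lte_fin.
(* An infinite residual makes the right-hand side infinite. *)
have [N1oo|N1fin] := eqVneq N1 +oo%E.
  have ge0_neq (x : \bar R) : (0 <= x)%E -> x != -oo%E by case: x.
  rewrite N1oo gt0_muley// !addye ?leey// ge0_neq//.
have [N3oo|N3fin] := eqVneq N3 +oo%E.
  have ge0_neq (x : \bar R) : (0 <= x)%E -> x != -oo%E by case: x.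
  rewrite N3oo gt0_muley// addey ?ge0_neq ?adde_ge0//.
  by rewrite addye ?leey// ge0_neq.
have [Le _ Ge _ _] := heta; have [Lze _ Gze _ _] := hzeta.
have [_ _ [_ Lde _] _ _] := eta_H; have [_ _ [_ Ldz _] _ _] := zeta_H.
have [Gtau [mtau _]] := tau_H; have [Grho [mrho _]] := rho_H.
have sL := sigma_mul_L2 oO sigma_meas sigma_hi'.
have nL := nu_grad_L2v oO nu_meas nu_hi'.
have sde := sL _ _ Lde; have sdz := sL _ _ Ldz; have lze := L2Z mQ lambda^-1 Lze.
have LR1 : L2Q Omega T (R1 Omega T sigma lambda eta zeta tau).
  split; last by rewrite ltey.
  apply: measurable_funB => //; apply: measurable_funD; [by case: sde|by case: lze].
have LR3 : L2Q Omega T (R3 Omega T sigma y_d eta zeta rho).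
  split; last by rewrite ltey.
  apply: measurable_funB; last by case: y_d_L2.
  apply: measurable_funB => //; apply: measurable_funD; [by case: sdz|by case: Le].
have LR2 : L2vQ Omega T (R2 Omega T nu eta tau) by exact: (L2vB mQ Gtau (nL _ _ Ge)).
have LR4 : L2vQ Omega T (R4 Omega T nu zeta rho) by exact: (L2vD mQ Grho (nL _ _ Gze)).
(* A finite residual is square integrable, hence so is the divergence in it. *)
have Ltau : L2Q Omega T (sdiv Omega T tau).
  have := L2B mQ (L2D mQ sde lze) LR1; congr (L2 _ _ _); apply/funext => u.
  by rewrite /R1; ring.
have Lrho : L2Q Omega T (sdiv Omega T rho).
  have := L2B mQ (L2B mQ (L2D mQ sdz Le) y_d_L2) LR3; congr (L2 _ _ _); apply/funext => u.
  by rewrite /R3; ring.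
have E1 : N1 = (fine N1)%:E by rewrite fineK// ge0_fin_numE// ltey.
have E3 : N3 = (fine N3)%:E by rewrite fineK// ge0_fin_numE// ltey.
have E2 : N2 = (fine N2)%:E by rewrite fineK// ge0_fin_numE//; case: LR2.
have E4 : N4 = (fine N4)%:E by rewrite fineK// ge0_fin_numE//; case: LR4.
apply: (le_trans (B_inf_sup _ _ he1 he2)); apply: ge_ereal_sup => _ [z [q [hz hq _ ->]]].
have [s -> [s0 zs qs]] := pair_seminorm_bounds T_gt0 hz hq.
rewrite E1 E2 E3 E4 -!EFinM -!EFinD lee_fin /=.
have fN (x : \bar R) : (0 <= x)%E -> 0 <= fine x by exact: fine_ge0.
have [Lz _ Gz _ _] := hz; have [Lq _ Gq _ _] := hq.
have fz : (normQ Omega T z <= (C_F * s)%:E)%E.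
  apply: (le_trans (friedrichs_QT oO C_F_friedrichs hz)).
  rewrite EFinM; exact: (lee_wpmul2l (ltW CF0) zs).
have fq : (normQ Omega T q <= (C_F * s)%:E)%E.
  apply: (le_trans (friedrichs_QT oO C_F_friedrichs hq)).
  rewrite EFinM; exact: (lee_wpmul2l (ltW CF0) qs).
have b1 := normQ_cauchy oO LR1 Lq fq; have b3 := normQ_cauchy oO LR3 Lz fz.
have b2 := normvQ_cauchy oO LR2 Gq qs; have b4 := normvQ_cauchy oO LR4 Gz zs.
rewrite (residual_identity oO finO T_gt0 sigma_meas nu_meas sigma_hi' nu_hi' y_d_L2 y_H p_H
  yp_sol eta_H zeta_H tau_H rho_H Ltau Lrho hz hq).
move: b1 b2 b3 b4 (fN _ N10) (fN _ N20) (fN _ N30) (fN _ N40); rewrite -/N1 -/N2 -/N3 -/N4.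
have alg (X1 X2 X3 X4 r1 r2 r3 r4 : R) : `|X1| <= r1 * (C_F * s) -> `|X2| <= r2 * s ->
    `|X3| <= r3 * (C_F * s) -> `|X4| <= r4 * s -> 0 <= r1 -> 0 <= r2 -> 0 <= r3 -> 0 <= r4 ->
    (X4 - X3 + (X2 - X1)) / s <= C_F * r1 + r2 + C_F * r3 + r4.
  move=> h1 h2 h3 h4 r10 r20 r30 r40.
  have S0 : 0 <= C_F * r1 + r2 + C_F * r3 + r4.
    by rewrite !addr_ge0// mulr_ge0// ltW.
  (* A pair of seminorm zero gives a quotient by zero, which is zero. *)
  have [s_eq0|sn0] := eqVneq s 0; first by rewrite s_eq0 invr0 mulr0.
  have s_gt0 : 0 < s by rewrite lt_neqAle eq_sym sn0.
  rewrite ler_pdivrMr//.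
  have := ler_norm X4; have := ler_norm X2; have := ler_norm (- X3); have := ler_norm (- X1).
  by rewrite !normrN => g1 g3 g2 g4; lra.
exact: alg.
Qed.
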